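(* Let $n\ge 3$ be an integer and define the Riemann surface $\Sigma=(\mathbb{C}\setminus\mathcal{P})\cup\{\infty\}$ with $\mathcal{P}=\{z\in\mathbb{C}\mid z^n=1\}$. Let $$\xi=\begin{pmatrix}0 & \lambda^{-1}dz\\ v(\lambda)\dfrac{n^2z^{n-2}}{(z^n-1)^2}dz & 0\end{pmatrix},$$ where $$v(\lambda)=\frac{(n-2)^2w}{16n^2}(1-\lambda)^2+\frac{1-n}{n^2}\lambda,\qquad w\in\left[\frac{-8n}{(n-2)^2},\,0\right).$$ Let $w_0\in\widetilde\Sigma$ be a point in the fibre of $z_0=0\in\Sigma$ and let $\Phi$ be the solution of $d\Phi=\Phi\,\xi$, $\Phi(w_0)=\mathrm{Id}$. Then there exists an initial condition that unitarises the monodromy of $\Phi$.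
   Context: $\widetilde\Sigma$ is the universal cover of $\Sigma$ and $\Delta$ its group of deck transformations; $\lambda\in\mathbb{C}\setminus\{0\}$ is the spectral parameter. For $\gamma\in\Delta$, the monodromy $M_\gamma(\lambda)\in\mathrm{SL}_2(\mathbb{C})$ of $\Phi$ is defined by $\Phi(\gamma(p),\lambda)=M_\gamma(\lambda)\Phi(p,\lambda)$ for $p\in\widetilde\Sigma$ (the singularity of the displayed form of $\xi$ at $z=\infty$ is treated as part of the data: the loop around $\infty$ has trivial monodromy, so the monodromy of $\Phi$ is that along loops in $\mathbb{C}\setminus\mathcal{P}$ based at $0$). ''There exists an initial condition that unitarises the monodromy of $\Phi$'' means: there exist $r\in(0,1)$ and a map $h$ with values in $\mathrm{GL}_2(\mathbb{C})$, holomorphic in a neighbourhood of the circle $\{|\lambda|=r\}$, such that for every $\gamma$ the map $\lambda\mapsto h(\lambda)M_\gamma(\lambda)h(\lambda)^{-1}$ (which is the monodromy of the solution $h\Phi$ of $d\Psi=\Psi\xi$, $\Psi(w_0)=h$) extends holomorphically from a neighbourhood of that circle to a neighbourhood of the closed annulus $\{r\le|\lambda|\le 1/r\}$ and takes values in $\mathrm{SU}_2$ for $|\lambda|=1$. *)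

(* Defs.v *)
From HB Require Import structures.
From mathcomp Require Import all_boot all_order all_algebra spectral.
From mathcomp Require Import complex.
From mathcomp Require Import all_classical all_reals topology normedtype derive.

Set Implicit Arguments.
Unset Strict Implicit.
Unset Printing Implicit Defensive.

Import Order.TTheory GRing.Theory Num.Theory.
Import numFieldNormedType.Exports.

Local Open Scope classical_set_scope.
Local Open Scope ring_scope.
Local Open Scope complex_scope.

(* Packaging R[i] as a numClosedFieldType gives it the norm topology of
   numFieldNormedType; with [CC R] as scalar field, [derivable F z 1] is complex
   differentiability of F at z. *)
Definition CC (R : realType) : numClosedFieldType := R[i].

(* The point at infinity is [None]; z in C is [Some z]. *)
Definition sphere (R : realType) := one_point_compactification (CC R).

Section Coverings.
Variables (R : realType).

Definition homeo_onto (T U : topologicalType) (f : T -> U)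
    (A : set T) (B : set U) :=
  exists g : U -> T,
    [/\ (forall t, A t -> B (f t) /\ g (f t) = t),
        (forall u, B u -> A (g u) /\ f (g u) = u),
        {within A, continuous f} & {within B, continuous g}].

Definition evenly_covered (E X : topologicalType) (p : E -> X) (U : set X) :=
  exists (I : Type) (V : I -> set E),
    [/\ (forall i, open (V i)), trivIset [set: I] V,
        p @^-1` U = \bigcup_i V i & forall i, homeo_onto p (V i) U].

(* Covering of the open subset S of X; as S is open, its open subsets are the
   open sets of X contained in S. *)
Definition covering_map (E X : topologicalType) (p : E -> X) (S : set X) :=
  [/\ continuous p, range p = S &
      forall x, S x ->
        exists U : set X, [/\ open U, U x, U `<=` S & evenly_covered p U]].

Definition path_connected (E : topologicalType) :=
  forall x y : E, exists c : R -> E,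
    [/\ {within `[0, 1], continuous c}, c 0 = x & c 1 = y].

Definition null_homotopic (E : topologicalType) (c : R -> E) :=
  exists H : R * R -> E,
    [/\ {within `[0, 1] `*` `[0, 1], continuous H},
        (forall t, t \in `[0, 1] -> H (0, t) = c t),
        (forall t, t \in `[0, 1] -> H (1, t) = c 0) &
        (forall s, s \in `[0, 1] -> H (s, 0) = c 0 /\ H (s, 1) = c 0)].

Definition simply_connected (E : topologicalType) :=
  path_connected E /\
  forall c : R -> E, {within `[0, 1], continuous c} -> c 0 = c 1 ->
    null_homotopic c.

Definition universal_covering (E X : topologicalType) (p : E -> X)
    (S : set X) :=
  covering_map p S /\ simply_connected E.

Definition deck_transformation (E X : topologicalType) (p : E -> X)
    (g : E -> E) :=
  (forall e, p (g e) = p e) /\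
  exists g' : E -> E,
    [/\ continuous g, continuous g', cancel g g' & cancel g' g].

End Coverings.

Section Potential.
Variables (R : realType) (n : nat) (w : R).
Local Notation C := (CC R).

Definition Sigma : set (sphere R) :=
  [set x | if x is Some z then z ^+ n <> 1 else True].

Definition v (lam : C) : C :=
  (n%:R - 2) ^+ 2 * w%:C / (16 * n%:R ^+ 2) * (1 - lam) ^+ 2
  + (1 - n%:R) / n%:R ^+ 2 * lam.

(* The coefficient of dz in xi. *)
Definition xi (lam z : C) : 'M[C]_2 :=
  \matrix_(i < 2, j < 2)
    if (i == 0) && (j == 1) then lam^-1
    else if (i == 1) && (j == 0) then
      v lam * (n%:R ^+ 2 * z ^+ (n - 2) / (z ^+ n - 1) ^+ 2)
    else 0.

End Potential.

Arguments Sigma : clear implicits.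

Section Monodromy.
Variables (R : realType) (E : topologicalType) (p : E -> sphere R).
Local Notation C := (CC R).

(* d Phi = Phi (A dz) on the part of E lying over C, where z \o p is a local
   complex coordinate: near e0, Phi is F \o z with F' = F A. Nothing is
   required of Phi over infinity, where A dz may be singular; since p covers
   Sigma, infinity included, a function Phi on E is single-valued around the
   points over infinity. *)
Definition solution (A : C -> C -> 'M[C]_2) (Phi : E -> C -> 'M[C]_2) :=
  forall lam : C, lam != 0 -> forall (e0 : E) (z0 : C), p e0 = Some z0 ->
    exists F : C -> 'M[C]_2,
      (\forall z \near z0, is_derive (z : C) 1 F (F z *m A lam z)) /\
      (\forall e \near e0, forall z, p e = Some z -> Phi e lam = F z).

Definition is_monodromy (Phi : E -> C -> 'M[C]_2) (g : E -> E)
    (M : C -> 'M[C]_2) :=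
  forall lam : C, lam != 0 ->
    \det (M lam) = 1 /\
    forall (e : E) (z : C), p e = Some z -> Phi (g e) lam = M lam *m Phi e lam.

Definition circle (r : R) : set C := [set lam | `|lam| = r%:C].

Definition annulus (r : R) : set C :=
  [set lam | r%:C <= `|lam| <= (r^-1)%:C].

Definition near_set (K : set C) (P : C -> Prop) :=
  forall x, K x -> \forall y \near x, P y.

Definition holomorphic_near (K : set C) (F : C -> 'M[C]_2) :=
  near_set K (fun y : C => derivable F y 1).

Definition in_SU2 (A : 'M[C]_2) := A \is unitarymx /\ \det A = 1.

Definition unitarisable (Phi : E -> C -> 'M[C]_2) :=
  exists (r : R) (h : C -> 'M[C]_2),
    [/\ 0 < r < 1,
        holomorphic_near (circle r) h,
        near_set (circle r) (fun lam => h lam \in unitmx) &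
        forall g : E -> E, deck_transformation p g ->
          exists M : C -> 'M[C]_2, is_monodromy Phi g M /\
          exists G : C -> 'M[C]_2,
            [/\ holomorphic_near (annulus r) G,
                near_set (circle r)
                  (fun lam => G lam = h lam *m M lam *m invmx (h lam)) &
                forall lam, `|lam| = 1 -> in_SU2 (G lam)]].

End Monodromy.

(* Main.v *)
Require Import Defs.
From HB Require Import structures.
From mathcomp Require Import all_boot all_order all_algebra spectral.
From mathcomp Require Import complex ring lra zify.
From mathcomp Require Import all_classical all_reals all_analysis.

Set Implicit Arguments.
Unset Strict Implicit.
Unset Printing Implicit Defensive.

Import Order.TTheory GRing.Theory Num.Theory.
Import numFieldNormedType.Exports.

Local Open Scope classical_set_scope.
Local Open Scope ring_scope.

(** Multiplying out dPhi = Phi xi, the rows of Phi are (lam b', b) where b runs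
through the solutions of b'' = mu q b, with mu = v / lam and
q = n^2 z^(n-2) / (z^n - 1)^2. The monodromy is computed from explicit frames
of solutions of this scalar equation, and then conjugated by an explicit gauge.

The frames. In the coordinate z^n / (z^n - 1) the equation is hypergeometric at
0; this gives a frame [fund0], equal to 1 at z = 0, where Re z^n < 1/2, and by
inversion one at infinity. In the coordinate tau^2, tau = (1 - z^n) / (1 + z^n),
it is hypergeometric at the roots of unity, with exponents s and 1 - s,
s (s - 1) = mu; this gives, for each logarithm of tau, a frame [fund1] where
Re z^n > 0. Uniqueness of solutions is everywhere reduced to the constancy of
Wronskians. Since z -> 1/z turns tau into - tau, a half turn of tau exchanges 0
and infinity: it multiplies [fund1] by the connection matrix B between the
frames at 0 and at infinity ([fund1_step]). Together with the rotations
z -> om z, om^n = 1, which act by diag(om, 1) and diag(1, om), all changes of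
frame are products of such diagonal matrices and of powers of B
([frame_unique]). The determinant of B is -1; its trace is that of the half turn
in the exponents, and a comparison on both sides of the real axis gives one more
equation, so that the diagonal of B is (- zeta kappa, kappa / zeta), with
zeta = exp (i pi / n) and kappa = sin (pi s) / sin (pi / n)
([conn_mx_entries]).

The gauge. With s = 1/2 + nu one has nu^2 = 1/4 + mu, which is real when
|lam| = 1, and
  1 - kappa^2 = (nu^2 - nu0^2) (nu1^2 - nu^2) U, nu0, nu1 = 1/2 -+ 1/n,
with U > 0 on the unit circle. Here nu^2 - nu0^2 is a positive multiple of
(1 - lam) (1 - 1/lam), and the lower bound on w is what makes nu1^2 - nu^2 a
product (al + de lam) (al + de / lam) with real al and de. Hence
1 - kappa^2 = beta betat with beta and betat holomorphic near the unit circle and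
conjugate on it. The product of the off-diagonal entries of B is 1 - kappa^2 too,
so conjugation by diag(beta / B_01, 1) replaces them by beta and betat: B becomes
holomorphic near the unit circle and unitary on it ([gauge_conn],
[gauged_conn_unitary]), and diagonal matrices are unchanged. The gauge itself
degenerates at lam = 1, which is why it is used on a circle of radius r < 1.

Globalisation. Consider the points of the covering at which Phi is, up to factors
diag(1/lam, 1) on the left and diag(lam, 1) on the right, the product of a matrix
that the gauge makes unitary ([gauge_group]) and of a frame. They form an open
and closed set: locally Phi and the frames satisfy the same equation, and changes
of frame are such matrices. The part of the covering that lies over C is
connected, because a point over infinity has connected punctured neighbourhoods
([lift_connected]). So Phi has this form at the image of w0 under every deck
transformation, and its value there is the monodromy. *)

(** * Complex differentiability *)

Section ComplexBasics.
Variable R : realType.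
Local Notation C := (CC R).
Implicit Types z w : C.

(** The modulus as a real number: the norm of CC R has values in CC R. *)
Definition cabs (z : C) : R := Normc.normc z.

Lemma normCE z : `|z| = (cabs z)%:C%C.
Proof. by []. Qed.

Lemma ReD z w : complex.Re (z + w) = complex.Re z + complex.Re w.
Proof. by case: z w => ? ? []. Qed.
Lemma ImD z w : complex.Im (z + w) = complex.Im z + complex.Im w.
Proof. by case: z w => ? ? []. Qed.
Lemma ReN z : complex.Re (- z) = - complex.Re z.
Proof. by case: z. Qed.
Lemma ImN z : complex.Im (- z) = - complex.Im z.
Proof. by case: z. Qed.
Lemma ReMc z w : complex.Re (z * w) =
  complex.Re z * complex.Re w - complex.Im z * complex.Im w.
Proof. by case: z w => ? ? []. Qed.
Lemma ImMc z w : complex.Im (z * w) =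
  complex.Re z * complex.Im w + complex.Im z * complex.Re w.
Proof. by case: z w => ? ? []. Qed.
Lemma Re_rc (t : R) : complex.Re ((t%:C)%C : C) = t. Proof. by []. Qed.
Lemma Im_rc (t : R) : complex.Im ((t%:C)%C : C) = 0. Proof. by []. Qed.
Lemma Re1 : complex.Re (1 : C) = 1. Proof. by []. Qed.
Lemma Im1 : complex.Im (1 : C) = 0. Proof. by []. Qed.
Lemma Re_i : complex.Re ('i%C : C) = 0. Proof. by []. Qed.
Lemma Im_i : complex.Im ('i%C : C) = 1. Proof. by []. Qed.
Lemma ReZ (t : R) z : complex.Re ((t%:C)%C * z) = t * complex.Re z.
Proof. by rewrite ReMc Re_rc Im_rc mul0r subr0. Qed.
Lemma ImZ (t : R) z : complex.Im ((t%:C)%C * z) = t * complex.Im z.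
Proof. by rewrite ImMc Re_rc Im_rc mul0r addr0. Qed.
Lemma Re_Mi z : complex.Re ('i%C * z) = - complex.Im z.
Proof. by rewrite ReMc Re_i Im_i mul0r mul1r sub0r. Qed.
Lemma Im_Mi z : complex.Im ('i%C * z) = complex.Re z.
Proof. by rewrite ImMc Re_i Im_i mul0r mul1r add0r. Qed.
Lemma ReC (a b : R) : complex.Re (Complex a b) = a. Proof. by []. Qed.
Lemma ImC (a b : R) : complex.Im (Complex a b) = b. Proof. by []. Qed.
Definition ReIm := (ReZ, ImZ, Re_Mi, Im_Mi, ReD, ImD, ReN, ImN, ReMc, ImMc,
  Re1, Im1, Re_i, Im_i, Re_rc, Im_rc, ReC, ImC).

Lemma complexPE z w : complex.Re z = complex.Re w ->
  complex.Im z = complex.Im w -> z = w.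
Proof. by case: z w => ? ? [? ?] /= -> ->. Qed.

Lemma scaleCE z w : z *: (w : C) = z * w. Proof. by []. Qed.

Lemma cabs_ge0 z : 0 <= cabs z.
Proof. by case: z => a b; exact: sqrtr_ge0. Qed.

Lemma cabsM z w : cabs (z * w) = cabs z * cabs w.
Proof. exact: Normc.normcM. Qed.

Lemma cabsV z : cabs z^-1 = (cabs z)^-1.
Proof. exact: Normc.normcV. Qed.

Lemma cabsD z w : cabs (z + w) <= cabs z + cabs w.
Proof. by rewrite -lecR rmorphD -!normCE; exact: (@ler_normD _ R[i]). Qed.

Lemma cabsN z : cabs (- z) = cabs z.
Proof. by apply: (@complexI R); rewrite -!normCE; exact: (@normrN R[i] R[i]). Qed.

Lemma cabsB z w : cabs (z - w) <= cabs z + cabs w.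
Proof. by rewrite (le_trans (cabsD _ _))// cabsN. Qed.

Lemma cabsC z w : cabs (z - w) = cabs (w - z).
Proof. by rewrite -cabsN opprB. Qed.

Lemma cabs0 : cabs 0 = 0. Proof. exact: Normc.normc0. Qed.
Lemma cabs1 : cabs 1 = 1. Proof. exact: Normc.normc1. Qed.

Lemma cabs_eq0 z : (cabs z == 0) = (z == 0).
Proof.
apply/eqP/eqP => [|->]; last exact: cabs0.
exact: Normc.eq0_normc.
Qed.

Lemma cabs_gt0 z : (0 < cabs z) = (z != 0).
Proof. by rewrite lt_neqAle cabs_ge0 andbT eq_sym cabs_eq0. Qed.

Lemma cabsX z n : cabs (z ^+ n) = cabs z ^+ n.
Proof. by elim: n => [|n ih]; rewrite ?expr0 ?cabs1// !exprS cabsM ih. Qed.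

Lemma cabsR (a : R) : cabs (a%:C)%C = `|a|.
Proof. by rewrite /cabs/= expr0n/= addr0 sqrtr_sqr. Qed.

Lemma cabs_nat n : cabs n%:R = n%:R.
Proof. by rewrite -[n%:R](rmorph_nat (real_complex R)) cabsR normr_nat. Qed.

Lemma Re_le_cabs z : `|complex.Re z| <= cabs z.
Proof. by rewrite -lecR -normCE; exact: normc_ge_Re. Qed.

Lemma Im_le_cabs z : `|complex.Im z| <= cabs z.
Proof.
case: z => a b; rewrite /cabs/= -sqrtr_sqr ler_wsqrtr//.
by rewrite lerDr sqr_ge0.
Qed.

Lemma cabs_le z : cabs z <= `|complex.Re z| + `|complex.Im z|.
Proof.
case: z => a b; rewrite /cabs/= -[leRHS]ger0_norm ?addr_ge0//.
rewrite -sqrtr_sqr ler_wsqrtr// sqrrD !real_normK ?num_real//.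
have : 0 <= `|a| * `|b| by exact: mulr_ge0.
by lra.
Qed.

Lemma cabs_sqr z : cabs z ^+ 2 = complex.Re z ^+ 2 + complex.Im z ^+ 2.
Proof. by case: z => a b; rewrite /cabs/= sqr_sqrtr// addr_ge0 ?sqr_ge0. Qed.

Lemma nbhsCP z (P : set C) :
  nbhs z P <-> exists2 e : R, 0 < e & forall w, cabs (w - z) < e -> P w.
Proof.
split.
  move/nbhs_ballP => [e /= e0 H].
  move: e0; rewrite ltcE => /andP[/eqP/= eI e0].
  exists (complex.Re e) => // w Hw; apply: H.
  rewrite /ball/= /ball_/= distrC normCE ltcE/= eI eqxx/=.
  exact: Hw.
case=> e e0 H; apply/nbhs_ballP; exists (e%:C)%C => /=; first by rewrite ltcR.
move=> w; rewrite /ball/= /ball_/= distrC normCE ltcR; exact: H.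
Qed.

(** The form of differentiability with a remainder, on which the chain rule and
termwise differentiation rest. *)
Lemma cder_eps (f : C -> C) z d : is_derive z 1 f d <->
  forall e : R, 0 < e -> exists2 r : R, 0 < r & forall w, cabs (w - z) < r ->
    cabs (f w - f z - d * (w - z)) <= e * cabs (w - z).
Proof.
have -> : is_derive z 1 f d <->
    (fun h : C => h^-1 *: ((f \o shift z) (h *: (1 : C)) - f z)) @ 0^' --> d.
  split=> [[df <-]|cv]; first exact: df.
  apply: DeriveDef; last exact: cvg_lim.
  by apply/cvg_ex; exists d.
split=> [cv e e0|H].
  have /cvgrPdist_lt/(_ (e%:C)%C) := cv.
  rewrite ltcR => /(_ e0); rewrite /dnbhs/within/= => /nbhsCP[r r0 Hr].
  exists r => // w wz; have [->|wz0] := eqVneq w z.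
    by rewrite !subrr mulr0 subr0 cabs0 mulr0.
  have h0 : w - z != 0 by rewrite subr_eq0.
  have := Hr (w - z); rewrite subr0 => /(_ wz h0).
  rewrite normCE ltcR /= => /ltW.
  rewrite /shift/= [(w - z) *: 1]mulr1 subrK => le.
  have -> : f w - f z - d * (w - z) =
     - ((d - (w - z)^-1 *: (f w - f z)) * (w - z)).
    rewrite mulrBl scaleCE.
    by rewrite mulrAC mulVf// mul1r opprB.
  by rewrite cabsN cabsM ler_wpM2r// cabs_ge0.
apply/cvgrPdist_le => e e0.
have [E E0 eE] : exists2 E : R, 0 < E & e = (E%:C)%C.
  move: e0; rewrite ltcE => /andP[/eqP/= eI e0]; exists (complex.Re e) => //.
  by case: e eI {e0} => a b /= ->.
have [r r0 Hr] := H _ E0.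
rewrite /dnbhs/within/=; apply/nbhsCP; exists r => // h.
rewrite subr0 => hr h0; rewrite eE normCE lecR.
have := Hr (h + z); rewrite addrK => /(_ hr) {}Hr.
rewrite /shift/= [h *: 1]mulr1.
have -> : d - h^-1 *: (f (h + z) - f z) = - (h^-1 * (f (h + z) - f z - d * h)).
  by rewrite scaleCE [in RHS]mulrBr opprB [h^-1 * (d * h)]mulrCA mulVf// mulr1.
by rewrite cabsN cabsM cabsV [leLHS]mulrC ler_pdivrMr ?cabs_gt0.
Qed.

Notation cder f z d := (is_derive (z : C) (1 : C) (f : C -> C) (d : C)).

Lemma cder_eq (f : C -> C) z d d' : cder f z d -> d = d' -> cder f z d'.
Proof. by move=> ? <-. Qed.

Lemma cder_cts (f : C -> C) z d : cder f z d -> {for z, continuous f}.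
Proof. by move=> fd; apply/differentiable_continuous/derivable1_diffP. Qed.

Lemma cderc (a : C) z : cder (fun=> a) z 0.
Proof. exact: is_derive_cst. Qed.

Lemma cderid z : cder (fun w => w) z 1.
Proof. exact: is_derive_id. Qed.

Lemma cderD (f g : C -> C) z a b :
  cder f z a -> cder g z b -> cder (fun w => f w + g w) z (a + b).
Proof. by move=> ? ?; exact: is_deriveD. Qed.

Lemma cderN (f : C -> C) z a : cder f z a -> cder (fun w => - f w) z (- a).
Proof. by move=> ?; exact: is_deriveN. Qed.

Lemma cderB (f g : C -> C) z a b :
  cder f z a -> cder g z b -> cder (fun w => f w - g w) z (a - b).
Proof. by move=> ? ?; exact: is_deriveB. Qed.

Lemma cderM (f g : C -> C) z a b : cder f z a -> cder g z b ->
  cder (fun w => f w * g w) z (a * g z + f z * b).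
Proof.
move=> fa gb; apply: cder_eq (is_deriveM fa gb) _.
by rewrite !scaleCE addrC [g z * a]mulrC.
Qed.

Lemma cderZ (k : C) (f : C -> C) z a : cder f z a ->
  cder (fun w => k * f w) z (k * a).
Proof.
by move=> fa; apply: cder_eq (cderM (cderc k z) fa) _; rewrite mul0r add0r.
Qed.

Lemma cderX (f : C -> C) z a k : cder f z a ->
  cder (fun w => f w ^+ k) z (k%:R * f z ^+ k.-1 * a).
Proof.
move=> fa; elim: k => [|k ih].
  by rewrite mul0r mul0r; apply: (cder_eq (cderc 1 z)).
have -> : (fun w => f w ^+ k.+1) = (fun w => f w * f w ^+ k).
  by apply/funext => w; rewrite exprS.
apply: cder_eq (cderM fa ih) _; rewrite /=; case: k {ih} => [|k] /=.
  by rewrite expr0; ring.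
by rewrite -[k.+2%:R]natr1 exprS; ring.
Qed.

Lemma cderV (f : C -> C) z a : f z != 0 -> cder f z a ->
  cder (fun w => (f w)^-1) z (- a / f z ^+ 2).
Proof.
move=> fz fa; apply: DeriveDef; first exact: derivableV.
by rewrite deriveV// derive_val scaleCE mulrC mulrN mulNr.
Qed.

Lemma cder_comp (f g : C -> C) z a b : cder f z a -> cder g (f z) b ->
  cder (fun w => g (f w)) z (b * a).
Proof.
move=> /cder_eps fa /cder_eps gb; apply/cder_eps => e e0.
pose A := cabs a + 1.
have A0 : 0 < A by rewrite ltr_wpDl// cabs_ge0.
pose e1 := e / (2 * A); have e10 : 0 < e1 by rewrite divr_gt0// mulr_gt0.
have [r1 r10 H1] := gb _ e10.
pose e2 := Num.min 1 (e / (2 * (cabs b + 1))).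
have b0 : 0 < cabs b + 1 by rewrite ltr_wpDl// cabs_ge0.
have e20 : 0 < e2 by rewrite lt_min ltr01 divr_gt0// mulr_gt0.
have [r2 r20 H2] := fa _ e20.
exists (Num.min r2 (r1 / A)) => [|w].
  by rewrite lt_min r20 divr_gt0.
rewrite lt_min => /andP[wr2 wr1].
have := H2 _ wr2; set D := f w - f z - _ => HD.
have fwz : f w - f z = D + a * (w - z) by rewrite /D subrK.
have lefwz : cabs (f w - f z) <= A * cabs (w - z).
  rewrite fwz (le_trans (cabsD _ _))// cabsM /A mulrDl addrC lerD2l.
  by rewrite (le_trans HD)// ler_wpM2r ?cabs_ge0// ge_min lexx.
have /H1 : cabs (f w - f z) < r1.
  by rewrite (le_lt_trans lefwz)// mulrC -ltr_pdivlMr.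
set E := g (f w) - _ - _ => HE.
have -> : g (f w) - g (f z) - b * a * (w - z) = E + b * D.
  by rewrite /E fwz; ring.
rewrite (le_trans (cabsD _ _))// cabsM.
have c0 := cabs_ge0 (w - z).
have le1 : cabs E <= e / 2 * cabs (w - z).
  rewrite (le_trans HE)// (le_trans (ler_wpM2l (ltW e10) lefwz))//.
  by rewrite /e1 invfM !mulrA divfK ?gt_eqF.
have le2 : cabs b * cabs D <= e / 2 * cabs (w - z).
  apply: (@le_trans _ _ ((cabs b + 1) * (e2 * cabs (w - z)))).
    by rewrite ler_pM ?cabs_ge0// lerDl.
  rewrite mulrA ler_wpM2r//.
  apply: (@le_trans _ _ ((cabs b + 1) * (e / (2 * (cabs b + 1))))).
    by rewrite ler_wpM2l ?(ltW b0)// ge_min lexx orbT.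
  have -> : (cabs b + 1) * (e / (2 * (cabs b + 1))) = e / 2.
    by field; rewrite gt_eqF.
  by [].
by lra.
Qed.

Lemma cder_near (f g : C -> C) z a : (\forall w \near z, f w = g w) ->
  cder f z a -> cder g z a.
Proof.
by move=> fg fa; exact: near_eq_is_derive fg fa.
Qed.

(** The real and imaginary parts, restricted to the segment, have vanishing
derivative, so the real mean value theorem applies to them. *)
Lemma cder0_cst (f : C -> C) z w :
  (forall t : R, 0 <= t <= 1 -> cder f (z + (t%:C)%C * (w - z)) 0) -> f z = f w.
Proof.
move=> f0.
pose g (k : C -> R) (t : R) := k (f (z + (t%:C)%C * (w - z))).
have gE (k : C -> R) : (forall u v, k (u - v) = k u - k v) ->
    (forall u, `|k u| <= cabs u) -> g k 0 = g k 1.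
  move=> kB kle.
  have H (t : R) : 0 <= t <= 1 -> is_derive t 1 (g k) 0.
    move=> /f0 /cder_eps Ht.
    have cv : (fun h : R => h^-1 *: ((g k \o shift t) (h *: (1 : R)) - g k t))
        @ 0^' --> (0 : R).
      apply/cvgrPdist_le => e e0.
      pose A := cabs (w - z) + 1.
      have A0 : 0 < A by rewrite ltr_wpDl// cabs_ge0.
      have [r r0 Hr] := Ht _ (divr_gt0 e0 A0).
      rewrite /dnbhs/within/=; apply/nbhs_ballP; exists (r / A) => /=.
        by rewrite divr_gt0.
      move=> h; rewrite /ball/= sub0r normrN ltr_pdivlMr// => hA h0.
      rewrite sub0r normrN normrM normfV mulrC ler_pdivrMr ?normr_gt0//.
      rewrite /shift/= [h *: 1]mulr1 /g -kB (le_trans (kle _))//.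
      have E : z + ((h + t)%:C)%C * (w - z) - (z + (t%:C)%C * (w - z))
               = (h%:C)%C * (w - z).
        by rewrite rmorphD/=; ring.
      have le1 : cabs ((h%:C)%C * (w - z)) <= `|h| * A.
        by rewrite cabsM cabsR ler_wpM2l// lerDl.
      have := Hr (z + ((h + t)%:C)%C * (w - z)).
      rewrite E mul0r subr0 => /(_ (le_lt_trans le1 hA)) /le_trans; apply.
      have -> : e * `|h| = e / A * (`|h| * A) by field; rewrite gt_eqF.
      by rewrite ler_wpM2l// divr_ge0 ?ltW.
    by apply: DeriveDef; [apply/cvg_ex; exists 0|exact: cvg_lim cv].
  have H1 (t : R) : t \in `]0, 1[%R -> is_derive t 1 (g k) ((fun=> 0) t).
    by rewrite in_itv/= => /andP[t0 t1]; apply: H; rewrite !ltW.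
  have H2 : {within `[0, 1], continuous (g k)}.
    by apply: derivable_within_continuous => t; rewrite in_itv/= => /H [].
  have [c _] := MVT_segment ler01 H1 H2.
  by rewrite mul0r => /eqP; rewrite subr_eq0 => /eqP.
have := gE (@complex.Re R); have := gE (@complex.Im R).
rewrite /g mul0r addr0 mul1r addrC subrK => HI HR.
have : complex.Re (f z) = complex.Re (f w) /\
   complex.Im (f z) = complex.Im (f w).
  split; [apply: HR|apply: HI]; first by case=> ? ? [].
  - exact: Re_le_cabs.
  - by case=> ? ? [].
  - exact: Im_le_cabs.
by case: (f z) (f w) => ? ? [? ?] /= [-> ->].
Qed.

Definition cconvex (A : set C) := forall z w, A z -> A w ->
  forall t : R, 0 <= t <= 1 -> A (z + (t%:C)%C * (w - z)).

Lemma cder0_convex (A : set C) (f : C -> C) : cconvex A ->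
  (forall z, A z -> cder f z 0) -> forall z w, A z -> A w -> f z = f w.
Proof.
by move=> Ac f0 z w Az Aw; apply: cder0_cst => t t01; apply: f0; exact: Ac.
Qed.

Lemma cconvexI (A B : set C) : cconvex A -> cconvex B -> cconvex (A `&` B).
Proof.
by move=> Ac Bc z w [? ?] [? ?] t t01; split; [exact: Ac|exact: Bc].
Qed.

Lemma cconvex_ball (c : C) (r : R) : cconvex [set z | cabs (z - c) < r].
Proof.
move=> z w /= zc wc t /andP[t0 t1].
have -> : z + (t%:C)%C * (w - z) - c =
   ((1 - t)%:C)%C * (z - c) + (t%:C)%C * (w - c).
  by rewrite rmorphB rmorph1; ring.
apply: le_lt_trans (cabsD _ _) _; rewrite !cabsM !cabsR !ger0_norm ?subr_ge0//.
have := cabs_ge0 (z - c); have := cabs_ge0 (w - c).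
case: (ltP t 1) => [tl1|t1']; last first.
  by rewrite (_ : t = 1) ?subrr ?mul0r ?mul1r ?add0r//; apply/le_anti/andP.
move=> _ _.
have H1 : (1 - t) * cabs (z - c) < (1 - t) * r by rewrite ltr_pM2l// subr_gt0.
have H2 : t * cabs (w - c) <= t * r by rewrite ler_wpM2l// ltW.
by lra.
Qed.

(** Half-planes: in the applications k is the real part or its opposite. *)
Lemma cconvex_half (k : C -> R) (a : R) : (forall u v, k (u + v) = k u + k v) ->
  (forall (t : R) u, k ((t%:C)%C * u) = t * k u) ->
  cconvex [set z | a < k z].
Proof.
move=> kD kZ z w /= az aw t /andP[t0 t1].
have kB u v : k (u - v) = k u - k v.
  have -> : u - v = u + ((-1)%:C)%C * v by rewrite rmorphN rmorph1 mulN1r.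
  by rewrite kD kZ mulN1r.
rewrite kD kZ kB.
case: (ltP t 1) => [tl1|t1']; last first.
  by rewrite (_ : t = 1); [lra|apply/le_anti/andP].
have H1 : (1 - t) * a < (1 - t) * k z by rewrite ltr_pM2l// subr_gt0.
have H2 : t * a <= t * k w by rewrite ler_wpM2l// ltW.
by lra.
Qed.

End ComplexBasics.
Arguments cabs : simpl never.
Notation cder f z d :=
  (is_derive (z : CC _) (1 : CC _) (f : CC _ -> CC _) (d : CC _)).

(** * Absolutely convergent complex series *)

Section ComplexSeries.
Variable R : realType.
Local Notation C := (CC R).
Implicit Types (a b : nat -> C) (z : C).

Definition summable a :=
  exists B : R, forall n, \sum_(0 <= k < n) cabs (a k) <= B.

Definition csum a : C :=
  Complex (limn (series (fun k => complex.Re (a k))))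
          (limn (series (fun k => complex.Im (a k)))).

Definition sums_to a (l : C) := forall e : R, 0 < e -> exists N, forall n,
  (N <= n)%N -> cabs (\sum_(0 <= k < n) a k - l) < e.

Lemma cabs_sum a n : cabs (\sum_(0 <= k < n) a k) <= \sum_(0 <= k < n) cabs (a k).
Proof.
elim: n => [|n ih]; first by rewrite !big_nil cabs0.
by rewrite !big_nat_recr//= (le_trans (cabsD _ _))// lerD2r.
Qed.

(** Both components are absolutely convergent real series. *)
Lemma csumP a : summable a -> sums_to a (csum a).
Proof.
move=> [B aB].
have part (k : C -> R) : (forall u, `|k u| <= cabs u) ->
    cvgn (series (fun j => k (a j))).
  move=> kle; apply: normed_cvg.
  apply: nondecreasing_is_cvgn.
    by apply: nondecreasing_series => j _ _; exact: normr_ge0.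
  exists B => _ [n _ <-]; apply: le_trans (aB n).
  by rewrite /series/=; apply: ler_sum => j _; exact: kle.
have lim_ (k : C -> R) : (forall u, `|k u| <= cabs u) ->
    forall e : R, 0 < e -> exists N, forall n, (N <= n)%N ->
    `|\sum_(0 <= j < n) k (a j) - limn (series (fun j => k (a j)))| < e.
  move=> /part/cvgrPdist_lt H e /H [N _ HN]; exists N => n Nn.
  by rewrite distrC; apply: HN.
move=> e e0; have e2 : 0 < e / 2 by rewrite divr_gt0.
have [N1 H1] := lim_ _ (@Re_le_cabs R) _ e2.
have [N2 H2] := lim_ _ (@Im_le_cabs R) _ e2.
exists (maxn N1 N2) => n; rewrite geq_max => /andP[/H1 {}H1 /H2 {}H2].
apply: le_lt_trans (cabs_le _) _.
have sumRe m : complex.Re (\sum_(0 <= j < m) a j) =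
    \sum_(0 <= j < m) complex.Re (a j).
  elim: m => [|m ih]; first by rewrite !big_nil.
  by rewrite !big_nat_recr//= -ih; case: (\sum_(_ <= _ < _) _) (a m) => ? ? [].
have sumIm m : complex.Im (\sum_(0 <= j < m) a j) =
    \sum_(0 <= j < m) complex.Im (a j).
  elim: m => [|m ih]; first by rewrite !big_nil.
  by rewrite !big_nat_recr//= -ih; case: (\sum_(_ <= _ < _) _) (a m) => ? ? [].
move: H1 H2; rewrite -sumRe -sumIm /csum; case: (\sum_(_ <= _ < _) _) => x y /=.
by move=> H1 H2; rewrite (splitr e) ltrD.
Qed.

Lemma cabs_small z : (forall e : R, 0 < e -> cabs z < e) -> z = 0.
Proof.
move=> H; apply/eqP; rewrite -cabs_eq0 eq_le cabs_ge0 andbT.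
by apply/ler_addgt0Pr => e /H/ltW; rewrite add0r.
Qed.

Lemma sums_to_uniq a l l' : sums_to a l -> sums_to a l' -> l = l'.
Proof.
move=> al al'; apply/subr0_eq/cabs_small => e e0.
have e2 : 0 < e / 2 by rewrite divr_gt0.
have [N1 H1] := al _ e2; have [N2 H2] := al' _ e2.
have := H1 (maxn N1 N2) (leq_maxl _ _); have := H2 (maxn N1 N2) (leq_maxr _ _).
set s := bigop _ _ _ => h2 h1.
have -> : l - l' = (s - l') - (s - l) by ring.
by rewrite (le_lt_trans (cabsB _ _))// (splitr e) ltrD.
Qed.

Lemma csum_eq a l : summable a -> sums_to a l -> csum a = l.
Proof. by move=> /csumP; exact: sums_to_uniq. Qed.

Lemma summable_le a (b : nat -> R) : (forall k, cabs (a k) <= b k) ->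
  (exists B : R, forall n, \sum_(0 <= k < n) b k <= B) -> summable a.
Proof.
move=> ab [B bB]; exists B => n; apply: le_trans (bB n).
by apply: ler_sum => k _; exact: ab.
Qed.

Lemma summableD a b : summable a -> summable b -> summable (fun k => a k + b k).
Proof.
move=> [A aA] [B bB]; exists (A + B) => n.
apply: le_trans (lerD (aA n) (bB n)).
by rewrite -big_split/=; apply: ler_sum => k _; exact: cabsD.
Qed.

Lemma summableZ z a : summable a -> summable (fun k => z * a k).
Proof.
move=> [A aA]; exists (cabs z * A) => n.
under eq_bigr do rewrite cabsM.
by rewrite -mulr_sumr ler_wpM2l// cabs_ge0.
Qed.

Lemma summableS a : summable a -> summable (fun k => a k.+1).
Proof.
move=> [A aA]; exists A => n; apply: le_trans (aA n.+1).
by rewrite [leRHS]big_nat_recl//= lerDr cabs_ge0.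
Qed.

Lemma summable_S a : summable (fun k => a k.+1) -> summable a.
Proof.
move=> [A aA]; exists (cabs (a 0%N) + A) => -[|n].
  by rewrite big_nil addr_ge0 ?cabs_ge0// (le_trans _ (aA 0%N))// big_nil.
by rewrite big_nat_recl//= lerD2l.
Qed.

Lemma csumD a b : summable a -> summable b ->
  csum (fun k => a k + b k) = csum a + csum b.
Proof.
move=> sa sb; apply: csum_eq (summableD sa sb) _ => e e0.
have e2 : 0 < e / 2 by rewrite divr_gt0.
have [N1 H1] := csumP sa e2; have [N2 H2] := csumP sb e2.
exists (maxn N1 N2) => n; rewrite geq_max => /andP[/H1 {}H1 /H2 {}H2].
rewrite big_split/= opprD addrACA.
by rewrite (le_lt_trans (cabsD _ _))// (splitr e) ltrD.
Qed.

Lemma csumZ z a : summable a -> csum (fun k => z * a k) = z * csum a.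
Proof.
move=> sa; apply: csum_eq (summableZ z sa) _ => e e0.
have [->|z0] := eqVneq z 0.
  exists 0%N => n _; rewrite mul0r subr0 big1 ?cabs0// => k _.
  exact: mul0r.
have z1 : 0 < cabs z by rewrite cabs_gt0.
have [N H] := csumP sa (divr_gt0 e0 z1); exists N => n /H {}H.
by rewrite -mulr_sumr -mulrBr cabsM mulrC -ltr_pdivlMr.
Qed.

Lemma csumS a : summable a -> csum a = a 0%N + csum (fun k => a k.+1).
Proof.
move=> sa; apply: (csum_eq (sa)) => e e0.
have [N H] := csumP (summableS sa) e0; exists N.+1 => -[//|n] /H {}H.
by rewrite big_nat_recl//= opprD addrACA subrr add0r.
Qed.

Lemma csum_le a B : (forall n, \sum_(0 <= k < n) cabs (a k) <= B) ->
  cabs (csum a) <= B.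
Proof.
move=> aB; apply/ler_addgt0Pr => e e0.
have sa : summable a by exists B.
have [N /(_ N (leqnn _)) HN] := csumP sa e0.
have -> : csum a = \sum_(0 <= k < N) a k - (\sum_(0 <= k < N) a k - csum a).
  by rewrite subKr.
rewrite (le_trans (cabsB _ _))// lerD ?(ltW HN)//.
exact: le_trans (cabs_sum _ _) (aB _).
Qed.

Lemma eq_csum a b : a =1 b -> csum a = csum b.
Proof. by move=> /funext ->. Qed.

(** From rank N on, the series is dominated by a geometric one. *)
Lemma ratio_bounded (b : nat -> R) (rho : R) N : (forall k, 0 <= b k) ->
  rho < 1 -> (forall k, (N <= k)%N -> b k.+1 <= rho * b k) ->
  exists B : R, forall n, \sum_(0 <= k < n) b k <= B.
Proof.
move=> b0 r1 Hr.
have [rn0|r0] := ltP rho 0.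
  have bz k : (N < k)%N -> b k = 0.
    case: k => // k Nk; apply: le_anti; rewrite b0 andbT.
    by rewrite (le_trans (Hr k Nk))// mulr_le0_ge0// ltW.
  exists (\sum_(0 <= k < N.+1) b k) => n.
  have [nN|/ltnW Nn] := leqP n N.+1.
    by rewrite [leRHS](big_cat_nat _ nN)//= lerDl sumr_ge0.
  rewrite [leLHS](big_cat_nat _ Nn)//= [X in _ + X]big_nat_cond.
  by rewrite [X in _ + X]big1 ?addr0// => k /andP[/andP[kN _] _]; exact: bz.
have bg m : b (N + m)%N <= rho ^+ m * b N.
  elim: m => [|m ih]; first by rewrite addn0 expr0 mul1r.
  by rewrite addnS (le_trans (Hr _ (leq_addr _ _)))// exprS -mulrA ler_wpM2l.
exists (\sum_(0 <= k < N) b k + b N / (1 - rho)) => n.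
have r10 : 0 < 1 - rho by rewrite subr_gt0.
have [nN|/ltnW Nn] := leqP n N.
  rewrite [X in _ <= X + _](big_cat_nat _ nN)//= -addrA lerDl addr_ge0
    ?sumr_ge0//.
  by rewrite divr_ge0// ltW.
rewrite [leLHS](big_cat_nat _ Nn)//= lerD2l.
rewrite -{1}[N]add0n big_addn.
have H k : \sum_(0 <= i < k) b (i + N)%N <= b N * (1 - rho ^+ k) / (1 - rho).
  elim: k => [|k ih]; first by rewrite big_nil expr0 subrr mulr0 mul0r.
  rewrite big_nat_recr//=.
  have := lerD ih (bg k); rewrite addnC => /le_trans; apply.
  rewrite exprS le_eqVlt; apply/orP; left; apply/eqP; field.
  by rewrite gt_eqF.
rewrite (le_trans (H _))// ler_wpM2r ?invr_ge0 ?(ltW r10)//.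
by rewrite ler_piMr// gerBl exprn_ge0.
Qed.

(** The remainder of order two of the sum is bounded by |h|^2 times the sum of
the majorant B, up to a constant. Multiplying by powers of delta lets one and
the same majorant serve for the terms, their derivatives and their remainders.
*)
Lemma cder_csum (f : nat -> C -> C) (f' : nat -> C) (B : nat -> R) y (delta : R) :
  0 < delta -> (exists S : R, forall n, \sum_(0 <= k < n) B k <= S) ->
  (forall k, cabs (f k y) <= B k) ->
  (forall k, delta * cabs (f' k) <= B k) ->
  (forall k h, cabs h <= delta ->
    cabs (f k (y + h) - f k y - f' k * h) * delta ^+ 2 <= cabs h ^+ 2 * B k) ->
  (forall h, cabs h <= delta -> summable (fun k => f k (y + h))) /\
  cder (fun w => csum (fun k => f k w)) y (csum f').
Proof.
move=> d0 sB fB f'B rB; have [S HS] := sB.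
have sf : summable (fun k => f k y) by apply: summable_le sB.
have sf' : summable f'.
  apply: (@summable_le _ (fun k => B k / delta)) => [k|].
    by rewrite ler_pdivlMr// mulrC.
  by exists (S / delta) => n; rewrite -mulr_suml ler_wpM2r// invr_ge0 ltW.
pose r h k := f k (y + h) - f k y - f' k * h.
have rE h : (fun k => f k (y + h)) =1 (fun k => f k y + (h * f' k + r h k)).
  by move=> k; rewrite /r; ring.
have d20 : 0 < delta ^+ 2 by rewrite exprn_gt0.
have rS h : cabs h <= delta -> forall n,
    \sum_(0 <= k < n) cabs (r h k) <= cabs h ^+ 2 / delta ^+ 2 * S.
  move=> hd n; apply: (@le_trans _ _
      (\sum_(0 <= k < n) (cabs h ^+ 2 / delta ^+ 2 * B k))).
    apply: ler_sum => k _; rewrite mulrAC ler_pdivlMr//; exact: rB.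
  by rewrite -mulr_sumr ler_wpM2l// divr_ge0 ?exprn_ge0 ?cabs_ge0// ltW.
have sr h : cabs h <= delta -> summable (r h).
  by move=> hd; exists (cabs h ^+ 2 / delta ^+ 2 * S); exact: rS.
split=> [h hd|].
  rewrite (funext (rE h)); apply: summableD => //.
  by apply: summableD; [exact: summableZ|exact: sr].
have S0 : 0 <= S by rewrite (le_trans _ (HS 0%N))// big_nil.
apply/cder_eps => e e0; pose e1 := e * delta ^+ 2 / (S + 1).
have S10 : 0 < S + 1 by rewrite ltr_wpDl.
exists (Num.min delta e1).
  by rewrite lt_min d0 /e1 divr_gt0// mulr_gt0.
move=> w; rewrite lt_min => /andP[wd we].
have -> : w = y + (w - y) by rewrite addrC subrK.
move: (w - y) wd we => h {w} hd he; rewrite [y + h - y]addrC addKr.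
rewrite (eq_csum (rE h)) csumD//; last first.
  by apply: summableD; [exact: summableZ|apply: sr; exact: ltW].
rewrite csumD ?csumZ//; [|exact: summableZ|by apply: sr; exact: ltW].
have -> : csum (f^~ y) + (h * csum f' + csum (r h)) - csum (f^~ y) - csum f' * h
  = csum (r h) by ring.
rewrite (le_trans (csum_le (rS h (ltW hd))))//.
have h0 := cabs_ge0 h.
rewrite expr2 -!mulrA [leRHS]mulrC ler_wpM2l//.
have : cabs h * (S + 1) <= e * delta ^+ 2.
  by rewrite -ler_pdivlMr// ltW.
rewrite mulrA mulrAC ler_pdivrMr// => /(le_trans _); apply.
by rewrite ler_wpM2l// lerDl.
Qed.

End ComplexSeries.

(** * Series of products and power series *)

Section ProductSeries.
Variable R : realType.
Local Notation C := (CC R).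
Implicit Types (a c kappa : nat -> C) (y : C).

(** The shape taken by the coefficients of a hypergeometric series as functions
of a parameter y; the case c = 0 gives power series. *)
Fixpoint rprod c y k : C := if k is j.+1 then rprod c y j * (c j + y) else 1.

Fixpoint drprod c y k : C :=
  if k is j.+1 then drprod c y j * (c j + y) + rprod c y j else 0.

(** Majorant of rprod, of its derivative and of its remainder around y, for X =
|y| + 2 delta. *)
Fixpoint majprod c (X : R) k : R :=
  if k is j.+1 then majprod c X j * (cabs (c j) + X) else 1.

Lemma majprod_ge0 c (X : R) k : 0 <= X -> 0 <= majprod c X k.
Proof.
by move=> X0; elim: k => //= k ih; rewrite mulr_ge0 ?addr_ge0 ?cabs_ge0.
Qed.

(** By induction on the number of factors: the new factor c_k + y + h has
modulus at most |c_k| + |y| + delta, and the second delta in X absorbs the terms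
produced by the product rule. *)
Lemma rprod_bounds c y (delta : R) k : 0 < delta ->
  let F := majprod c (cabs y + 2 * delta) in
  [/\ cabs (rprod c y k) <= F k, delta * cabs (drprod c y k) <= F k &
  forall h, cabs h <= delta ->
    cabs (rprod c (y + h) k - rprod c y k - drprod c y k * h) * delta ^+ 2 <=
      cabs h ^+ 2 * F k].
Proof.
move=> d0 /=; set X := cabs y + 2 * delta.
have y0 := cabs_ge0 y; have d0' := ltW d0.
have X0 : 0 <= X by rewrite /X; lra.
elim: k => [|k [ih1 ih2 ih3]] /=.
  split; first by rewrite cabs1.
    by rewrite cabs0 mulr0.
  by move=> h hd; rewrite subrr mul0r subr0 cabs0 mul0r mulr1 exprn_ge0 ?cabs_ge0.
have F0 := majprod_ge0 c k X0.
have ck0 := cabs_ge0 (c k).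
have cy : cabs (c k + y) <= cabs (c k) + cabs y := cabsD _ _.
split.
- rewrite cabsM ler_pM ?cabs_ge0// (le_trans cy)// lerD2l /X; lra.
- apply: (@le_trans _ _ (majprod c X k * (cabs (c k) + cabs y) +
      delta * majprod c X k)).
    apply: (@le_trans _ _ (delta * cabs (drprod c y k) * cabs (c k + y) +
       delta * cabs (rprod c y k))).
      by rewrite -mulrA -mulrDr ler_wpM2l// -cabsM cabsD.
    rewrite lerD//; last by rewrite ler_wpM2l.
    by rewrite ler_pM ?mulr_ge0 ?cabs_ge0.
  by rewrite [delta * _]mulrC -mulrDr ler_wpM2l// /X; lra.
- move=> h hd; have h0 := cabs_ge0 h.
  set r := _ - _ - _ * h.
  have -> : r = (rprod c (y + h) k - rprod c y k - drprod c y k * h) *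
      (c k + y + h) + drprod c y k * h ^+ 2 by rewrite /r; ring.
  set r0 := _ - _ - _ * h.
  have := ih3 _ hd; rewrite -/r0 => {}ih3.
  apply: (@le_trans _ _ (cabs r0 * delta ^+ 2 * (cabs (c k) + cabs y + delta) +
     delta * (delta * cabs (drprod c y k)) * cabs h ^+ 2)).
    have -> : delta * (delta * cabs (drprod c y k)) * cabs h ^+ 2 =
      cabs (drprod c y k) * cabs h ^+ 2 * delta ^+ 2 by ring.
    rewrite mulrAC -mulrDl ler_wpM2r ?exprn_ge0//.
    rewrite (le_trans (cabsD _ _))// [cabs (drprod _ _ _ * _)]cabsM cabsX.
    rewrite lerD2r [leLHS]cabsM ler_wpM2l ?cabs_ge0//.
    by rewrite (le_trans (cabsD _ _))// lerD.
  apply: (@le_trans _ _ (cabs h ^+ 2 * majprod c X k *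
       (cabs (c k) + cabs y + delta) + delta * majprod c X k * cabs h ^+ 2)).
    rewrite lerD//; first by rewrite ler_wpM2r//; lra.
    by rewrite ler_wpM2r ?exprn_ge0// ler_wpM2l.
  by rewrite le_eqVlt; apply/orP; left; apply/eqP; rewrite /X; ring.
Qed.

Definition prodser kappa c y := csum (fun k => kappa k * rprod c y k).

Definition prod_maj kappa c (X : R) := exists S : R, forall n,
  \sum_(0 <= k < n) (cabs (kappa k) * majprod c X k) <= S.

Lemma cder_prodser kappa c y (delta : R) : 0 < delta ->
  prod_maj kappa c (cabs y + 2 * delta) ->
  cder (prodser kappa c) y (csum (fun k => kappa k * drprod c y k)).
Proof.
move=> d0 S.
have H k := rprod_bounds c y k d0.
apply: (proj2 (@cder_csum R (fun k y => kappa k * rprod c y k)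
  (fun k => kappa k * drprod c y k)
  (fun k => cabs (kappa k) * majprod c (cabs y + 2 * delta) k) y delta
  d0 S _ _ _)).
- by move=> k; have [H1 _ _] := H k; rewrite cabsM ler_wpM2l ?cabs_ge0.
- move=> k; have [_ H1 _] := H k.
  by rewrite cabsM mulrCA ler_wpM2l ?cabs_ge0.
- move=> k h hd; have [_ _ /(_ _ hd) H1] := H k.
  rewrite -mulrBr -mulrA -mulrBr cabsM -mulrA [leRHS]mulrCA.
  by rewrite ler_wpM2l ?cabs_ge0.
Qed.

Definition pser a y := csum (fun k => a k * y ^+ k).

Definition pdiff a k : C := k.+1%:R * a k.+1.

Definition abs_conv a (X : R) := exists S : R, forall n,
  \sum_(0 <= k < n) (cabs (a k) * X ^+ k) <= S.

Definition conv_disc a (r : R) := forall X : R, 0 <= X -> X < r -> abs_conv a X.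

Lemma rprod0 y k : rprod (fun=> 0) y k = y ^+ k.
Proof. by elim: k => //= k ->; rewrite add0r exprSr. Qed.

Lemma drprod0 y k : drprod (fun=> 0) y k.+1 = k.+1%:R * y ^+ k.
Proof.
elim: k => [|k]; first by rewrite /= mul0r add0r mulr1.
rewrite [drprod _ _ k.+2]/= -/(drprod (fun=> 0) y k.+1) => ->.
rewrite -[rprod _ y k * (0 + y)]/(rprod (fun=> 0) y k.+1) rprod0 exprSr.
by rewrite -[k.+2%:R]natr1; ring.
Qed.

Lemma majprod0 (X : R) k : majprod (fun=> 0 : C) X k = X ^+ k.
Proof. by elim: k => //= k ->; rewrite cabs0 add0r exprSr. Qed.

Lemma summable_pser a y (r : R) : conv_disc a r -> cabs y < r ->
  summable (fun k => a k * y ^+ k).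
Proof.
move=> H /(H _ (cabs_ge0 _)); apply: summable_le => k.
by rewrite cabsM cabsX.
Qed.

Lemma pser_at0 a (r : R) : 0 < r -> conv_disc a r -> pser a 0 = a 0%N.
Proof.
move=> r0 ca; rewrite /pser csumS; last first.
  by apply: (summable_pser ca); rewrite cabs0.
have H : (fun k : nat => a k.+1 * 0 ^+ k.+1) =1 (fun=> 0 * 0).
  by move=> k; rewrite exprS !mul0r mulr0.
rewrite (eq_csum H) csumZ; first by rewrite mul0r addr0 expr0 mulr1.
by exists 0 => n; rewrite big1// => k _; rewrite cabs0.
Qed.

Lemma cder_pser a y (r : R) : conv_disc a r -> cabs y < r ->
  cder (pser a) y (pser (pdiff a) y).
Proof.
move=> H yr; have y0 := cabs_ge0 y.
pose d := (r - cabs y) / 3.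
have d0 : 0 < d by rewrite divr_gt0// subr_gt0.
have [S HS] : abs_conv a (cabs y + 2 * d) by apply: H; rewrite /d; lra.
have M : prod_maj a (fun=> 0) (cabs y + 2 * d).
  by exists S => n; under eq_bigr do rewrite majprod0.
have := cder_prodser d0 M.
have -> : prodser a (fun=> 0) = pser a.
  by apply/funext => w; apply: eq_csum => k; rewrite rprod0.
move=> /cder_eq; apply.
rewrite csumS; last first.
  apply: (@summable_le _ _ (fun k => cabs (a k) * (cabs y + 2 * d) ^+ k / d)).
    move=> k; rewrite cabsM -mulrA ler_wpM2l ?cabs_ge0// ler_pdivlMr// mulrC.
    by have [_] := rprod_bounds (fun=> 0) y k d0; rewrite /= majprod0.
  exists (S / d) => n; rewrite -mulr_suml ler_wpM2r// invr_ge0 ltW//.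
rewrite [drprod _ _ 0%N]/= mulr0 add0r; apply: eq_csum => k.
by rewrite drprod0 /pdiff; ring.
Qed.

(** The factor k produced by differentiation is absorbed by enlarging the
radius: k X^(k-1) (Y - X) <= Y^k for X < Y. *)
Lemma conv_pdiff a (r : R) : conv_disc a r -> conv_disc (pdiff a) r.
Proof.
move=> H X X0 Xr; pose Y := (X + r) / 2.
have YX : 0 < Y - X by rewrite /Y; lra.
have [S HS] : abs_conv a Y by apply: H; rewrite /Y; lra.
have key k : k.+1%:R * X ^+ k * (Y - X) <= Y ^+ k.+1 - X ^+ k.+1.
  elim: k => [|k ih]; first by rewrite expr0 mulr1 mul1r !expr1.
  have Xk : 0 <= X ^+ k by rewrite exprn_ge0.
  have le : X * X ^+ k <= Y * Y ^+ k.
    by rewrite -!exprS lerXn2r ?nnegrE//; rewrite /Y; lra.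
  rewrite exprS [Y ^+ _]exprS [X ^+ k.+2]exprS -[k.+2%:R]natr1.
  have := ler_wpM2l X0 ih.
  have : 0 <= (Y - X) * (Y ^+ k.+1 - X ^+ k.+1).
    by rewrite mulr_ge0 ?(ltW YX)// subr_ge0 !exprS.
  rewrite !exprS; move: (k.+1%:R : R) (X ^+ k) (Y ^+ k) => u v t; lra.
exists (S / (Y - X)) => n.
apply: (@le_trans _ _ (\sum_(0 <= k < n) (cabs (a k.+1) * Y ^+ k.+1 / (Y - X)))).
  apply: ler_sum => k _; rewrite /pdiff cabsM cabs_nat ler_pdivlMr//.
  rewrite [k.+1%:R * _]mulrC -!mulrA ler_wpM2l ?cabs_ge0// mulrA.
  by rewrite (le_trans (key k))// gerBl exprn_ge0.
rewrite -mulr_suml ler_wpM2r ?invr_ge0 ?(ltW YX)//.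
apply: le_trans (HS n.+1); rewrite [leRHS]big_nat_recl//= lerDr.
by rewrite mulr_ge0 ?cabs_ge0// expr0.
Qed.

End ProductSeries.

(** * The hypergeometric equation *)

Section Hypergeometric.
Variable R : realType.
Local Notation C := (CC R).
Implicit Types (sg pp gm y mu : C).

(** The coefficients of the Gauss series 2F1(a, b; gm; y) in terms of sg = a + b
and pp = a b, since (a + j) (b + j) = j^2 + sg j + pp. At 0 and infinity the
parameters a and b are the roots of X^2 - X - mu, and only their sum and product
depend holomorphically on mu. *)
Fixpoint hyp_coef sg pp gm k : C := if k is j.+1 then
  hyp_coef sg pp gm j * (j%:R ^+ 2 + sg * j%:R + pp) / ((gm + j%:R) * j.+1%:R)
  else 1.

Definition hyp sg pp gm := pser (hyp_coef sg pp gm).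
Definition dhyp sg pp gm := pser (pdiff (hyp_coef sg pp gm)).
Definition ddhyp sg pp gm := pser (pdiff (pdiff (hyp_coef sg pp gm))).

Lemma eventually_quad (e A B : R) : 0 < e -> exists N, forall k, (N <= k)%N ->
  A * k%:R + B <= e * k%:R ^+ 2.
Proof.
move=> e0; pose T := (`|A| + `|B|) / e.
have T0 : 0 <= T by rewrite divr_ge0 ?addr_ge0// ltW.
have [N TN] : exists N : nat, T < N%:R.
  by exists (Num.bound T); apply: archi_boundP.
exists N.+1 => k Nk.
have k1 : 1 <= k%:R :> R by rewrite ler1n (leq_trans _ Nk).
have Tk : `|A| + `|B| <= e * k%:R.
  rewrite mulrC -ler_pdivrMr// (le_trans (ltW TN))// ler_nat.
  exact: ltnW.
have H1 : A * k%:R <= `|A| * k%:R by rewrite ler_wpM2r ?ler_norm//; lra.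
have H2 : B <= `|B| * k%:R.
  by rewrite (le_trans (ler_norm _))// ler_peMr.
rewrite expr2 mulrA (le_trans (lerD H1 H2))// -mulrDl ler_wpM2r//; lra.
Qed.

(** The quotient of consecutive terms tends to the modulus of the variable; this
is put in the form required by the ratio test. *)
Lemma quad_growth sg pp gm (X : R) : 0 <= X -> X < 1 ->
  exists N, forall k, (N <= k)%N ->
  [/\ gm + k%:R != 0 & (k%:R ^+ 2 + cabs sg * k%:R + cabs pp) * X <=
  (X + 1) / 2 * (cabs (gm + k%:R) * k.+1%:R)].
Proof.
move=> X0 X1.
pose rho := (X + 1) / 2; have rX : 0 < rho - X by rewrite /rho; lra.
have g0 := cabs_ge0 gm.
have [N HN] := eventually_quad (cabs sg * X + rho * cabs gm)
  (cabs pp * X + rho * cabs gm) rX.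
have [M gM] : exists M : nat, cabs gm < M%:R.
  by exists (Num.bound (cabs gm)); apply: archi_boundP.
exists (maxn N M) => k; rewrite geq_max => /andP[/HN {}HN Mk].
have gk : cabs gm < k%:R by rewrite (lt_le_trans gM)// ler_nat.
have le : k%:R - cabs gm <= cabs (gm + k%:R).
  have : cabs (k%:R : C) <= cabs (gm + k%:R) + cabs gm.
    by rewrite -{1}[k%:R](addKr gm) addrC cabsB.
  by rewrite cabs_nat; lra.
split; first by rewrite -cabs_gt0; lra.
rewrite -/rho.
apply: (@le_trans _ _ (rho * ((k%:R - cabs gm) * k.+1%:R))); last first.
  by rewrite ler_wpM2l ?ler_wpM2r// /rho; lra.
have r0 : 0 <= rho by rewrite /rho; lra.
have k0 : 0 <= k%:R :> R by [].
rewrite -natr1; move: HN r0 k0 rX; move: (k%:R : R) rho => K r HN r0 K0 rX.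
have : 0 <= r * K by rewrite mulr_ge0.
by nra.
Qed.

Lemma hyp_conv sg pp gm : conv_disc (hyp_coef sg pp gm) 1.
Proof.
move=> X X0 X1; have [N HN] := quad_growth sg pp gm X0 X1.
apply: (@ratio_bounded _ _ ((X + 1) / 2) N).
- by move=> k; rewrite mulr_ge0 ?cabs_ge0 ?exprn_ge0.
- by lra.
move=> k /HN[gk le]; rewrite /= !cabsM cabsV cabsM cabs_nat [X ^+ k.+1]exprS.
set a := cabs (hyp_coef _ _ _ _); set D := cabs (gm + _) in le *.
have D0 : 0 < D by rewrite cabs_gt0.
have Dk : 0 < D * k.+1%:R by rewrite mulr_gt0// ltr0n.
have a0 : 0 <= a := cabs_ge0 _.
have Xk : 0 <= X ^+ k by rewrite exprn_ge0.
set q := cabs _.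
have q_le : q <= k%:R ^+ 2 + cabs sg * k%:R + cabs pp.
  rewrite /q (le_trans (cabsD _ _))// lerD2r (le_trans (cabsD _ _))//.
  by rewrite cabsX cabsM !cabs_nat.
have -> : a * q / (D * k.+1%:R) * (X * X ^+ k) =
    (q * X / (D * k.+1%:R)) * (a * X ^+ k) by ring.
rewrite ler_wpM2r ?mulr_ge0// ler_pdivrMr// (le_trans _ le)//.
by rewrite ler_wpM2r.
Qed.

Lemma cder_hyp sg pp gm y : cabs y < 1 ->
  cder (hyp sg pp gm) y (dhyp sg pp gm y).
Proof. by move=> y1; exact: cder_pser (hyp_conv _ _ _) y1. Qed.

Lemma cder_dhyp sg pp gm y : cabs y < 1 ->
  cder (dhyp sg pp gm) y (ddhyp sg pp gm y).
Proof. by move=> y1; exact: cder_pser (conv_pdiff (hyp_conv _ _ _)) y1. Qed.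

Lemma hyp0 sg pp gm : hyp sg pp gm 0 = 1.
Proof. exact: (pser_at0 ltr01 (hyp_conv _ _ _)). Qed.

(** The recurrence that defines the coefficients says that the coefficient of
each y^k cancels. *)
Lemma hyp_ode sg pp gm y : (forall k : nat, gm + k%:R != 0) -> cabs y < 1 ->
  y * (1 - y) * ddhyp sg pp gm y + (gm - (sg + 1) * y) * dhyp sg pp gm y
    - pp * hyp sg pp gm y = 0.
Proof.
move=> gm0 y1; set a := hyp_coef sg pp gm.
have cv0 : conv_disc a 1 by exact: hyp_conv.
have cv1 := conv_pdiff cv0; have cv2 := conv_pdiff cv1.
have s0 := summable_pser cv0 y1; have s1 := summable_pser cv1 y1.
have s2 := summable_pser cv2 y1.
have sh (b : nat -> C) : conv_disc b 1 ->
  summable (fun k => k%:R * b k * y ^+ k) /\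
    y * pser (pdiff b) y = csum (fun k => k%:R * b k * y ^+ k).
  move=> cb; have sb := summable_pser (conv_pdiff cb) y1.
  have E : (fun k => k.+1%:R * b k.+1 * y ^+ k.+1) =
      (fun k => y * (pdiff b k * y ^+ k)).
    by apply/funext => k; rewrite /pdiff exprS; ring.
  have S : summable (fun k => k%:R * b k * y ^+ k).
    by apply: summable_S; rewrite E; exact: summableZ.
  by split=> //; rewrite csumS// !mul0r add0r E csumZ.
have [t1 e1] := sh _ cv0; have [t2 e2] := sh _ cv1.
(* k b_k = k (k - 1) a_k are the coefficients of y^2 F''. *)
pose b k : C := k.-1%:R * a k.
have [t3 e3] : summable (fun k => k%:R * b k * y ^+ k) /\
    y * pser (fun k => k%:R * pdiff a k) y = csum (fun k => k%:R * b k * y ^+ k).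
  have E : (fun k => k.+1%:R * b k.+1 * y ^+ k.+1) =
      (fun k => y * (k%:R * pdiff a k * y ^+ k)).
    by apply/funext => k; rewrite /pdiff /b exprS; ring.
  have S : summable (fun k => k%:R * b k * y ^+ k).
    by apply: summable_S; rewrite E; exact: summableZ.
  by split=> //; rewrite csumS// !mul0r add0r E csumZ.
have -> : y * (1 - y) * ddhyp sg pp gm y + (gm - (sg + 1) * y) * dhyp sg pp gm y
    - pp * hyp sg pp gm y =
  (y * ddhyp sg pp gm y + gm * dhyp sg pp gm y) +
  ((-1) * (y * (y * ddhyp sg pp gm y)) +
   ((- (sg + 1)) * (y * dhyp sg pp gm y) + (- pp) * hyp sg pp gm y)).
  by ring.
rewrite /ddhyp /dhyp /hyp -/a e2 e1.
rewrite -[csum (fun k => k%:R * pdiff a k * y ^+ k)]/(pser (fun k => k%:R *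
  pdiff a k) y).
rewrite e3 /pser -!csumZ//.
rewrite -!csumD//; do ?[exact: summableZ|apply: summableD|by []].
rewrite (@eq_csum _ _ (fun=> 0 * 0)); last first.
  move=> k; rewrite /pdiff /b /= -/a; case: k => [|k] /=.
    rewrite !expr0 !mulr1 !mul0r /a /= !mul1r addr0 expr0n/= add0r mulr0 add0r.
    rewrite mulr1; field; have := gm0 0%N; by rewrite addr0.
  rewrite -/(a k.+1) -[a k.+2]/(a k.+1 * (k.+1%:R ^+ 2 + sg * k.+1%:R + pp) /
     ((gm + k.+1%:R) * k.+2%:R)).
  have := gm0 k.+1; rewrite -[k.+2%:R]natr1 -[k.+1%:R]natr1 => gk.
  field; rewrite gk/=.
  by rewrite !natr1 pnatr_eq0.
rewrite csumZ ?mul0r//.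
by exists 0 => n; rewrite big1// => k _; rewrite cabs0.
Qed.

(** When sg = 1 and pp = - mu the numerators are j^2 + j - mu, hence the
coefficients are products of the form studied above, in the variable - mu. *)
Lemma hyp_coef_rprod mu gm k : hyp_coef 1 (- mu) gm k =
  (\prod_(j < k) ((gm + j%:R) * j.+1%:R)^-1) *
  rprod (fun j => j%:R ^+ 2 + j%:R) (- mu) k.
Proof.
elim: k => [|k ih] /=; first by rewrite big_ord0 mul1r.
by rewrite ih big_ord_recr/= mul1r; ring.
Qed.

(** For fixed y the series is a series of products in - mu. The weight P selects
the hypergeometric function, or y times its derivative. *)
Lemma cder_hyp_mu gm mu (P : nat -> C) (y : C) :
  cabs y < 1 -> (forall k, P k = 1 \/ P k = k%:R) ->
  exists d, cder (fun mu => csum (fun k => P k * hyp_coef 1 (- mu) gm k * y ^+ k))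
    mu d.
Proof.
move=> y1 HP.
pose kappa k : C := P k * (\prod_(j < k) ((gm + j%:R) * j.+1%:R)^-1) * y ^+ k.
pose c j : C := j%:R ^+ 2 + j%:R.
have E : (fun mu => csum (fun k => P k * hyp_coef 1 (- mu) gm k * y ^+ k)) =
    (fun mu => prodser kappa c (- mu)).
  apply/funext => nu; apply: eq_csum => k; rewrite hyp_coef_rprod /kappa.
  by ring.
pose X : R := cabs (- mu) + 2 * 1.
have X0 : 0 <= X by rewrite addr_ge0 ?cabs_ge0//; lra.
have M : prod_maj kappa c X.
  pose Y := (cabs y + 1) / 2.
  have Y0 : 0 <= Y by have := cabs_ge0 y; rewrite /Y; lra.
  have Y1 : Y < 1 by rewrite /Y; lra.
  pose q k : R := cabs (\prod_(j < k) ((gm + j%:R) * j.+1%:R)^-1) *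
    majprod c X k.
  have q0 k : 0 <= q k by rewrite mulr_ge0 ?cabs_ge0 ?majprod_ge0.
  (* The factor k + 1 bounds both possible values of P k. *)
  have cq : exists S : R, forall n,
    \sum_(0 <= k < n) k.+1%:R * (q k * cabs y ^+ k) <= S.
    have [N HN] := quad_growth 1 ((X%:C)%C) gm Y0 Y1.
    have [M HM] : exists M : nat, forall k, (M <= k)%N ->
       k.+2%:R * cabs y <= k.+1%:R * Y.
      have yY : 0 < Y - cabs y by rewrite /Y; lra.
      have := archi_boundP (divr_ge0 (cabs_ge0 y) (ltW yY)).
      set M := Num.bound _ => HM; exists M => k Mk.
      have : cabs y / (Y - cabs y) < k.+1%:R.
        by rewrite (lt_le_trans HM)// ler_nat (leq_trans Mk).
      rewrite ltr_pdivrMr// -[k.+2%:R]natr1 => H; lra.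
    apply: (@ratio_bounded _ _ ((Y + 1) / 2) (maxn N M)).
    - by move=> k; rewrite mulr_ge0 ?ler0n// mulr_ge0 ?q0// exprn_ge0 ?cabs_ge0.
    - by lra.
    move=> k; rewrite geq_max => /andP[/HN[gk le] /HM leM].
    rewrite /q big_ord_recr/= cabsM cabsV cabsM cabs_nat [cabs y ^+ k.+1]exprS.
    set A := cabs _; set F := majprod c X k; set D := cabs (gm + _) in le *.
    have D0 : 0 < D by rewrite cabs_gt0.
    have Dk : 0 < D * k.+1%:R by rewrite mulr_gt0// ltr0n.
    have F0 : 0 <= F by exact: majprod_ge0.
    have A0 : 0 <= A := cabs_ge0 _.
    have B0 : 0 <= A * F * cabs y ^+ k by rewrite !mulr_ge0 ?exprn_ge0 ?cabs_ge0.
    have ck : cabs (c k) <= k%:R ^+ 2 + k%:R.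
      by rewrite (le_trans (cabsD _ _))// cabsX cabs_nat.
    have -> : k.+2%:R * (A / (D * k.+1%:R) * (F * (cabs (c k) + X)) *
        (cabs y * cabs y ^+ k)) =
      (k.+2%:R * cabs y) * ((cabs (c k) + X) / (D * k.+1%:R)) *
        (A * F * cabs y ^+ k) by ring.
    have -> : (Y + 1) / 2 * (k.+1%:R * (A * F * cabs y ^+ k)) =
      (Y + 1) / 2 * k.+1%:R * (A * F * cabs y ^+ k) by ring.
    rewrite ler_wpM2r//.
    apply: (@le_trans _ _ (k.+1%:R * Y * ((cabs (c k) + X) / (D * k.+1%:R)))).
      by rewrite ler_wpM2r// divr_ge0 ?addr_ge0 ?cabs_ge0// ltW.
    rewrite -mulrA [leRHS]mulrC ler_wpM2l// mulrA ler_pdivrMr//.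
    apply: le_trans le; rewrite mulrC ler_wpM2r// cabs1 mul1r cabsR ger0_norm//.
    by rewrite lerD2r.
  have [S HS] := cq; exists S => n; apply: le_trans (HS n).
  apply: ler_sum => k _.
  have -> : cabs (kappa k) * majprod c X k =
      cabs (P k) * (q k * cabs y ^+ k).
    by rewrite /kappa cabsM cabsX cabsM /q; ring.
  have Q0 : 0 <= q k * cabs y ^+ k.
    by rewrite mulr_ge0 ?q0 ?exprn_ge0 ?cabs_ge0.
  rewrite ler_wpM2r//.
  by case: (HP k) => ->; rewrite ?cabs1 ?cabs_nat ?ler1n ?ler_nat.
exists ((csum (fun k => kappa k * drprod c (- mu) k)) * (- 1)).
rewrite E.
exact: (cder_comp (cderN (cderid mu)) (cder_prodser ltr01 M)).
Qed.

End Hypergeometric.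

(** * Exponential and logarithm *)

Section ComplexExponential.
Variable R : realType.
Local Notation C := (CC R).
Implicit Types (z w : C) (t : R).
Local Notation rc t := (t%:C)%C.
Local Notation ii := ('i%C : C).

Lemma cE z : z = rc (complex.Re z) + ii * rc (complex.Im z).
Proof. exact: complexE. Qed.

Lemma ii2 : ii * ii = -1.
Proof. by rewrite -expr2 sqr_i. Qed.

Definition cexp z : C := rc (expR (complex.Re z)) *
  Complex (cos (complex.Im z)) (sin (complex.Im z)).

Lemma cexpD z w : cexp (z + w) = cexp z * cexp w.
Proof.
rewrite /cexp; case: z w => [a b] [c d] /=.
rewrite expRD cosD sinD rmorphM/= mulrACA; congr (_ * _).
by apply/eqP; rewrite eq_complex/= eqxx/= addrC.
Qed.

Lemma cexp0 : cexp 0 = 1.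
Proof. by rewrite /cexp/= expR0 cos0 sin0 mul1r. Qed.

Lemma cexpN z : cexp (- z) = (cexp z)^-1.
Proof.
have H : cexp z * cexp (- z) = 1 by rewrite -cexpD subrr cexp0.
have z0 : cexp z != 0.
  by apply: contra_eq_neq H => ->; rewrite mul0r eq_sym oner_neq0.
by apply: (mulfI z0); rewrite H mulfV.
Qed.

Lemma cexp_neq0 z : cexp z != 0.
Proof.
have H : cexp z * cexp (- z) = 1 by rewrite -cexpD subrr cexp0.
by apply: contra_eq_neq H => ->; rewrite mul0r eq_sym oner_neq0.
Qed.

Lemma cexpB z w : cexp (z - w) = cexp z / cexp w.
Proof. by rewrite cexpD cexpN. Qed.

Lemma cexpX z n : cexp (n%:R * z) = cexp z ^+ n.
Proof.
elim: n => [|n ih]; first by rewrite mul0r cexp0.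
by rewrite -natr1 mulrDl mul1r cexpD ih exprSr.
Qed.

Lemma cexpR t : cexp (rc t) = rc (expR t).
Proof. by rewrite /cexp/= cos0 sin0 mulr1. Qed.

Lemma cexp_i t : cexp (ii * rc t) = Complex (cos t) (sin t).
Proof.
by rewrite /cexp/= !(mul0r, mul1r, subrr, add0r, oppr0, expR0).
Qed.

Lemma cabs_cexp z : cabs (cexp z) = expR (complex.Re z).
Proof.
rewrite /cexp cabsM cabsR ger0_norm ?expR_ge0//.
by rewrite /cabs/= cos2Dsin2 sqrtr1 mulr1.
Qed.

Lemma cexp_ipi : cexp (ii * rc pi) = -1.
Proof. by rewrite cexp_i cospi sinpi; apply/eqP;
  rewrite eq_complex/= oppr0 !eqxx. Qed.

Lemma cexp_ipi2 : cexp (ii * rc (pi / 2)) = ii.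
Proof. by rewrite cexp_i cos_pihalf sin_pihalf. Qed.

Lemma rder_eps (f : R -> R) (x d : R) : is_derive x (1 : R) f d ->
  forall e : R, 0 < e -> exists2 r : R, 0 < r & forall h, `|h| < r ->
    `|f (x + h) - f x - d * h| <= e * `|h|.
Proof.
case=> df dE e e0.
have : (fun h : R => h^-1 *: ((f \o shift x) (h *: (1 : R)) - f x)) @ 0^' --> d.
  by rewrite -dE; exact: df.
move=> /cvgrPdist_lt/(_ e e0); rewrite /dnbhs/within/= => /nbhs_ballP[r /= r0 Hr].
exists r => // h hr; have [->|h0] := eqVneq h 0.
  by rewrite addr0 subrr mulr0 subr0 normr0 mulr0.
have := Hr h; rewrite /ball/= sub0r normrN => /(_ hr h0)/ltW.
rewrite /shift/= [h *: 1]mulr1 [h + x]addrC => le.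
have -> : f (x + h) - f x - d * h = - ((d - h^-1 * (f (x + h) - f x)) * h).
  by field.
by rewrite normrN normrM ler_wpM2r.
Qed.

(** By the functional equation it is enough to differentiate at 0, where the
first-order expansions of expR, cos and sin are known. *)
Lemma cder_cexp z : cder cexp z (cexp z).
Proof.
suff H : cder cexp 0 1.
  have E : (fun w => cexp z * cexp (w - z)) = cexp.
    by apply/funext => w; rewrite -cexpD addrC subrK.
  rewrite -E.
  have H1 : cder (fun w => w - z) z 1.
    by apply: cder_eq (cderB (cderid z) (cderc z z)) _; rewrite subr0.
  have H2 : cder cexp (z - z) 1 by rewrite subrr.
  have := cderZ (cexp z) (cder_comp H1 H2).
  by move=> /cder_eq; apply; rewrite !mulr1 subrr cexp0 mulr1.
apply/cder_eps => e e0; pose e' := Num.min 1 (e / 6).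
have e'0 : 0 < e' by rewrite lt_min ltr01 divr_gt0.
have e'1 : e' <= 1 by rewrite ge_min lexx.
have e'e : 6 * e' <= e.
  have : e' <= e / 6 by rewrite ge_min lexx orbT.
  by lra.
have [r1 r10 H1] := rder_eps (is_derive_expR (0 : R)) e'0.
have [r2 r20 H2] := rder_eps (is_derive_cos (0 : R)) e'0.
have [r3 r30 H3] := rder_eps (is_derive_sin (0 : R)) e'0.
pose r4 : R := e' / 2; have r40 : 0 < r4 by rewrite divr_gt0.
exists (Num.min (Num.min r1 r2) (Num.min r3 r4)).
  by rewrite !lt_min r10 r20 r30.
move=> w; rewrite subr0 !lt_min => /andP[/andP[w1 w2] /andP[w3 w4]].
have wa := Re_le_cabs w; have wb := Im_le_cabs w.
move: (cabs w) (cabs_ge0 w) w1 w2 w3 w4 wa wb => W W0 w1 w2 w3 w4 wa wb.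
have := H1 _ (le_lt_trans wa w1); have := H2 _ (le_lt_trans wb w2).
have := H3 _ (le_lt_trans wb w3).
rewrite !add0r expR0 cos0 sin0 oppr0 mul0r !subr0 !mul1r.
rewrite cexp0 /cexp; case: w wa wb => a b /= wa wb.
rewrite ?(mul1r, mul0r, subr0, addr0) => h3 h2 h1.
apply: le_trans (cabs_le _) _.
rewrite !ReIm oppr0 addr0.
set E := expR a.
have E1 : `|E - 1| <= e'.
  have -> : E - 1 = (E - 1 - a) + a by ring.
  rewrite (le_trans (ler_normD _ _))//.
  have : e' * `|a| <= 1 * `|a| by rewrite ler_wpM2r.
  by rewrite /r4 in w4; lra.
have E0 : 0 < E := expR_gt0 _.
have E2 : E <= 2 by have := ler_norm (E - 1); lra.
have a0 : 0 <= `|a| by []. have b0 : 0 <= `|b| by [].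
have HR : `|E * cos b - 1 - a| <= 3 * e' * W.
  have -> : E * cos b - 1 - a = E * (cos b - 1) + (E - 1 - a) by ring.
  rewrite (le_trans (ler_normD _ _))// normrM (gtr0_norm E0).
  have : E * `|cos b - 1| <= 2 * (e' * `|b|) by rewrite ler_pM// ltW.
  have : e' * `|b| <= e' * W by rewrite ler_wpM2l// ltW.
  have : e' * `|a| <= e' * W by rewrite ler_wpM2l// ltW.
  by lra.
have HI : `|E * sin b - b| <= 3 * e' * W.
  have -> : E * sin b - b = E * (sin b - b) + (E - 1) * b by ring.
  rewrite (le_trans (ler_normD _ _))// !normrM (gtr0_norm E0).
  have : E * `|sin b - b| <= 2 * (e' * `|b|) by rewrite ler_pM// ltW.
  have : `|E - 1| * `|b| <= e' * `|b| by rewrite ler_wpM2r.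
  have : e' * `|b| <= e' * W by rewrite ler_wpM2l// ltW.
  by lra.
have H6 : 6 * e' * W <= e * W by rewrite ler_wpM2r.
by apply: le_trans (lerD HR HI) _; lra.
Qed.

(** The principal logarithm; the argument is given by the arcsine, which is
correct on the right half-plane. *)
Definition clog z : C := Complex (ln (cabs z)) (asin (complex.Im z / cabs z)).

Lemma Re_gt0_cabs z : 0 < complex.Re z -> 0 < cabs z.
Proof. by move=> z0; rewrite (lt_le_trans z0)// (le_trans (ler_norm _))//
  Re_le_cabs. Qed.

Lemma Im_div_cabs z : 0 < complex.Re z -> -1 < complex.Im z / cabs z < 1.
Proof.
move=> z0; have c0 := Re_gt0_cabs z0.
rewrite -ltr_norml normrM normfV (gtr0_norm c0) ltr_pdivrMr// mul1r.
rewrite -(@ltr_pXn2r _ 2) ?nnegrE ?normr_ge0 ?(ltW c0)// cabs_sqr real_normK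
  ?num_real//.
by rewrite ltrDr exprn_gt0.
Qed.

Lemma cexp_clog z : 0 < complex.Re z -> cexp (clog z) = z.
Proof.
move=> z0; have c0 := Re_gt0_cabs z0.
have /andP[h1 h2] := Im_div_cabs z0.
rewrite /cexp /clog /= lnK ?posrE// asinK ?in_itv/= ?ltW//.
rewrite cos_asin; last by rewrite !ltW.
have -> : 1 - (complex.Im z / cabs z) ^+ 2 = (complex.Re z / cabs z) ^+ 2.
  have -> : (complex.Re z / cabs z) ^+ 2 = complex.Re z ^+2 / cabs z ^+ 2.
    by rewrite exprMn exprVn.
  have -> : (complex.Im z / cabs z) ^+ 2 = complex.Im z ^+2 / cabs z ^+ 2.
    by rewrite exprMn exprVn.
  have := cabs_sqr z; have : cabs z ^+ 2 != 0 by rewrite gt_eqF// exprn_gt0.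
  move: (cabs z ^+ 2) => q q0 qE; have -> : complex.Re z ^+ 2 =
    q - complex.Im z ^+ 2.
    by rewrite qE; ring.
  by field.
rewrite sqrtr_sqr ger0_norm; last by rewrite divr_ge0// ltW.
apply: complexPE; rewrite !ReIm mulrC divfK ?gt_eqF//.
Qed.

Lemma Im_clog z : 0 < complex.Re z ->
  - (pi / 2) < complex.Im (clog z) < pi / 2.
Proof.
move=> z0; have /andP[h1 h2] := Im_div_cabs z0.
by rewrite /clog/= asin_gtNpi2 ?asin_ltpi2// ?h1 ?h2 ?ltW.
Qed.

Lemma clogR t : 0 < t -> clog (rc t) = rc (ln t).
Proof.
move=> t0; rewrite /clog cabsR gtr0_norm//= mul0r.
have -> : asin (0 : R) = 0.
  have := @sinK R 0; rewrite sin0; apply.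
  by rewrite in_itv/= oppr_le0 divr_ge0 ?pi_ge0.
by [].
Qed.

Lemma Re_cts z : {for z, continuous (fun w : C => complex.Re w)}.
Proof.
pose f (w : C) : R := complex.Re w; rewrite -/f.
suff : f @ nbhs z --> f z by [].
apply/cvgrPdist_lt => e e0; rewrite near_simpl; apply/nbhsCP;
  exists e => // w wz; rewrite /f.
have -> : complex.Re z - complex.Re w = complex.Re (z - w).
  by case: z {wz} w => ? ? [].
by rewrite (le_lt_trans (Re_le_cabs _))// cabsC.
Qed.

Lemma Im_cts z : {for z, continuous (fun w : C => complex.Im w)}.
Proof.
pose f (w : C) : R := complex.Im w; rewrite -/f.
suff : f @ nbhs z --> f z by [].
apply/cvgrPdist_lt => e e0; rewrite near_simpl; apply/nbhsCP;
  exists e => // w wz; rewrite /f.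
have -> : complex.Im z - complex.Im w = complex.Im (z - w).
  by case: z {wz} w => ? ? [].
by rewrite (le_lt_trans (Im_le_cabs _))// cabsC.
Qed.

Lemma cabs_cts z : {for z, continuous (fun w : C => cabs w)}.
Proof.
pose f (w : C) : R := cabs w; rewrite -/f.
suff : f @ nbhs z --> f z by [].
apply/cvgrPdist_lt => e e0; rewrite near_simpl; apply/nbhsCP;
  exists e => // w wz; rewrite /f.
rewrite (le_lt_trans _ wz)// ler_norml.
have := cabsD (z - w) w; have := cabsD (w - z) z.
by rewrite !subrK cabsC => ? ?; apply/andP; split; lra.
Qed.

Lemma clog_cts z : 0 < complex.Re z -> {for z, continuous clog}.
Proof.
move=> z0; have c0 := Re_gt0_cabs z0.
have H1 : {for z, continuous (fun w : C => ln (cabs w))}.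
  apply: (@continuous_comp _ _ _ (fun w : C => cabs w) (@ln R)).
    exact: cabs_cts.
  exact: continuous_ln.
have H2 : {for z, continuous (fun w : C => asin (complex.Im w / cabs w))}.
  apply: (@continuous_comp _ _ _ (fun w : C => complex.Im w / cabs w) (@asin R)).
    apply: (@continuousM R C); first exact: Im_cts.
    apply: (@continuousV R C); first by rewrite gt_eqF.
    exact: cabs_cts.
  exact/continuous_asin/Im_div_cabs.
suff : clog @ nbhs z --> clog z by [].
apply/cvgrPdist_lt => e; rewrite near_simpl.
rewrite ltcE => /andP[/eqP/= eI] => e0.
have e2 : 0 < complex.Re e / 2 by rewrite divr_gt0.
have /cvgrPdist_lt/(_ _ e2)/nbhsCP[r1 r10 {}H1] := H1.
have /cvgrPdist_lt/(_ _ e2)/nbhsCP[r2 r20 {}H2] := H2.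
apply/nbhsCP; exists (Num.min r1 r2) => [|w]; first by rewrite lt_min r10.
rewrite lt_min => /andP[/H1 {}H1 /H2 {}H2].
rewrite normCE ltcE/= eI eqxx/= (le_lt_trans (cabs_le _))//.
by rewrite [ltRHS]splitr ltrD.
Qed.

(** With u = clog w - clog z, the expansion of cexp at clog z compares w - z
with z u. *)
Lemma cder_clog z : 0 < complex.Re z -> cder clog z (z^-1).
Proof.
move=> z0; have c0 := Re_gt0_cabs z0.
have /cder_eps Hexp := cder_cexp (clog z).
have zn0 : z != 0 by rewrite -cabs_gt0.
apply/cder_eps => e e0.
pose c := cabs z; have cc0 : 0 < c by [].
pose e1 := Num.min (c / 2) (e * c ^+ 2 / 2).
have e10 : 0 < e1 by rewrite lt_min !divr_gt0// mulr_gt0// exprn_gt0.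
have e1c : e1 <= c / 2 by rewrite ge_min lexx.
have e1e : e1 <= e * c ^+ 2 / 2 by rewrite ge_min lexx orbT.
have [r1 r10 H1] := Hexp _ e10.
have /nbhsCP[r2 r20 H2] : nbhs z [set w | cabs (clog w - clog z) < r1].
  have /cvgrPdist_lt/(_ (rc r1)) := clog_cts z0.
  rewrite ltcR => /(_ r10); apply: filterS => w /=.
  by rewrite normCE ltcR cabsC.
have /nbhsCP[r3 r30 H3] : nbhs z [set w : C | 0 < complex.Re w].
  by have /cvgrPdist_lt/(_ _ z0) := @Re_cts z; apply: filterS => w /=;
    rewrite ltr_norml => /andP[]; lra.
exists (Num.min r2 r3) => [|w]; first by rewrite lt_min r20.
rewrite lt_min => /andP[/H2/= {}H2 /H3/= w0].
have := H1 _ H2; rewrite !cexp_clog//.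
set u := clog w - clog z; set v := w - z => le.
have uv : c * cabs u <= 2 * cabs v.
  have : cabs (z * u) <= cabs v + cabs (v - z * u).
    by have := cabsB v (v - z * u); rewrite subKr.
  rewrite cabsM -/c; have := ler_wpM2r (cabs_ge0 u) e1c; lra.
have -> : u - z^-1 * v = - (z^-1 * (v - z * u)).
  by field.
rewrite cabsN cabsM cabsV -/c mulrC ler_pdivrMr// (le_trans le)//.
rewrite -(ler_pM2r cc0).
have -> : e1 * cabs u * c = e1 * (c * cabs u) by ring.
apply: (@le_trans _ _ (e1 * (2 * cabs v))); first by rewrite ler_wpM2l// ltW.
have := ler_wpM2r (cabs_ge0 v) e1e; rewrite expr2; lra.
Qed.

Definition csqrt z := cexp (clog z / 2).

Lemma csqrtK z : 0 < complex.Re z -> csqrt z * csqrt z = z.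
Proof.
move=> z0; rewrite /csqrt -cexpD.
have -> : clog z / 2 + clog z / 2 = clog z by field.
exact: cexp_clog.
Qed.

Lemma cder_csqrt z : 0 < complex.Re z -> exists d, cder csqrt z d.
Proof.
move=> z0; exists (cexp (clog z / 2) * (z^-1 * 2^-1 + clog z * 0)).
exact: (cder_comp (cderM (cder_clog z0) (cderc 2^-1 z)) (cder_cexp _)).
Qed.

Lemma csqrtR t : 0 < t -> csqrt (rc t) = rc (Num.sqrt t).
Proof.
move=> t0; rewrite /csqrt clogR//.
have -> : rc (ln t) / 2 = rc (ln t / 2) by rewrite rmorphM/= fmorphV/= rmorph_nat.
rewrite cexpR; congr (rc _); apply/eqP.
rewrite -(@eqrXn2 _ 2) ?expR_ge0 ?sqrtr_ge0//.
by rewrite sqr_sqrtr ?ltW// -expRM_natl mulrC divfK ?pnatr_eq0// lnK.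
Qed.

(** A quarter or half turn brings the point into the right half-plane. *)
Lemma clog_exists z : z != 0 -> exists u, cexp u = z.
Proof.
have Hpos w : 0 < complex.Re w -> exists u, cexp u = w.
  by move=> w0; exists (clog w); exact: cexp_clog.
have rot k w : (exists u, cexp u = cexp k * w) -> exists u, cexp u = w.
  by case=> u uE; exists (u - k);
    rewrite cexpB uE mulrAC mulfV ?cexp_neq0// mul1r.
move=> z0; case: (ltgtP (complex.Re z) 0) => Hre; last first.
- have Him : complex.Im z != 0.
    by move: z0; rewrite eq_complex/= Hre eqxx.
  case: (ltgtP (complex.Im z) 0) Him => // Him _.
  + apply: (rot (ii * rc (pi / 2))); apply: Hpos; rewrite cexp_ipi2.
    by move: Him Hre; case: z {z0} => a b /=; rewrite mul0r mul1r; lra.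
  + apply: (rot (- (ii * rc (pi / 2)))); apply: Hpos; rewrite cexpN cexp_ipi2.
    have -> : ii^-1 = - ii.
      have i0 : ii != 0 by rewrite -cexp_ipi2 cexp_neq0.
      by apply: (mulfI i0); rewrite mulfV// mulrN ii2 opprK.
    by move: Him Hre; case: z {z0} => a b /=; rewrite oppr0 mul0r mulN1r; lra.
- exact: Hpos.
- apply: (rot (ii * rc pi)); apply: Hpos; rewrite cexp_ipi mulN1r.
  by move: Hre; case: z {z0} => a b /=; lra.
Qed.

Lemma cos_eq1 t : 0 <= t < 2 * pi -> cos t = 1 -> t = 0.
Proof.
move=> /andP[t0 t2] ct; have pi0 := pi_gt0 R.
have zi : (0 : R) \in `[0, pi]%R by rewrite in_itv/= lexx ltW.
have [tpi|pit] := leP t pi.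
  have ti : t \in `[0, pi]%R by rewrite in_itv/= t0.
  by apply: (cos_inj ti zi); rewrite ct cos0.
have ti : 2 * pi - t \in `[0, pi]%R by rewrite in_itv/=; apply/andP; split; lra.
suff : 2 * pi - t = 0 by lra.
have E : 2 * pi - t = - t + pi *+ 2 by rewrite -[pi *+ 2]mulr_natl; ring.
by apply: (cos_inj ti zi); rewrite E cosD2pi cosN ct cos0.
Qed.

Lemma cexp_eq1 z : cexp z = 1 -> exists k : int, z = 2 * rc pi * ii * k%:~R.
Proof.
move=> z1; have pi0 := pi_gt0 R.
have Rz : complex.Re z = 0.
  by apply: expR_inj; rewrite expR0 -cabs_cexp z1 cabs1.
pose k := Num.floor (complex.Im z / (2 * pi)).
have p2 : 0 < 2 * (pi : R) by rewrite mulr_gt0.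
have /andP[k1 k2] := floor_itv (complex.Im z / (2 * pi)).
pose b := complex.Im z - 2 * pi * k%:~R.
have E (j : int) : cexp (2 * rc pi * ii * j%:~R) = 1.
  have En (n : nat) : cexp (2 * rc pi * ii * n%:R) = 1.
    rewrite mulrC cexpX.
    have -> : 2 * rc pi * ii = ii * rc pi + ii * rc pi by ring.
    by rewrite cexpD cexp_ipi mulrNN mulr1 expr1n.
  case: j => n; first exact: En.
  by rewrite NegzE mulrNz mulrN cexpN En invr1.
have zb : z = ii * rc b + 2 * rc pi * ii * k%:~R.
  rewrite [LHS]cE Rz /b rmorphB/= !rmorphM/= rmorph_int rmorph_nat.
  by rewrite add0r; ring.
have b0 : b = 0.
  apply: cos_eq1.
    move: k1 k2; rewrite ler_pdivlMr// ltr_pdivrMr// intrD /b -/k => k1 k2.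
    by apply/andP; split; lra.
  move: z1; rewrite zb cexpD E mulr1 cexp_i => /eqP.
  by rewrite eq_complex/= => /andP[/eqP].
by exists k; rewrite {1}zb b0 mulr0 add0r.
Qed.

Lemma cexp_eq z w : cexp z = cexp w ->
  exists k : int, z = w + 2 * rc pi * ii * k%:~R.
Proof.
move=> zw; have /cexp_eq1[k kE] : cexp (z - w) = 1.
  by rewrite cexpB zw mulfV// cexp_neq0.
by exists k; rewrite -kE addrC subrK.
Qed.

(** Two logarithms of the same number differ by a multiple of 2 pi i. *)
Lemma cexp_inj z w : cexp z = cexp w ->
  `|complex.Im z - complex.Im w| < 2 * pi -> z = w.
Proof.
move=> /cexp_eq[k kE] lt; suff k0 : k = 0 by rewrite kE k0 mulr0 addr0.
move: lt; have -> : complex.Im z - complex.Im w = 2 * pi * k%:~R.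
  have -> : complex.Im z - complex.Im w = complex.Im (z - w).
    by case: z {kE} w => ? ? [].
  rewrite kE addrC addKr.
  have -> : 2 * rc pi * ii * k%:~R = ii * rc (2 * pi * k%:~R).
    by rewrite !rmorphM/= rmorph_int rmorph_nat; ring.
  by rewrite Im_Mi Re_rc.
have p2 : 0 < 2 * (pi : R) by rewrite mulr_gt0// pi_gt0.
rewrite normrM gtr0_norm// gtr_pMr// -intr_norm ltrz1.
by move=> k1; lia.
Qed.

End ComplexExponential.

(** * The scalar equation, at 0 and at infinity *)

Section ScalarEquation.
Variables (R : realType) (k : nat).
Local Notation C := (CC R).
Implicit Types (z mu s l om : C).
Local Notation n := k.+2.
Local Notation N := (n%:R : C).
Local Notation m := (N^-1).

Definition qcoef z : C := N ^+ 2 * z ^+ k / (z ^+ n - 1) ^+ 2.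

(** The equation satisfied by the second entry of a row (lam b', b) of a
solution of dPhi = Phi xi, for mu = v / lam. Carrying the derivative db along
avoids second derivatives. *)
Definition scalar_sol mu (b db : C -> C) z :=
  cder b z (db z) /\ cder db z (mu * qcoef z * b z).

Definition wronsk (b db c dc : C -> C) z := b z * dc z - db z * c z.

Lemma cder_wronsk mu b db c dc z : scalar_sol mu b db z -> scalar_sol mu c dc z ->
  cder (wronsk b db c dc) z 0.
Proof.
move=> [b1 b2] [c1 c2].
by apply: cder_eq (cderB (cderM b1 c2) (cderM b2 c1)) _; ring.
Qed.

Lemma wronsk_cst mu b db c dc (D : set C) (sig dsig : C -> C) : cconvex D ->
  (forall d, D d -> [/\ cder sig d (dsig d), scalar_sol mu b db (sig d) &
    scalar_sol mu c dc (sig d)]) ->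
  forall d1 d2, D d1 -> D d2 ->
  wronsk b db c dc (sig d1) = wronsk b db c dc (sig d2).
Proof.
move=> Dc H; apply: (cder0_convex (f := fun d => wronsk b db c dc (sig d))) Dc _.
move=> d /H[h1 h2 h3].
by apply: cder_eq (cder_comp h1 (cder_wronsk h2 h3)) _; rewrite mul0r.
Qed.

Lemma N_neq0 : N != 0. Proof. by rewrite pnatr_eq0. Qed.

Lemma expz z : z ^+ n = z ^+ k * z ^+ 2.
Proof. by rewrite -exprD addn2. Qed.

Lemma expz1 z : z ^+ k.+1 = z ^+ k * z.
Proof. by rewrite exprSr. Qed.

Lemma cder_zn z : cder (fun w => w ^+ n) z (N * (z ^+ k * z)).
Proof.
by apply: cder_eq (cderX n (cderid z)) _; rewrite mulr1 /= expz1.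
Qed.

Lemma cder_zn1 z : cder (fun w => w ^+ k.+1) z ((N - 1) * z ^+ k).
Proof.
apply: cder_eq (cderX k.+1 (cderid z)) _; rewrite mulr1 /=.
by rewrite -[k.+2%:R]natr1 addrK.
Qed.

(** Pull-back of the hypergeometric equation by y, with a factor E. Once F'' is
eliminated by means of that equation, the last two hypotheses are the vanishing
of the coefficients of F and of F'. *)
Lemma scalar_sol_comp mu (E E1 y y1 : C -> C) (E2 y2 A sg pp gm : C) z :
  cder E z (E1 z) -> cder E1 z E2 -> cder y z (y1 z) -> cder y1 z y2 ->
  cabs (y z) < 1 -> (forall j : nat, gm + j%:R != 0) ->
  y1 z ^+ 2 = A * (y z * (1 - y z)) ->
  E2 + E z * A * pp = mu * qcoef z * E z ->
  2 * E1 z * y1 z + E z * (y2 - A * (gm - (sg + 1) * y z)) = 0 ->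
  scalar_sol mu (fun w => E w * hyp sg pp gm (y w))
    (fun w => E1 w * hyp sg pp gm (y w) + E w * y1 w * dhyp sg pp gm (y w)) z.
Proof.
move=> hE hE1 hy hy1 yz1 gm0 eA e0 e1; set F := hyp sg pp gm.
have hF := cder_comp hy (cder_hyp sg pp gm yz1).
have hdF := cder_comp hy (cder_dhyp sg pp gm yz1).
have ode := hyp_ode sg pp gm0 yz1.
split.
  apply: cder_eq (cderM hE hF) _; rewrite /F; ring.
apply: cder_eq (cderD (cderM hE1 hF) (cderM (cderM hE hy1) hdF)) _.
rewrite -/F -/(F _).
have -> : mu * qcoef z * (E z * F (y z)) = (mu * qcoef z * E z) * F (y z) by ring.
rewrite -e0.
have e2 : E z * y1 z * (ddhyp sg pp gm (y z) * y1 z) =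
  E z * A * (y z * (1 - y z) * ddhyp sg pp gm (y z)).
  have -> : E z * y1 z * (ddhyp sg pp gm (y z) * y1 z) =
     E z * (y1 z ^+ 2) * ddhyp sg pp gm (y z) by ring.
  by rewrite eA; ring.
have e3 : y z * (1 - y z) * ddhyp sg pp gm (y z) = pp * F (y z)
   - (gm - (sg + 1) * y z) * dhyp sg pp gm (y z).
  by apply/eqP; rewrite -subr_eq0; apply/eqP; rewrite -[RHS]ode /F; ring.
rewrite e2 e3.
transitivity ((E2 + E z * A * pp) * F (y z) +
  (2 * E1 z * y1 z + E z * (y2 - A * (gm - (sg + 1) * y z))) *
   dhyp sg pp gm (y z)); first by ring.
by rewrite e1 mul0r addr0.
Qed.

(** The hypergeometric coordinate at z = 0. It sends the roots of unity to
infinity, and z -> 1/z becomes y -> 1 - y. *)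
Definition ycoord z : C := z ^+ n / (z ^+ n - 1).
Definition dycoord z : C := - N * z ^+ k.+1 / (z ^+ n - 1) ^+ 2.

Lemma cder_ycoord z : z ^+ n != 1 -> cder ycoord z (dycoord z).
Proof.
move=> z1; have x1 : z ^+ n - 1 != 0 by rewrite subr_eq0.
have h := cderB (cder_zn z) (cderc 1 z).
have h2 := cderV (f := fun w => w ^+ n - 1) x1 h.
apply: cder_eq (cderM (cder_zn z) h2) _.
by rewrite /dycoord expz1; field.
Qed.

Lemma cder_dycoord z : z ^+ n != 1 -> cder dycoord z
  (- N * (N - 1) * z ^+ k / (z ^+ n - 1) ^+ 2 +
   2 * N ^+ 2 * z ^+ k * z ^+ n / (z ^+ n - 1) ^+ 3).
Proof.
move=> z1; have x1 : z ^+ n - 1 != 0 by rewrite subr_eq0.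
have x2 : (z ^+ n - 1) ^+ 2 != 0 by rewrite expf_neq0.
have h := cderX 2 (cderB (cder_zn z) (cderc 1 z)).
have h2 := cderV (f := fun w => (w ^+ n - 1) ^+ 2) x2 h.
have h3 := cderM (cderZ (- N) (cder_zn1 z)) h2.
apply: cder_eq h3 _.
move: x1; rewrite /= expz1 expz; move: (z ^+ k) => P x1.
by field.
Qed.

Lemma gm1_neq0 (j : nat) : 1 - m + j%:R != 0.
Proof.
have -> : 1 - m + j%:R = (k.+1 + j * n)%:R / N.
  rewrite natrD natrM -[k.+1%:R](addrK 1) natr1.
  by have := N_neq0; move: N => K K0; field.
by rewrite mulf_neq0 ?invr_eq0 ?N_neq0// pnatr_eq0.
Qed.

Lemma gm2_neq0 (j : nat) : 1 + m + j%:R != 0.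
Proof.
have -> : 1 + m + j%:R = (n.+1 + j * n)%:R / N.
  rewrite natrD natrM -[n.+1%:R]natr1.
  by have := N_neq0; move: N => K K0; field.
by rewrite mulf_neq0 ?invr_eq0 ?N_neq0// pnatr_eq0.
Qed.

(** The solutions at z = 0 of exponents 0 and 1. *)
Definition b1 mu z := hyp 1 (- mu) (1 - m) (ycoord z).
Definition db1 mu z := dycoord z * dhyp 1 (- mu) (1 - m) (ycoord z).
Definition b2 mu z := z * hyp 1 (- mu) (1 + m) (ycoord z).
Definition db2 mu z := hyp 1 (- mu) (1 + m) (ycoord z) +
  z * dycoord z * dhyp 1 (- mu) (1 + m) (ycoord z).

Lemma dycoord_sqr z : z ^+ n != 1 ->
  dycoord z ^+ 2 = (- N ^+ 2 * z ^+ k / (z ^+ n - 1) ^+ 2) * (ycoord z * (1 -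
    ycoord z)).
Proof.
move=> z1; have : z ^+ n - 1 != 0 by rewrite subr_eq0.
by rewrite /dycoord /ycoord expz1 expz; move: (z ^+ k) => P x1; field.
Qed.

Lemma scalar_sol_b1 mu z : z ^+ n != 1 -> cabs (ycoord z) < 1 ->
  scalar_sol mu (b1 mu) (db1 mu) z.
Proof.
move=> z1 y1; have x1 : z ^+ n - 1 != 0 by rewrite subr_eq0.
have := @scalar_sol_comp mu (fun=> 1) (fun=> 0) ycoord dycoord 0 _
  (- N ^+ 2 * z ^+ k / (z ^+ n - 1) ^+ 2) 1 (- mu) (1 - m) z
  (cderc _ _) (cderc _ _) (cder_ycoord z1) (cder_dycoord z1) y1 gm1_neq0
    (dycoord_sqr z1).
have -> : (fun w => 1 * hyp 1 (- mu) (1 - m) (ycoord w)) = b1 mu.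
  by apply/funext => w; rewrite mul1r.
have -> : (fun w => 0 * hyp 1 (- mu) (1 - m) (ycoord w) +
   1 * dycoord w * dhyp 1 (- mu) (1 - m) (ycoord w)) = db1 mu.
  by apply/funext => w; rewrite mul0r add0r mul1r.
apply; first by rewrite /qcoef; ring.
have := N_neq0; rewrite /ycoord.
by move: x1; rewrite expz; move: (z ^+ k) N => P K x1 K0; field; rewrite x1.
Qed.

Lemma scalar_sol_b2 mu z : z ^+ n != 1 -> cabs (ycoord z) < 1 ->
  scalar_sol mu (b2 mu) (db2 mu) z.
Proof.
move=> z1 y1; have x1 : z ^+ n - 1 != 0 by rewrite subr_eq0.
have := @scalar_sol_comp mu (fun w => w) (fun=> 1) ycoord dycoord 0 _
  (- N ^+ 2 * z ^+ k / (z ^+ n - 1) ^+ 2) 1 (- mu) (1 + m) z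
  (cderid _) (cderc _ _) (cder_ycoord z1) (cder_dycoord z1) y1 gm2_neq0
    (dycoord_sqr z1).
have -> : (fun w => 1 * hyp 1 (- mu) (1 + m) (ycoord w) +
   w * dycoord w * dhyp 1 (- mu) (1 + m) (ycoord w)) = db2 mu.
  by apply/funext => w; rewrite mul1r.
apply; first by rewrite /qcoef; ring.
have := N_neq0; rewrite /ycoord /dycoord expz1.
by move: x1; rewrite expz; move: (z ^+ k) N => P K x1 K0; field; rewrite x1.
Qed.

(** Inversion z -> 1/z; the factor z is the weight under which the equation is
invariant. *)
Definition inv (b : C -> C) z := z * b z^-1.
Definition dinv (b db : C -> C) z := b z^-1 - db z^-1 / z.

Lemma scalar_sol_inv mu b db z : z != 0 -> z ^+ n != 1 ->
  scalar_sol mu b db z^-1 ->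
  scalar_sol mu (inv b) (dinv b db) z.
Proof.
move=> z0 z1 [h1 h2].
have x1 : z ^+ n - 1 != 0 by rewrite subr_eq0.
have hi : cder (fun w => w^-1) z (- 1 / z ^+ 2) by exact: cderV (cderid z).
split.
  apply: cder_eq (cderM (cderid z) (cder_comp hi h1)) _.
  by rewrite /dinv; field.
apply: cder_eq (cderB (cder_comp hi h1) (cderM (cder_comp hi h2) hi)) _.
rewrite /inv /qcoef !exprVn.
have P0 : z ^+ k != 0 by rewrite expf_neq0.
move: x1; rewrite expz; move: (z ^+ k) P0 => P P0 x1.
field; rewrite x1 z0 P0 /= mulN1r.
by rewrite -[1 - _]opprB oppr_eq0.
Qed.

Definition b3 mu := inv (b1 mu).
Definition db3 mu := dinv (b1 mu) (db1 mu).
Definition b4 mu := inv (b2 mu).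
Definition db4 mu := dinv (b2 mu) (db2 mu).

End ScalarEquation.

(** * Two by two matrices *)

Section Mx2.
Variable (F : fieldType).
Definition mx2 (a b c d : F) : 'M[F]_2 := \matrix_(i < 2, j < 2)
  if i == 0 then (if j == 0 then a else b) else (if j == 0 then c else d).

Lemma mx2E (M : 'M[F]_2) : M = mx2 (M 0 0) (M 0 1) (M 1 0) (M 1 1).
Proof.
by apply/matrixP => -[[|[|//]] /= hi] [[|[|//]] /= hj]; rewrite !mxE/=;
  congr (M _ _); apply/val_inj.
Qed.

Lemma mx2_mul a b c d a' b' c' d' : mx2 a b c d *m mx2 a' b' c' d' =
  mx2 (a * a' + b * c') (a * b' + b * d') (c * a' + d * c') (c * b' + d * d').
Proof.
apply/matrixP => i j; rewrite !mxE !big_ord_recl big_ord0 !mxE/= addr0.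
by case: (i == 0); case: (j == 0).
Qed.

Lemma mx2_det a b c d : \det (mx2 a b c d) = a * d - b * c.
Proof.
rewrite (expand_det_row _ 0) !big_ord_recl big_ord0 addr0 /cofactor !mxE/=.
rewrite !det_mx11 !mxE/= expr0 mul1r.
by rewrite /bump/= addn0 expr1 mulN1r mulrN.
Qed.

Lemma mx2_1 : 1%:M = mx2 1 0 0 1.
Proof. by rewrite [LHS]mx2E !mxE. Qed.

Lemma mx2_inj a b c d a' b' c' d' : mx2 a b c d = mx2 a' b' c' d' ->
  [/\ a = a', b = b', c = c' & d = d'].
Proof.
move=> /matrixP E.
by have := E 0 0; have := E 0 1; have := E 1 0; have := E 1 1; rewrite !mxE.
Qed.

Lemma mx2_adj a b c d e : a * d - b * c = e ->
  mx2 a b c d *m mx2 d (- b) (- c) a = e *: 1%:M.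
Proof.
move=> <-; rewrite mx2_mul mx2_1 [RHS]mx2E !mxE/=.
by congr mx2; ring.
Qed.

Lemma mx2_adjl a b c d e : a * d - b * c = e ->
  mx2 d (- b) (- c) a *m mx2 a b c d = e *: 1%:M.
Proof.
move=> <-; rewrite mx2_mul mx2_1 [RHS]mx2E !mxE/=.
by congr mx2; ring.
Qed.

Lemma mx2_unit a b c d : (mx2 a b c d \in unitmx) = (a * d - b * c != 0).
Proof. by rewrite unitmxE unitfE mx2_det. Qed.

End Mx2.

(** * The connection matrix between 0 and infinity *)

Section Connection.
Variables (R : realType) (k : nat).
Local Notation C := (CC R).
Implicit Types (z mu s l om x y : C).
Local Notation n := k.+2.
Local Notation N := (n%:R : C).
Local Notation m := (N^-1).
Local Notation rc t := (t%:C)%C.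
Local Notation ii := ('i%C : C).
Local Notation scalar_sol := (@scalar_sol R k).
Local Notation b1 := (@b1 R k). Local Notation db1 := (@db1 R k).
Local Notation b2 := (@b2 R k). Local Notation db2 := (@db2 R k).
Local Notation b3 := (@b3 R k). Local Notation db3 := (@db3 R k).
Local Notation b4 := (@b4 R k). Local Notation db4 := (@db4 R k).
Local Notation ycoord := (@ycoord R k). Local Notation dycoord := (@dycoord R k).

(** Derivatives come first, so that the rows (f', f) match the rows (lam f', f)
of Phi. *)
Definition sol_mx (f df g dg : C -> C) z := mx2 (df z) (f z) (dg z) (g z).

(** The product of the first matrix with the adjugate of the second has
Wronskians as entries, and these are constant. The map sig from a convex set
allows domains such as sectors, which are images of convex sets under a root. *)
Lemma connection_cst mu (D : set C) (sig dsig f df g dg c dc e de : C -> C)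
  kap d0 :
  cconvex D -> kap != 0 -> D d0 ->
  (forall d, D d -> cder sig d (dsig d) /\
    [/\ scalar_sol mu f df (sig d), scalar_sol mu g dg (sig d),
      scalar_sol mu c dc (sig d),
     scalar_sol mu e de (sig d) & \det (sol_mx c dc e de (sig d)) = kap]) ->
  let T := kap^-1 *: (sol_mx f df g dg (sig d0) *m
    mx2 (e (sig d0)) (- c (sig d0)) (- de (sig d0)) (dc (sig d0))) in
  forall d, D d -> sol_mx f df g dg (sig d) = T *m sol_mx c dc e de (sig d).
Proof.
move=> Dc kap0 Dd0 H /= d Dd.
have W b db b' db' : (forall d, D d -> scalar_sol mu b db (sig d) /\
  scalar_sol mu b' db' (sig d)) ->
    wronsk b db b' db' (sig d0) = wronsk b db b' db' (sig d).
  move=> Hb; apply: (@wronsk_cst R k mu _ _ _ _ D sig dsig Dc) => // d' Dd'.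
  by have [? ?] := Hb _ Dd'; have [? _] := H _ Dd'; split.
have E : sol_mx f df g dg (sig d0) *m
    mx2 (e (sig d0)) (- c (sig d0)) (- de (sig d0)) (dc (sig d0)) =
    sol_mx f df g dg (sig d) *m
    mx2 (e (sig d)) (- c (sig d)) (- de (sig d)) (dc (sig d)).
  rewrite /sol_mx !mx2_mul.
  have sol1 := fun d Dd => (H d Dd).2.
  have W1 : wronsk f df e de (sig d0) = wronsk f df e de (sig d).
    by apply: W => ? /sol1[].
  have W2 : wronsk f df c dc (sig d0) = wronsk f df c dc (sig d).
    by apply: W => ? /sol1[].
  have W3 : wronsk g dg e de (sig d0) = wronsk g dg e de (sig d).
    by apply: W => ? /sol1[].
  have W4 : wronsk g dg c dc (sig d0) = wronsk g dg c dc (sig d).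
    by apply: W => ? /sol1[].
  rewrite /wronsk in W1 W2 W3 W4.
  congr mx2.
  - transitivity (- (f (sig d0) * de (sig d0) - df (sig d0) * e (sig d0)));
    first by ring.
    by rewrite W1; ring.
  - transitivity (f (sig d0) * dc (sig d0) - df (sig d0) * c (sig d0));
    first by ring.
    by rewrite W2; ring.
  - transitivity (- (g (sig d0) * de (sig d0) - dg (sig d0) * e (sig d0)));
    first by ring.
    by rewrite W3; ring.
  - transitivity (g (sig d0) * dc (sig d0) - dg (sig d0) * c (sig d0));
    first by ring.
    by rewrite W4; ring.
rewrite E -scalemxAl -mulmxA (@mx2_adjl _ _ _ _ _ kap); last first.
  by have [_ [_ _ _ _ <-]] := H _ Dd; rewrite mx2_det.
by rewrite -scalemxAr mulmx1 scalerA mulVf// scale1r.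
Qed.

(** The inequality |y| < 1 in terms of z. *)
Definition disc0 z := complex.Re (z ^+ n) < 2^-1.
Definition disc_inf z := z != 0 /\ disc0 z^-1.

Lemma disc0_ne1 z : disc0 z -> z ^+ n != 1.
Proof. by rewrite /disc0; apply: contraTneq => ->; rewrite Re1 -leNgt; lra. Qed.

Lemma ne1_inv z : z != 0 -> z^-1 ^+ n != 1 -> z ^+ n != 1.
Proof. by move=> z0; apply: contra_neq => E; rewrite exprVn E invr1. Qed.

Lemma disc0_ycoord z : disc0 z -> cabs (ycoord z) < 1.
Proof.
move=> d0; have x1 := disc0_ne1 d0.
have c0 : 0 < cabs (z ^+ n - 1) by rewrite cabs_gt0 subr_eq0.
rewrite /ycoord cabsM cabsV ltr_pdivrMr// mul1r.
rewrite -(@ltr_pXn2r _ 2) ?nnegrE ?cabs_ge0// !cabs_sqr.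
move: d0; rewrite /disc0 ReD ImD ReN ImN Re1 Im1; move: (z ^+ n) => x d0.
rewrite subr0 sqrrB; lra.
Qed.

Definition fund0 mu := sol_mx (b2 mu) (db2 mu) (b1 mu) (db1 mu).
Definition fund_inf mu := sol_mx (b4 mu) (db4 mu) (b3 mu) (db3 mu).

Lemma scalar_sol1 mu z : disc0 z -> scalar_sol mu (b1 mu) (db1 mu) z.
Proof. by move=> d0; apply: scalar_sol_b1;
  [exact: disc0_ne1|exact: disc0_ycoord]. Qed.
Lemma scalar_sol2 mu z : disc0 z -> scalar_sol mu (b2 mu) (db2 mu) z.
Proof. by move=> d0; apply: scalar_sol_b2;
  [exact: disc0_ne1|exact: disc0_ycoord]. Qed.
Lemma scalar_sol3 mu z : disc_inf z -> scalar_sol mu (b3 mu) (db3 mu) z.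
Proof.
move=> [z0 d0].
exact: (scalar_sol_inv z0 (ne1_inv z0 (disc0_ne1 d0)) (scalar_sol1 mu d0)).
Qed.
Lemma scalar_sol4 mu z : disc_inf z -> scalar_sol mu (b4 mu) (db4 mu) z.
Proof.
move=> [z0 d0].
exact: (scalar_sol_inv z0 (ne1_inv z0 (disc0_ne1 d0)) (scalar_sol2 mu d0)).
Qed.

Lemma fund0_0 mu : fund0 mu 0 = 1%:M.
Proof.
rewrite /fund0 /sol_mx /b2 /db2 /b1 /db1 /ycoord /dycoord.
by rewrite !exprS !(mul0r, mulr0) !hyp0 addr0 mx2_1.
Qed.

(** The Wronskian is constant along the ray from 0 to z, and the domain is star-
shaped. *)
Lemma det_fund0 mu z : disc0 z -> \det (fund0 mu z) = 1.
Proof.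
move=> d0; pose W z := wronsk (b1 mu) (db1 mu) (b2 mu) (db2 mu) z.
have WE w : \det (fund0 mu w) = W w by rewrite mx2_det /W /wronsk; ring.
have W0 : W 0 = 1 by rewrite -WE fund0_0 det1.
rewrite WE -W0; apply/esym; apply: cder0_cst => t /andP[t0 t1].
rewrite add0r subr0.
have dt : disc0 (rc t * z).
  rewrite /disc0 exprMn -rmorphXn ReZ /=.
  have [le0|gt0] := leP (complex.Re (z ^+ n)) 0.
    by rewrite (@le_lt_trans _ _ 0)// mulr_ge0_le0// exprn_ge0.
  by rewrite (le_lt_trans _ d0)// ler_piMl ?(ltW gt0)// exprn_ile1.
by apply: cder_wronsk; [exact: scalar_sol1|exact: scalar_sol2].
Qed.

Lemma det_fund_inf mu z : disc_inf z -> \det (fund_inf mu z) = -1.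
Proof.
move=> [z0 d0]; have := det_fund0 mu d0;
  rewrite /fund0 /fund_inf /sol_mx !mx2_det.
rewrite /b4 /db4 /b3 /db3 /inv /dinv => <-.
by field.
Qed.

Lemma ycoord_rot z om : om ^+ n = 1 -> ycoord (om * z) = ycoord z.
Proof. by move=> o1; rewrite /ycoord exprMn o1 mul1r. Qed.

Lemma om_neq0 om : om ^+ n = 1 -> om != 0.
Proof. by apply: contra_eq_neq => ->; rewrite expr0n/= eq_sym oner_neq0. Qed.

Lemma om_pred om : om ^+ n = 1 -> om ^+ k.+1 = om^-1.
Proof.
move=> o1; have o0 := om_neq0 o1.
by apply: (mulfI o0); rewrite -exprS o1 mulfV.
Qed.

Lemma dycoord_rot z om : om ^+ n = 1 -> dycoord (om * z) = om^-1 * dycoord z.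
Proof.
move=> o1; rewrite /dycoord [(om * z) ^+ n]exprMn o1 mul1r.
by rewrite [(om * z) ^+ k.+1]exprMn (om_pred o1); ring.
Qed.

(** The equation is invariant under z -> om z, and the two solutions have
exponents 1 and 0. *)
Lemma fund0_rot mu z om : om ^+ n = 1 ->
  fund0 mu (om * z) = mx2 om 0 0 1 *m fund0 mu z *m mx2 om^-1 0 0 1.
Proof.
move=> o1; have o0 := om_neq0 o1.
rewrite /fund0 /sol_mx !mx2_mul /db2 /b2 /db1 /b1 ycoord_rot// dycoord_rot//.
by congr mx2; field.
Qed.

Lemma fund_inf_rot mu z om : z != 0 -> om ^+ n = 1 ->
  fund_inf mu (om * z) = mx2 1 0 0 om *m fund_inf mu z *m mx2 om^-1 0 0 1.
Proof.
move=> z0 o1; have o0 := om_neq0 o1.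
have oV : om^-1 ^+ n = 1 by rewrite exprVn o1 invr1.
rewrite /fund_inf /sol_mx !mx2_mul /db4 /b4 /db3 /b3 /inv /dinv invfM.
rewrite /db2 /b2 /db1 /b1 ycoord_rot// dycoord_rot// invrK.
by congr mx2; field; rewrite ?z0 ?o0.
Qed.

(** In the coordinate y the domains of the frames at 0 and at infinity meet in
the lens |y| < 1, |1 - y| < 1. *)
Definition lens : set C := [set y | cabs y < 1] `&` [set y | cabs (1 - y) < 1].
(** Section over the lens of the coordinate y, with values in the sector 0 < arg
z < 2 pi / n. The middle y = 1/2 of the lens gives z = exp (i pi / n). *)
Definition zlens y := cexp (m * (ii * rc pi + (clog y - clog (1 - y)))).
Definition zeta2n := cexp (m * (ii * rc pi)).

(** The quotient of the frames at 0 and at infinity, evaluated at the middle of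
the sector; the sign comes from the determinant -1 of the frame at infinity. *)
Definition conn_mx mu := - (fund0 mu zeta2n *m
   mx2 (b3 mu zeta2n) (- b4 mu zeta2n) (- db3 mu zeta2n) (db4 mu zeta2n)).

Lemma lens_Re y : lens y -> 0 < complex.Re y /\ 0 < complex.Re (1 - y).
Proof.
move=> [/= h1 h2]; rewrite ReD ReN Re1.
have := Re_le_cabs y; have := Re_le_cabs (1 - y); rewrite ReD ReN Re1.
by rewrite !ler_norml => /andP[? ?] /andP[? ?]; lra.
Qed.

Lemma lens_half : lens 2^-1.
Proof.
have c2 : cabs (2^-1 : C) = 2^-1 by rewrite cabsV cabs_nat.
split => /=; first by rewrite c2; lra.
have -> : 1 - 2^-1 = 2^-1 :> C by field.
by rewrite c2; lra.
Qed.

Lemma cconvex_lens : cconvex lens.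
Proof.
apply: cconvexI.
  have := @cconvex_ball R 0 1.
  have -> : [set z : C | cabs (z - 0) < 1] = [set y | cabs y < 1].
    by apply/funext => z /=; rewrite subr0.
  by [].
have := @cconvex_ball R 1 1.
have -> : [set z : C | cabs (z - 1) < 1] = [set y | cabs (1 - y) < 1].
  by apply/funext => z /=; rewrite cabsC.
by [].
Qed.

Lemma mN : N * m = 1. Proof. by rewrite mulfV// N_neq0. Qed.

Lemma zlens_n y : lens y -> zlens y ^+ n = - y / (1 - y).
Proof.
move=> /lens_Re[h1 h2]; rewrite /zlens -cexpX mulrA mN mul1r cexpD cexpB.
by rewrite !cexp_clog// cexp_ipi mulN1r mulNr.
Qed.

Lemma zlens_half : zlens 2^-1 = zeta2n.
Proof.
rewrite /zlens; have -> : 1 - 2^-1 = 2^-1 :> C by field.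
by rewrite subrr addr0.
Qed.

Lemma ycoord_zlens y : lens y -> ycoord (zlens y) = y.
Proof.
move=> ly; have [_ h2] := lens_Re ly.
have y1 : 1 - y != 0 by rewrite -cabs_gt0 Re_gt0_cabs.
rewrite /ycoord zlens_n//.
have -> : - y / (1 - y) - 1 = - (1 - y)^-1 by field.
by rewrite invrN invrK mulrN mulNr mulNr opprK divfK.
Qed.

Lemma ycoord_disc0 z : z ^+ n != 1 -> cabs (ycoord z) < 1 -> disc0 z.
Proof.
move=> x1; have c0 : 0 < cabs (z ^+ n - 1) by rewrite cabs_gt0 subr_eq0.
rewrite /ycoord cabsM cabsV ltr_pdivrMr// mul1r.
rewrite -(@ltr_pXn2r _ 2) ?nnegrE ?cabs_ge0// !cabs_sqr.
rewrite /disc0 ReD ImD ReN ImN Re1 Im1; move: (z ^+ n) => x.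
rewrite subr0 sqrrB; lra.
Qed.

Lemma ycoord_inv z : z != 0 -> z ^+ n != 1 -> ycoord z^-1 = 1 - ycoord z.
Proof.
move=> z0 x1; rewrite /ycoord exprVn.
have x0 : z ^+ n != 0 by rewrite expf_neq0.
have x2 : z ^+ n - 1 != 0 by rewrite subr_eq0.
field; rewrite x0 x2 /=.
by rewrite mulN1r -oppr_eq0 opprB.
Qed.

Lemma zlens_disc y : lens y -> disc0 (zlens y) /\ disc_inf (zlens y).
Proof.
move=> ly; have [h1 h2] := lens_Re ly; have [/= l1 l2] := ly.
have y1 : 1 - y != 0 by rewrite -cabs_gt0 Re_gt0_cabs.
have z0 : zlens y != 0 by exact: cexp_neq0.
have x1 : zlens y ^+ n != 1.
  rewrite zlens_n//; apply/eqP => E.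
  have E2 : - y = 1 - y by rewrite -[LHS](divfK y1) E mul1r.
  have /eqP : (1 : C) = 0 by rewrite -[1](subrK y) -E2 addNr.
  by rewrite oner_eq0.
split; first by apply: ycoord_disc0 => //; rewrite ycoord_zlens.
split=> //; apply: ycoord_disc0.
  by apply: contra_neq x1; rewrite exprVn => /(congr1 GRing.inv);
    rewrite invrK invr1.
by rewrite ycoord_inv// ycoord_zlens.
Qed.

Lemma conn_mx_lens mu y : lens y -> fund0 mu (zlens y) = conn_mx mu *m
  fund_inf mu (zlens y).
Proof.
move=> ly.
pose dz y := cexp (m * (ii * rc pi + (clog y - clog (1 - y)))) *
     (m * (y^-1 - (1 - y)^-1 * (- 1))).
have H d : lens d -> cder zlens d (dz d) /\
    [/\ scalar_sol mu (b2 mu) (db2 mu) (zlens d),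
      scalar_sol mu (b1 mu) (db1 mu) (zlens d),
     scalar_sol mu (b4 mu) (db4 mu) (zlens d),
       scalar_sol mu (b3 mu) (db3 mu) (zlens d) &
     \det (fund_inf mu (zlens d)) = -1].
  move=> ld; have [d0 di] := zlens_disc ld; have [h1 h2] := lens_Re ld.
  split; last by split; [exact: scalar_sol2|exact: scalar_sol1|exact:
    scalar_sol4|exact: scalar_sol3|
    exact: det_fund_inf].
  have h3 : cder (fun y : C => 1 - y) d (-1).
    by apply: cder_eq (cderB (cderc 1 d) (cderid d)) _; rewrite sub0r.
  have h4 := cderB (cder_clog h1) (cder_comp h3 (cder_clog h2)).
  have h5 := cderZ m (cderD (cderc (ii * rc pi) d) h4).
  by apply: cder_eq (cder_comp h5 (cder_cexp _)) _; rewrite add0r.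
have k0 : (-1 : C) != 0 by rewrite oppr_eq0 oner_neq0.
rewrite /fund0 (connection_cst cconvex_lens k0 lens_half H ly) zlens_half.
by rewrite invrN1 scaleN1r.
Qed.

Lemma root_om z w : z != 0 -> w != 0 -> z ^+ n = w ^+ n ->
  exists2 om, om ^+ n = 1 & z = om * w.
Proof.
move=> z0 w0 zw; exists (z / w); last by rewrite divfK.
by rewrite exprMn exprVn zw mulfV// expf_neq0.
Qed.

Lemma conn_mx_det mu : \det (conn_mx mu) = -1.
Proof.
have := conn_mx_lens mu lens_half => /(congr1 (fun M => \det M)).
have [d0 di] := zlens_disc lens_half.
rewrite det_mulmx det_fund0// det_fund_inf// mulrN1 => /eqP.
by rewrite -eqr_oppLR => /eqP <-.
Qed.

End Connection.

(** * The scalar equation at the roots of unity *)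

Section Third.
Variables (R : realType) (k : nat).
Local Notation C := (CC R).
Implicit Types (z mu s l om x y : C).
Local Notation n := k.+2.
Local Notation N := (n%:R : C).
Local Notation m := (N^-1).

Local Notation scalar_sol := (@scalar_sol R k).

(** The local coordinate at the roots of unity. It changes sign under z -> 1/z,
so that a half turn of tau leads from 0 to infinity. *)
Definition tau z : C := (1 - z ^+ n) / (1 + z ^+ n).
Definition tau2 z : C := tau z ^+ 2.
Definition dtau2 z : C := - 4 * N * z ^+ k.+1 * (1 - z ^+ n) / (1 + z ^+ n) ^+ 3.
(** The logarithmic derivative of tau. *)
Definition dlog z : C := - 2 * N * z ^+ k.+1 / (1 - (z ^+ n) ^+ 2).
Definition sgu s : C := s - m + 2^-1.
Definition ppu s : C := (s - m) * (s - m + 1) / 4.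
Definition gmu s : C := s + 2^-1.
Definition uE s l z : C := cexp (s * l + m * clog (1 + z ^+ n)).
Definition ue s z : C := s * dlog z + z ^+ k.+1 / (1 + z ^+ n).
Definition uF s z := hyp (sgu s) (ppu s) (gmu s) (tau2 z).
Definition udF s z := dhyp (sgu s) (ppu s) (gmu s) (tau2 z).
(** The solution tau^s (1 + z^n)^(1/n) F(tau^2) of exponent s at the roots of
unity. The argument l stands for a logarithm of tau: the branch is a variable,
and continuation around a root of unity is a translation of l. *)
Definition uval s l z := uE s l z * uF s z.
Definition uder s l z := uE s l z * ue s z * uF s z +
  uE s l z * dtau2 z * udF s z.

Definition Rpos z := 0 < complex.Re (z ^+ n).

Lemma Rpos1 z : Rpos z -> 0 < complex.Re (1 + z ^+ n).
Proof. by rewrite /Rpos ReD Re1; lra. Qed.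

Lemma Re_neq0 z : 0 < complex.Re z -> z != 0.
Proof. by move=> z0; rewrite -cabs_gt0 Re_gt0_cabs. Qed.

Lemma Rpos_neq z : Rpos z -> 1 + z ^+ n != 0.
Proof. by move=> /Rpos1/Re_neq0. Qed.

Lemma Rpos_z0 z : Rpos z -> z != 0.
Proof.
by rewrite /Rpos => /Re_neq0; rewrite expf_eq0/=.
Qed.

Lemma cabs_tau z : Rpos z -> cabs (tau z) < 1.
Proof.
move=> zp; have c0 := Re_gt0_cabs (Rpos1 zp).
rewrite /tau cabsM cabsV ltr_pdivrMr// mul1r.
rewrite -(@ltr_pXn2r _ 2) ?nnegrE ?cabs_ge0// !cabs_sqr.
move: zp; rewrite /Rpos !ReD !ImD ReN ImN Re1 Im1; move: (z ^+ n) => x zp.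
by rewrite !expr2; nra.
Qed.

Lemma cabs_tau2 z : Rpos z -> cabs (tau2 z) < 1.
Proof.
by move=> zp; rewrite /tau2 cabsX exprn_ilt1 ?cabs_ge0 ?cabs_tau.
Qed.

Lemma cder_tau2 z : Rpos z -> cder tau2 z (dtau2 z).
Proof.
move=> zp; have x1 := Rpos_neq zp.
have h1 := cderD (cderc 1 z) (cder_zn k z).
have h2 := cderB (cderc 1 z) (cder_zn k z).
have h3 := cderV (f := fun w => 1 + w ^+ n) x1 h1.
apply: cder_eq (cderX 2 (cderM h2 h3)) _.
by move: x1; rewrite /dtau2 /= (@expz1 R k z);
  move: (z ^+ n) (z ^+ k) N => x P K x1; field.
Qed.

Lemma cder_dtau2 z : Rpos z -> cder dtau2 z
  (- 4 * N * ((N - 1) * z ^+ k * (1 - z ^+ n) / (1 + z ^+ n) ^+ 3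
   - N * z ^+ k * z ^+ n / (1 + z ^+ n) ^+ 3
   - 3 * N * z ^+ k * z ^+ n * (1 - z ^+ n) / (1 + z ^+ n) ^+ 4)).
Proof.
move=> zp; have x1 := Rpos_neq zp.
have x3 : (1 + z ^+ n) ^+ 3 != 0 by rewrite expf_neq0.
have h1 := cderD (cderc 1 z) (cder_zn k z).
have h2 := cderB (cderc 1 z) (cder_zn k z).
have h3 := cderV (f := fun w => (1 + w ^+ n) ^+ 3) x3 (cderX 3 h1).
apply: cder_eq (cderM (cderM (cderZ (- 4 * N) (cder_zn1 k z)) h2) h3) _.
move: x1; rewrite /= (@expz1 R k z) (@expz R k z); move: (z ^+ k) N => P K x1.
by field.
Qed.

(** A quadratic transformation: the equation is hypergeometric in tau^2 as well.
As |tau| < 1 exactly when Re z^n > 0, these solutions are defined on a region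
that meets the domains at 0 and at infinity. *)
Lemma scalar_sol_u s mu (l : C -> C) z : Rpos z -> z ^+ n != 1 ->
  s * (s - 1) = mu -> (forall j : nat, gmu s + j%:R != 0) ->
  cder l z (dlog z) ->
  scalar_sol mu (fun w => uval s (l w) w) (fun w => uder s (l w) w) z.
Proof.
move=> zp z1 smu gj hl; have x1 := Rpos_neq zp.
have x2 : 1 - z ^+ n != 0 by rewrite subr_eq0 eq_sym.
have x3 : 1 - (z ^+ n) ^+ 2 != 0.
  have -> : 1 - (z ^+ n) ^+ 2 = (1 - z ^+ n) * (1 + z ^+ n).
    by move: (z ^+ n) => x; ring.
  by rewrite mulf_neq0.
have x4 : z ^+ n - 1 != 0 by rewrite subr_eq0.
have h1 := cderD (cderc 1 z) (cder_zn k z).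
have hc := cder_comp h1 (cder_clog (Rpos1 zp)).
have hE : cder (fun w => uE s (l w) w) z (uE s (l z) z * ue s z).
  apply: cder_eq (cder_comp (cderD (cderZ s hl) (cderZ m hc)) (cder_cexp _)) _.
  rewrite /uE /ue; congr (_ * _); congr (_ + _); rewrite add0r (@expz1 R k z).
  by have := N_neq0 R k; move: x1; move: N (z ^+ k) (z ^+ n) => K P x x1 K0;
    field; rewrite ?K0 ?x1.
have hde : cder (ue s) z
   (s * (- 2 * N * ((N - 1) * z ^+ k / (1 - (z ^+ n) ^+ 2) +
      2 * N * z ^+ k * (z ^+ n) ^+ 2 / (1 - (z ^+ n) ^+ 2) ^+ 2)) +
    ((N - 1) * z ^+ k / (1 + z ^+ n) - N * z ^+ k * z ^+ n / (1 + z ^+ n) ^+ 2)).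
  have h2 := cderB (cderc 1 z) (cderX 2 (cder_zn k z)).
  have h3 := cderV (f := fun w => 1 - (w ^+ n) ^+ 2) x3 h2.
  have h4 := cderV (f := fun w => 1 + w ^+ n) x1 h1.
  have h5 := cderM (cderZ (- 2 * N) (cder_zn1 k z)) h3.
  apply: cder_eq (cderD (cderZ s h5) (cderM (cder_zn1 k z) h4)) _.
  move: x1 x3; rewrite /= (@expz1 R k z) (@expz R k z);
    move: (z ^+ k) N => P K x1 x3.
  by field; rewrite x1.
have hE1 := cderM hE hde.
apply: (@scalar_sol_comp R k mu (fun w => uE s (l w) w)
  (fun w => uE s (l w) w * ue s w) tau2 dtau2 _ _
  (4 * N ^+ 2 * z ^+ k / (1 + z ^+ n) ^+ 2) (sgu s) (ppu s) (gmu s) z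
  hE hE1 (cder_tau2 zp) (cder_dtau2 zp) (cabs_tau2 zp) gj).
- move: x1 x2; rewrite /dtau2 /tau2 /tau (@expz1 R k z) (@expz R k z);
  move: (z ^+ k) N => P K x1 x2.
  by field.
- rewrite -smu /qcoef /ue /dlog /ppu.
  move: x1 x2 x3 x4; rewrite (@expz1 R k z) (@expz R k z); move: (N_neq0 R k).
  move: (uE s (l z) z) (z ^+ k) N => E P K K0 x1 x2 x3 x4.
  have x5 : 1 - (P * z ^+ 2) ^+ 2 = (1 - P * z ^+ 2) * (1 + P * z ^+ 2) by ring.
  have x6 : P * z ^+ 2 - 1 = - (1 - P * z ^+ 2) by ring.
  rewrite x5 x6; field.
  by rewrite K0 x1 x2.
- rewrite /ue /dlog /dtau2 /tau2 /tau /sgu /gmu.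
  move: x1 x2 x3 x4; rewrite (@expz1 R k z) (@expz R k z); move: (N_neq0 R k).
  move: (uE s (l z) z) (z ^+ k) N => E P K K0 x1 x2 x3 x4.
  have x5 : 1 - (P * z ^+ 2) ^+ 2 = (1 - P * z ^+ 2) * (1 + P * z ^+ 2) by ring.
  rewrite x5; field.
  by rewrite K0 x1 x2.
Qed.

End Third.

(** * Holomorphic functions *)

Section Hol.
Variable R : realType.
Local Notation C := (CC R).
Implicit Types (f g : C -> C) (z : C).

Definition hol f z := exists d, cder f z d.

Lemma holc (a : C) z : hol (fun=> a) z.
Proof. by exists 0; exact: cderc. Qed.
Lemma holid z : hol (fun w => w) z.
Proof. by exists 1; exact: cderid. Qed.
Lemma holD f g z : hol f z -> hol g z -> hol (fun w => f w + g w) z.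
Proof. by move=> [a ha] [b hb]; exists (a + b); exact: cderD. Qed.
Lemma holN f z : hol f z -> hol (fun w => - f w) z.
Proof. by move=> [a ha]; exists (- a); exact: cderN. Qed.
Lemma holB f g z : hol f z -> hol g z -> hol (fun w => f w - g w) z.
Proof. by move=> [a ha] [b hb]; exists (a - b); exact: cderB. Qed.
Lemma holM f g z : hol f z -> hol g z -> hol (fun w => f w * g w) z.
Proof. by move=> [a ha] [b hb]; exists (a * g z + f z * b); exact: cderM. Qed.
Lemma holX f z j : hol f z -> hol (fun w => f w ^+ j) z.
Proof. by move=> [a ha]; exists (j%:R * f z ^+ j.-1 * a); exact: cderX. Qed.
Lemma holV f z : f z != 0 -> hol f z -> hol (fun w => (f w)^-1) z.
Proof. by move=> fz [a ha]; exists (- a / f z ^+ 2); exact: cderV. Qed.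
Lemma hol_comp f g z : hol f z -> hol g (f z) -> hol (fun w => g (f w)) z.
Proof. by move=> [a ha] [b hb]; exists (b * a); exact: cder_comp. Qed.
Lemma hol_cexp z : hol (@cexp R) z.
Proof. by exists (cexp z); exact: cder_cexp. Qed.
Lemma hol_clog z : 0 < complex.Re z -> hol (@clog R) z.
Proof. by move=> z0; exists z^-1; exact: cder_clog. Qed.

Lemma hol_eps f z : hol f z -> forall e : R, 0 < e ->
  exists2 r : R, 0 < r & forall w, cabs (w - z) < r -> cabs (f w - f z) < e.
Proof.
move=> [d /cder_cts fz] e e0.
have /cvgrPdist_lt/(_ (e%:C)%C) := fz; rewrite ltcR => /(_ e0)/nbhsCP[r r0 H].
by exists r => // w /H; rewrite normCE ltcR cabsC.
Qed.
End Hol.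

(** * Comparison of the frames *)

Section ThirdConnection.
Variables (R : realType) (k : nat).
Local Notation C := (CC R).
Implicit Types (z mu s l om x y : C).
Local Notation n := k.+2.
Local Notation N := (n%:R : C).
Local Notation m := (N^-1).
Local Notation rc t := (t%:C)%C.

Local Notation scalar_sol := (@scalar_sol R k).
Local Notation disc0 := (@disc0 R k).
Local Notation fund0 := (@fund0 R k). Local Notation fund_inf := (@fund_inf R k).
Local Notation uval := (@uval R k). Local Notation uder := (@uder R k).
Local Notation Rpos := (@Rpos R k). Local Notation tau := (@tau R k).

Local Notation gmu := (@gmu R).

(** Absence of resonance: the hypergeometric series for the exponents s and 1 -
s exist, and the exponents differ. *)
Definition nonres s mu := [/\ s * (s - 1) = mu,
  (forall j : nat, gmu s + j%:R != 0),
  (forall j : nat, gmu (1 - s) + j%:R != 0) & 2 * s - 1 != 0].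

Lemma exponent_sym s mu : s * (s - 1) = mu -> (1 - s) * (1 - s - 1) = mu.
Proof. by move=> <-; ring. Qed.

(** A determination of the logarithm of tau when 0 < Re z^n < 1. *)
Definition plog z : C := clog (1 - z ^+ n) - clog (1 + z ^+ n).
(** The frame that diagonalises the local monodromy at the roots of unity. *)
Definition eigframe s l z :=
  mx2 (uder s l z) (uval s l z) (uder (1 - s) l z) (uval (1 - s) l z).
(** The principal n-th root. *)
Definition nroot x : C := cexp (m * clog x).
(** The values of z^n in the right half-plane that belong to the domain at 0. *)
Definition strip : set C := [set x | 0 < complex.Re x] `&`
  [set x | complex.Re x < 2^-1].
Definition zbase : C := nroot 4^-1.

(** The matrix of the eigenframe in the frame at 0, which has determinant 1. *)
Definition eig_mx s mu := eigframe s (plog zbase) zbase *m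
  mx2 (b1 k mu zbase) (- b2 k mu zbase) (- db1 k mu zbase) (db2 k mu zbase).

Lemma nroot_n x : 0 < complex.Re x -> nroot x ^+ n = x.
Proof. by move=> x0; rewrite /nroot -cexpX mulrA mN mul1r cexp_clog. Qed.

Lemma cder_plog z : Rpos z -> complex.Re (z ^+ n) < 1 -> cder plog z (dlog k z).
Proof.
move=> zp z1.
have h1 : 0 < complex.Re (1 - z ^+ n) by rewrite ReD ReN Re1; lra.
have h2 := Rpos1 zp.
have g1 := cder_comp (cderB (cderc 1 z) (cder_zn k z)) (cder_clog h1).
have g2 := cder_comp (cderD (cderc 1 z) (cder_zn k z)) (cder_clog h2).
apply: cder_eq (cderB g1 g2) _; rewrite /dlog (@expz1 R k z).
have := Re_neq0 h1; have := Re_neq0 h2; move: (z ^+ n) (z ^+ k) N => x P K a b.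
have -> : 1 - x ^+ 2 = (1 - x) * (1 + x) by ring.
by field; rewrite a b.
Qed.

Lemma cexp_plog z : Rpos z -> complex.Re (z ^+ n) < 1 -> cexp (plog z) = tau z.
Proof.
move=> zp z1.
have h1 : 0 < complex.Re (1 - z ^+ n) by rewrite ReD ReN Re1; lra.
by rewrite /plog cexpB !cexp_clog//; exact: Rpos1.
Qed.

Lemma cder_nroot x : 0 < complex.Re x ->
  cder nroot x (cexp (m * clog x) * (m * x^-1)).
Proof.
by move=> x0; exact: (cder_comp (cderZ m (cder_clog x0)) (cder_cexp _)).
Qed.

Lemma cconvex_Re_gt (a : R) : cconvex [set x : C | a < complex.Re x].
Proof.
by apply: cconvex_half => [u v|t u]; rewrite ?ReD ?ReZ.
Qed.

Lemma cconvex_Re_lt (a : R) : cconvex [set x : C | complex.Re x < a].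
Proof.
have := @cconvex_half R (fun x => - complex.Re x) (- a).
have -> : [set z : C | - a < - complex.Re z] = [set x | complex.Re x < a].
  by apply/funext => z /=; rewrite ltrN2.
by apply => [u v|t u]; rewrite ?ReD ?ReZ ?opprD// mulrN.
Qed.

Lemma Re_half : complex.Re (4^-1 : C) = 4^-1 :> R.
Proof.
have -> : (4^-1 : C) = rc (4^-1) by rewrite fmorphV/= rmorph_nat.
by [].
Qed.

Lemma strip_c : strip 4^-1.
Proof. by split; rewrite /mkset Re_half; lra. Qed.

Section Fixed.
Variables (s mu : C).
Hypothesis sg : nonres s mu.

Lemma scalar_sol_up z : Rpos z -> complex.Re (z ^+ n) < 1 ->
  scalar_sol mu (fun w => uval s (plog w) w) (fun w => uder s (plog w) w) z.
Proof.
move=> zp z1; have [smu g1 g2 _] := sg.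
apply: scalar_sol_u => //; last exact: cder_plog.
by apply: contraTneq z1 => ->; rewrite Re1 ltxx.
Qed.

Lemma scalar_sol_um z : Rpos z -> complex.Re (z ^+ n) < 1 ->
  scalar_sol mu (fun w => uval (1 - s) (plog w) w) (fun w => uder (1 - s) (plog
    w) w) z.
Proof.
move=> zp z1; have [smu g1 g2 _] := sg.
apply: scalar_sol_u => //; [|exact: exponent_sym|exact: cder_plog].
by apply: contraTneq z1 => ->; rewrite Re1 ltxx.
Qed.

Lemma strip_z x : strip x -> [/\ Rpos (nroot x), complex.Re (nroot x ^+ n) < 1 &
  disc0 (nroot x)].
Proof.
move=> [/= h1 h2]; split; rewrite /Rpos /disc0 nroot_n//.
by rewrite (lt_trans h2)//; lra.
Qed.

Lemma eigframe_strip x : strip x -> eigframe s (plog (nroot x)) (nroot x) =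
  eig_mx s mu *m fund0 mu (nroot x).
Proof.
move=> xs.
pose dz x := cexp (m * clog x) * (m * x^-1).
have H d : strip d -> cder nroot d (dz d) /\
    [/\ scalar_sol mu (fun w => uval s (plog w) w) (fun w => uder s (plog w) w)
      (nroot d),
     scalar_sol mu (fun w => uval (1 - s) (plog w) w) (fun w => uder (1 - s)
       (plog w) w)
      (nroot d),
     scalar_sol mu (b2 k mu) (db2 k mu) (nroot d),
       scalar_sol mu (b1 k mu) (db1 k mu) (nroot d) &
     \det (fund0 mu (nroot d)) = 1].
  move=> ds; have [h1 h2 h3] := strip_z ds; have [h4 _] := ds.
  split; first exact: cder_nroot.
  by split; [exact: scalar_sol_up|exact: scalar_sol_um|exact:
    scalar_sol2|exact: scalar_sol1|
    exact: det_fund0].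
have cs : cconvex strip.
  by apply: cconvexI; [exact: cconvex_Re_gt|exact: cconvex_Re_lt].
have := connection_cst cs (oner_neq0 _) strip_c H xs.
by rewrite invr1 scale1r /sol_mx.
Qed.

(** The determinant of the eigenframe. The branch of the logarithm has
cancelled, so that, unlike the eigenframe, it makes sense at tau = 0. *)
Definition W0 z : C := cexp (2 * m * clog (1 + z ^+ n)) *
  ((2 * s - 1) * (- 2 * N * z ^+ k.+1 / (1 + z ^+ n) ^+ 2) *
     (uF k s z * uF k (1 - s) z) + tau z * dtau2 k z *
   (udF k s z * uF k (1 - s) z - uF k s z * udF k (1 - s) z)).

Lemma det_eigframe l z : Rpos z -> z ^+ n != 1 -> cexp l = tau z ->
  \det (eigframe s l z) = W0 z.
Proof.
move=> zp z1 lt; rewrite /eigframe mx2_det /uval /uder /W0.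
have x1 := Rpos_neq zp.
have x2 : 1 - z ^+ n != 0 by rewrite subr_eq0 eq_sym.
have EE : uE k s l z * uE k (1 - s) l z =
  tau z * cexp (2 * m * clog (1 + z ^+ n)).
  by rewrite /uE -lt -!cexpD; congr cexp; ring.
transitivity (uE k s l z * uE k (1 - s) l z *
  ((ue k s z - ue k (1 - s) z) * (uF k s z * uF k (1 - s) z) + dtau2 k z *
   (udF k s z * uF k (1 - s) z - uF k s z * udF k (1 - s) z))); first by ring.
rewrite EE; set A := cexp _; set F1 := uF _ _ _; set F2 := uF _ _ _.
set G1 := udF _ _ _; set G2 := udF _ _ _; set T := dtau2 _ _.
have -> : ue k s z - ue k (1 - s) z = (2 * s - 1) * dlog k z by rewrite /ue; ring.
have e : tau z * dlog k z = - 2 * N * z ^+ k.+1 / (1 + z ^+ n) ^+ 2.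
  rewrite /tau /dlog; move: x1 x2; move: (z ^+ n) (z ^+ k.+1) N => x P K a b.
  have -> : 1 - x ^+ 2 = (1 - x) * (1 + x) by ring.
  by field; rewrite a b.
rewrite -e; ring.
Qed.

Lemma nroot1 : nroot 1 = 1.
Proof.
rewrite /nroot; have -> : clog (1 : C) = 0.
  by rewrite -[1](rmorph1 (real_complex R)) clogR// ln1 rmorph0.
by rewrite mulr0 cexp0.
Qed.

Lemma W0_1 : W0 1 != 0.
Proof.
have [_ _ _ s2] := sg.
have t0 : tau 1 = 0 by rewrite /tau expr1n subrr mul0r.
rewrite /W0 t0 mul0r mul0r addr0 /uF /tau2 t0 expr0n/= !hyp0 !expr1n !mulr1.
apply: mulf_neq0; first exact: cexp_neq0.
apply: mulf_neq0 => //; apply: mulf_neq0.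
Qed.

Lemma hol_W0 z : Rpos z -> hol W0 z.
Proof.
move=> zp; have x1 := Rpos_neq zp.
have hx : hol (fun w : C => w ^+ n) z by apply: holX; exact: holid.
have h1 : hol (fun w : C => 1 + w ^+ n) z by apply: holD => //; exact: holc.
have hT : hol (tau2 k) z by exists (dtau2 k z); exact: cder_tau2.
have hdT : hol (dtau2 k) z by eexists; exact: cder_dtau2.
have ht : hol tau z.
  apply: holM; first by apply: holB => //; exact: holc.
  exact: (holV (f := fun w : C => 1 + w ^+ n)).
have hF a b c : hol (fun w => hyp a b c (tau2 k w)) z.
  by apply: hol_comp hT _; eexists; apply: cder_hyp; exact: cabs_tau2.
have hdF a b c : hol (fun w => dhyp a b c (tau2 k w)) z.
  by apply: hol_comp hT _; eexists; apply: cder_dhyp; exact: cabs_tau2.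
apply: holM.
  apply: (hol_comp (f := fun w => 2 * m * clog (1 + w ^+ n)) _ (hol_cexp _)).
  apply: holM; first exact: holc.
  by apply: hol_comp h1 (hol_clog _); exact: Rpos1.
apply: holD.
  apply: holM; last by apply: holM; exact: hF.
  apply: holM; first exact: holc.
  apply: holM.
    by apply: holM; [exact: holc|apply: holX; exact: holid].
  apply: (holV (f := fun w : C => (1 + w ^+ n) ^+ 2)); last exact: holX.
  by rewrite expf_neq0.
apply: holM; first exact: holM.
by apply: holB; apply: holM; [exact: hdF|exact: hF|exact: hF|exact: hdF].
Qed.

(** If the determinant vanished, then so would the Wronskian W0 for all 0 < z^n
< 1 and, by continuity, at z = 1, where it is 2 s - 1 up to a nonzero factor. *)
Lemma det_eig_mx : \det (eig_mx s mu) != 0.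
Proof.
have [h1 h2 h3] := strip_z strip_c.
have E : \det (eig_mx s mu) = W0 zbase.
  have := eigframe_strip strip_c => /(congr1 (fun M => \det M)).
  rewrite det_mulmx det_fund0// mulr1 => <-; apply: det_eigframe => //.
    exact: disc0_ne1.
  exact: cexp_plog.
rewrite E; apply/eqP => W00.
pose D : set C := [set x | 0 < complex.Re x] `&` [set x | complex.Re x < 1].
have Dc : cconvex D.
  by apply: cconvexI; [exact: cconvex_Re_gt|exact: cconvex_Re_lt].
have Wx x : D x -> W0 (nroot x) = 0.
  move=> Dx.
  pose f w := uval s (plog w) w. pose df w := uder s (plog w) w.
  pose g w := uval (1 - s) (plog w) w. pose dg w := uder (1 - s) (plog w) w.
  have Wd d : D d -> W0 (nroot d) = - wronsk f df g dg (nroot d).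
    move=> [/= d0 d1].
    rewrite -(@det_eigframe (plog (nroot d)));
      first by rewrite mx2_det /wronsk /f /df /g /dg; ring.
    - by rewrite /Rpos nroot_n.
    - by rewrite nroot_n//; apply: contraTneq d1 => ->; rewrite Re1 ltxx.
    - by apply: cexp_plog; rewrite /Rpos nroot_n.
  have Dq : D 4^-1 by split; rewrite /mkset Re_half; lra.
  have Wq : W0 zbase = - wronsk f df g dg zbase := Wd _ Dq.
  have Ewr : wronsk f df g dg (nroot x) = wronsk f df g dg zbase; last first.
    by rewrite (Wd _ Dx) Ewr -Wq.
  have H : forall d, D d -> [/\ cder nroot d (cexp (m * clog d) * (m * d^-1)),
    scalar_sol mu f df (nroot d) & scalar_sol mu g dg (nroot d)]; last first.
    exact: (wronsk_cst Dc H Dx Dq).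
  move=> d [/= d0 d1].
  have zp : Rpos (nroot d) by rewrite /Rpos nroot_n.
  split; [exact: cder_nroot|apply: scalar_sol_up|apply: scalar_sol_um] => //;
    by rewrite nroot_n.
have hW : hol (fun x => W0 (nroot x)) 1.
  have r1 : 0 < complex.Re (1 : C) by rewrite Re1.
  apply: (hol_comp (f := nroot)); first by eexists; exact: cder_nroot.
  by apply: hol_W0; rewrite /Rpos nroot_n.
have W1 : 0 < cabs (W0 (nroot 1)) by rewrite nroot1 cabs_gt0 W0_1.
have [r r0 Hr] := hol_eps hW W1.
(* 1 - t is a point of (0, 1) so close to 1 that W0 cannot vanish there. *)
pose t : R := Num.min r 1 / 2.
have t0 : 0 < t by rewrite divr_gt0// lt_min r0 ltr01.
have t1 : t < 1.
  have : Num.min r 1 <= 1 by rewrite ge_min lexx orbT.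
  by rewrite /t; lra.
have tr : t < r.
  have : Num.min r 1 <= r by rewrite ge_min lexx.
  by move: t0; rewrite /t; lra.
have := Hr (rc (1 - t)); have -> : rc (1 - t) - 1 = - rc t.
  by rewrite rmorphB rmorph1; ring.
rewrite cabsN cabsR gtr0_norm// => /(_ tr).
rewrite Wx; first by rewrite sub0r cabsN ltxx.
by split=> /=; lra.
Qed.

(** Continuation of the eigenframe along a translation by c of the logarithm of
tau. *)
Definition eig_turn (c : C) := mx2 (cexp (c * s)) 0 0 (cexp (c * (1 - s))).

Lemma eigframe_shift l c z : eigframe s (l + c) z = eig_turn c *m eigframe s l z.
Proof.
have E t : uE k t (l + c) z = cexp (c * t) * uE k t l z.
  by rewrite /uE -cexpD; congr cexp; ring.
by rewrite /eigframe /eig_turn mx2_mul /uval /uder !E; congr mx2; ring.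
Qed.

Lemma eig_turn_mul c d : eig_turn c *m eig_turn d = eig_turn (c + d).
Proof.
by rewrite /eig_turn mx2_mul !mulr0 !mul0r !addr0 !add0r -!cexpD !mulrDl.
Qed.

Lemma eig_turn0 : eig_turn 0 = 1%:M.
Proof. by rewrite /eig_turn !mul0r cexp0 mx2_1. Qed.

Lemma clogV x : 0 < complex.Re x -> 0 < complex.Re x^-1 /\ clog x^-1 = - clog x.
Proof.
move=> x0; have xn := Re_neq0 x0.
have xV : 0 < complex.Re x^-1.
  have c0 := Re_gt0_cabs x0.
  case: x x0 xn c0 => a b /= a0 _ _.
  by rewrite divr_gt0// ltr_pwDl ?exprn_gt0// sqr_ge0.
split=> //; apply: cexp_inj; first by rewrite cexpN !cexp_clog.
have := Im_clog x0; have := Im_clog xV; rewrite ImN.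
have := pi_gt0 R => p0 /andP[? ?] /andP[? ?].
by rewrite ltr_norml; apply/andP; split; lra.
Qed.

Lemma nrootV x : 0 < complex.Re x -> nroot x^-1 = (nroot x)^-1.
Proof.
by move=> x0; rewrite /nroot (clogV x0).2 mulrN cexpN.
Qed.

(** The action of inversion on rows (b', b). *)
Definition Jm z := mx2 (- z^-1) 0 1 z.

Lemma fund_inf_Jm z : z != 0 -> fund_inf mu z = fund0 mu z^-1 *m Jm z.
Proof.
move=> z0; rewrite /fund_inf /fund0 /sol_mx mx2_mul.
rewrite /b4 /db4 /b3 /db3 /inv /dinv.
by congr mx2; field.
Qed.

Lemma clog1D x : 0 < complex.Re x ->
  clog x + clog (1 + x^-1) = clog (1 + x).
Proof.
move=> x0; have [xV _] := clogV x0.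
have h1 : 0 < complex.Re (1 + x^-1) by rewrite ReD Re1; lra.
have h2 : 0 < complex.Re (1 + x) by rewrite ReD Re1; lra.
apply: cexp_inj.
  rewrite cexpD !cexp_clog// mulrDr mulr1 mulfV ?Re_neq0// addrC//.
have := Im_clog x0; have := Im_clog h1; have := Im_clog h2.
rewrite ImD; have := pi_gt0 R => p0 /andP[? ?] /andP[? ?] /andP[? ?].
by rewrite ltr_norml; apply/andP; split; lra.
Qed.

(** For a fixed logarithm l of tau, the solutions of exponents s and 1 - s are
invariant under inversion. *)
Lemma eigframe_Jm l x : 0 < complex.Re x -> x != 1 ->
  eigframe s l (nroot x)^-1 *m Jm (nroot x) = eigframe s l (nroot x).
Proof.
move=> x0 x2; have z0 : nroot x != 0 := cexp_neq0 _.
have zx := nroot_n x0; set z := nroot x in z0 zx *.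
have xn := Re_neq0 x0.
have x1 : 1 + x != 0 by apply: Re_neq0; rewrite ReD Re1; lra.
have E t : z * uE k t l z^-1 = uE k t l z.
  rewrite /uE /z /nroot -cexpD -/(nroot x) -/z exprVn zx; congr cexp.
  by rewrite -(clog1D x0); ring.
have T : tau2 k z^-1 = tau2 k z.
  rewrite /tau2 /tau exprVn zx.
  have -> : 1 + x^-1 = (1 + x) / x by rewrite mulrDl mul1r mulfV// addrC.
  by field; rewrite ?x1 ?xn.
have E1 t : uE k t l z^-1 = z^-1 * uE k t l z by rewrite -E mulrA mulVf// mul1r.
have zk : z ^+ k.+1 = x / z by rewrite -zx [z ^+ n]exprSr mulfK.
rewrite /eigframe mx2_mul /uval /uder /uF /udF T !E1 /dtau2 /ue /dlog !exprVn
  !zk !zx.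
have x3 : 1 - x != 0 by rewrite subr_eq0 eq_sym.
have x4 : 1 - x ^+ 2 = (1 - x) * (1 + x) by ring.
have x5 : 1 - x ^- 2 = - (1 - x) * (1 + x) / x ^+ 2 by field.
have x6 : 1 + x^-1 = (1 + x) / x by rewrite mulrDl mul1r mulfV// addrC.
rewrite x4 x5 x6; have := N_neq0 R k; move: N => K K0.
by congr mx2; field; rewrite ?x1 ?x3 ?xn ?z0 ?K0.
Qed.

End Fixed.
End ThirdConnection.

(** * Half turns around the roots of unity *)

Section MatrixCancel.
Variables (F : fieldType).
Implicit Types A B K P Q : 'M[F]_2.

Lemma conj_cancel A K B : A \in unitmx -> A = K *m A *m B ->
  invmx A *m K *m A *m B = 1%:M.
Proof. by move=> Au E; rewrite -2![in LHS]mulmxA [K *m _]mulmxA -E mulVmx. Qed.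

Lemma conj_solve A K P Q : A \in unitmx -> K *m (A *m P) = A *m Q ->
  Q = invmx A *m K *m A *m P.
Proof. by move=> Au E; rewrite -2![in RHS]mulmxA E mulKmx. Qed.

Lemma cancelR P Q A : A \in unitmx -> P *m A = Q *m A -> P = Q.
Proof. by move=> Au; exact: (can_inj (mulmxK Au)). Qed.

Lemma cancelR_conj A B K P : P \in unitmx ->
  K *m (A *m (B *m P)) = A *m P -> A = K *m A *m B.
Proof. by move=> Pu E; apply: (cancelR Pu); rewrite -E !mulmxA. Qed.

Lemma cancelR_rot A B K P Q : A \in unitmx ->
  P *m A = B *m (K *m Q *m A) -> P = B *m K *m Q.
Proof. by move=> Au E; apply: (cancelR Au); rewrite E !mulmxA. Qed.

Lemma conj_compose A B K P : A *m K = B *m P -> K *m B = 1%:M ->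
  B *m P *m B = A.
Proof. by move=> <- E; rewrite -mulmxA E mulmx1. Qed.

Lemma conj_solveB A B K L : A \in unitmx -> L *m K = 1%:M ->
  A = K *m A *m B -> B = invmx A *m L *m A.
Proof.
move=> Au LK E; have LA : L *m A = A *m B.
  by rewrite {1}E !mulmxA LK mul1mx.
by rewrite -mulmxA LA mulKmx.
Qed.

Lemma conj_step A K P : A \in unitmx ->
  invmx A *m (K *m P) = invmx A *m K *m A *m (invmx A *m P).
Proof.
by move=> Au; rewrite [in RHS]mulmxA mulmxK// mulmxA.
Qed.

Lemma invmx_cancel A P (T X : 'M[F]_2) Q : A \in unitmx -> Q = A *m P ->
  T *m P *m X = T *m (invmx A *m (Q *m X)).
Proof. by move=> Au ->; rewrite -[A *m P *m X]mulmxA mulKmx// !mulmxA. Qed.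

End MatrixCancel.

Section Entries.
Variables (R : realType) (k : nat).
Local Notation C := (CC R).
Implicit Types (z mu s l om x y : C).
Local Notation n := k.+2.
Local Notation N := (n%:R : C).
Local Notation m := (N^-1).
Local Notation rc t := (t%:C)%C.
Local Notation ii := ('i%C : C).
Local Notation disc0 := (@disc0 R k).
Local Notation fund0 := (@fund0 R k). Local Notation fund_inf := (@fund_inf R k).
Local Notation Rpos := (@Rpos R k). Local Notation tau := (@tau R k).
Local Notation conn_mx := (@conn_mx R k). Local Notation zeta2n := (@zeta2n R k).
Local Notation nonres := (@nonres R).
Local Notation eigframe := (@eigframe R k). Local Notation plog := (@plog R k).
Local Notation nroot := (@nroot R k). Local Notation strip := (@strip R).
Local Notation eig_mx := (@eig_mx R k). Local Notation eig_turn := (@eig_turn R).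
Local Notation ipi := (ii * rc pi).
Local Notation zlens := (@zlens R k).

(** The eigenframe, normalised so as to agree with fund0 on the strip for the
determination plog. *)
Definition fund1 s mu l z := invmx (eig_mx s mu) *m eigframe s l z.

Lemma Im_inv x : complex.Im x^-1 = - complex.Im x / cabs x ^+ 2.
Proof. by rewrite cabs_sqr mulNr; case: x. Qed.

Lemma Im_log_sign l : `|complex.Im l| < pi ->
  (complex.Im (cexp l) < 0 -> complex.Im l < 0) /\
  (0 < complex.Im (cexp l) -> 0 < complex.Im l).
Proof.
have -> : complex.Im (cexp l) = expR (complex.Re l) * sin (complex.Im l).
  by rewrite /cexp ImZ ImC.
have e0 := expR_gt0 (complex.Re l).
rewrite ltr_norml => /andP[h1 h2]; split.
  rewrite pmulr_rlt0// => s0; rewrite ltNge; apply: contraTN s0 => l0'.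
  by rewrite -leNgt sin_ge0_pi// l0' ltW.
rewrite pmulr_rgt0// => s0; rewrite ltNge; apply: contraTN s0 => l0'.
rewrite -leNgt -oppr_ge0 -sinN sin_ge0_pi//.
by apply/andP; split; lra.
Qed.

(** The side of the real axis on which the frames at 0 and at infinity are
compared with the eigenframe. *)
Definition upper x := [/\ strip x, strip x^-1 & 0 < complex.Im x].

Lemma Im_tau x : 0 < complex.Re x ->
  complex.Im ((1 - x) / (1 + x)) = - 2 * complex.Im x / cabs (1 + x) ^+ 2.
Proof.
move=> x0; have h : 0 < complex.Re (1 + x) by rewrite ReD Re1; lra.
have c0 := Re_gt0_cabs h.
rewrite ImMc Im_inv.
have -> : complex.Re (1 + x)^-1 = complex.Re (1 + x) / cabs (1 + x) ^+ 2.
  by rewrite cabs_sqr; case: (1 + x) => a b.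
rewrite !(ReD, ImD, ReN, ImN, Re1, Im1).
by move: (cabs _ ^+ 2)^-1 => c; ring.
Qed.

Lemma Im_plog z : Rpos z -> complex.Re (z ^+ n) < 1 ->
  `|complex.Im (plog z)| < pi.
Proof.
move=> zp z1.
have h1 : 0 < complex.Re (1 - z ^+ n) by rewrite ReD ReN Re1; lra.
have h2 := Rpos1 zp.
have := Im_clog h1; have := Im_clog h2;
  rewrite /plog ImD ImN => /andP[? ?] /andP[? ?].
by rewrite ltr_norml; apply/andP; split; lra.
Qed.

(** As tau (1/z) = - tau z, the two logarithms differ by an odd multiple of i
pi; since their imaginary parts have opposite, known signs and modulus less than
pi, the difference is i pi. *)
Lemma log_jump x : upper x -> plog (nroot x)^-1 = plog (nroot x) + ipi.
Proof.
move=> [xs xs' ix]; have [x0 _] := xs; have [x0' _] := xs';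
  rewrite /mkset in x0 x0'.
have [zp z1 _] := strip_z k xs; have [zp' z1' _] := strip_z k xs'.
rewrite nrootV// in zp' z1'.
have xn := Re_neq0 x0; have x1 := Rpos_neq zp.
have tE : tau (nroot x)^-1 = - tau (nroot x).
  move: x1; rewrite /tau exprVn nroot_n// => x1.
  have -> : 1 + x^-1 = (1 + x) / x by rewrite mulrDl mul1r mulfV// addrC.
  by field; rewrite ?x1 ?xn.
have e1 := cexp_plog zp z1; have e2 := cexp_plog zp' z1'.
have c0 : 0 < cabs (1 + x) ^+ 2.
  by rewrite exprn_gt0// Re_gt0_cabs// ReD Re1; lra.
have It : complex.Im (tau (nroot x)) < 0.
  rewrite /tau nroot_n// Im_tau// ltr_pdivrMr// mul0r; lra.
have b1 := Im_plog zp z1; have b2 := Im_plog zp' z1'.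
have s1 : complex.Im (plog (nroot x)) < 0.
  by apply: (Im_log_sign b1).1; rewrite e1.
have s2 : 0 < complex.Im (plog (nroot x)^-1).
  by apply: (Im_log_sign b2).2; rewrite e2 tE ImN; lra.
apply: cexp_inj; first by rewrite e2 tE cexpD e1 cexp_ipi mulrN1.
rewrite ImD Im_Mi Re_rc; move: b1 b2; rewrite !ltr_norml.
by move=> /andP[? ?] /andP[? ?]; apply/andP; split; lra.
Qed.

(** The sector of the lens contains the principal n-th root of x when Im x > 0,
and its rotation by exp (2 pi i / n) when Im x < 0. *)
Lemma lens_match x : strip x -> strip x^-1 -> complex.Im x != 0 ->
  lens (ycoord k (nroot x)) /\
  zlens (ycoord k (nroot x)) =
    (if 0 < complex.Im x then 1 else zeta2n ^+ 2) * nroot x.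
Proof.
move=> xs xs' ix; have [x0 _] := xs; have [x0' _] := xs';
  rewrite /mkset in x0 x0'.
have [zp z1 d0] := strip_z k xs; have [zp' z1' d0'] := strip_z k xs'.
have z0 : nroot x != 0 := cexp_neq0 _.
have zn1 := disc0_ne1 d0.
have ly : lens (ycoord k (nroot x)).
  split; first exact: disc0_ycoord.
  by rewrite /mkset -ycoord_inv//; rewrite -nrootV//; exact: disc0_ycoord.
split=> //; set y := ycoord k (nroot x) in ly *.
have [h1 h2] := lens_Re ly.
have xn1 : x - 1 != 0 by rewrite subr_eq0 -[x](nroot_n k x0).
have yE : y = x / (x - 1) by rewrite /y /ycoord nroot_n.
have y1E : 1 - y = - (x - 1)^-1 by rewrite yE; field.
have c0 : 0 < cabs (x - 1) ^+ 2 by rewrite exprn_gt0// cabs_gt0.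
have Iy : complex.Im y = - complex.Im x / cabs (x - 1) ^+ 2.
  have -> : y = 1 + (x - 1)^-1 by rewrite yE; field.
  by rewrite ImD Im1 add0r Im_inv ImD ImN Im1 oppr0 addr0.
have I1y : complex.Im (1 - y) = complex.Im x / cabs (x - 1) ^+ 2.
  by rewrite ImD ImN Im1 Iy add0r mulNr opprK.
have bx := Im_clog x0; have by_ := Im_clog h1; have b1y := Im_clog h2.
have p0 := pi_gt0 R.
have nb t : - (pi / 2) < t < pi / 2 -> `|t| < (pi : R).
  by move=> /andP[? ?]; rewrite ltr_norml; apply/andP; split; lra.
have S1 := Im_log_sign (nb _ by_); have S2 := Im_log_sign (nb _ b1y).
have S3 := Im_log_sign (nb _ bx).
rewrite !cexp_clog// in S1 S2 S3.
have eE : cexp (ipi + (clog y - clog (1 - y))) = x.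
  rewrite cexpD cexp_ipi cexpB !cexp_clog// y1E yE invrN invrK mulN1r mulrN opprK.
  by rewrite divfK.
rewrite /zlens.
move: bx by_ b1y => /andP[? ?] /andP[? ?] /andP[? ?].
case: (ltrP 0 (complex.Im x)) => ix'.
  rewrite mul1r /nroot; congr (cexp (_ * _)); apply: cexp_inj.
    by rewrite eE cexp_clog.
  have sy : complex.Im (clog y) < 0.
    by apply: S1.1; rewrite Iy ltr_pdivrMr// mul0r; lra.
  have s1y : 0 < complex.Im (clog (1 - y)).
    by apply: S2.2; rewrite I1y divr_gt0.
  rewrite !(ImD, ImN) Im_Mi Re_rc.
  by rewrite ltr_norml; apply/andP; split; lra.
have ix2 : complex.Im x < 0 by rewrite lt_neqAle ix.
rewrite /zeta2n -cexpX /nroot -cexpD; congr cexp.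
have -> : 2 * (m * ipi) + m * clog x = m * (clog x + (ipi + ipi)) by ring.
congr (_ * _); apply: cexp_inj.
  by rewrite eE 2!cexpD cexp_ipi cexp_clog// mulrNN mulr1 mulr1.
have sx : complex.Im (clog x) < 0 by apply: S3.1.
have sy : 0 < complex.Im (clog y).
  by apply: S1.2; rewrite Iy divr_gt0//; lra.
have s1y : complex.Im (clog (1 - y)) < 0.
  by apply: S2.1; rewrite I1y ltr_pdivrMr// mul0r.
rewrite !(ImD, ImN) Im_Mi Re_rc.
by rewrite ltr_norml; apply/andP; split; lra.
Qed.

(** A point of the unit circle with real part in (0, 1/2), for which a
Pythagorean triple makes the verification immediate. *)
Definition xu : C := Complex (5 / 13) (12 / 13).

Lemma upper_xu : upper xu /\ xu^-1 = Complex (5 / 13) (- (12 / 13)).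
Proof.
have E : xu^-1 = Complex (5 / 13) (- (12 / 13)).
  have n1 : (5 / 13) ^+ 2 + (12 / 13) ^+ 2 = 1 :> R by rewrite !expr2; lra.
  by apply: complexPE => /=; rewrite n1 divr1.
split=> //; split; rewrite /strip ?E; try split; rewrite /mkset /xu /=; lra.
Qed.

Section Fixed.
Variables (s mu : C).
Hypothesis sg : nonres s mu.

Lemma eig_mx_unit : eig_mx s mu \in unitmx.
Proof. by rewrite unitmxE unitfE; exact: det_eig_mx. Qed.

Lemma eigframe_fund_inf x : strip x^-1 ->
  eigframe s (plog (nroot x)^-1) (nroot x) = eig_mx s mu *m fund_inf mu (nroot x).
Proof.
move=> xs; have [xV xV2] := xs; rewrite /mkset in xV xV2.
have [x0 _] := clogV xV; rewrite invrK in x0.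
have x1 : x != 1 by apply: contraTneq xV2 => ->; rewrite invr1 Re1 -leNgt; lra.
have := eigframe_strip k sg xs; rewrite (nrootV k x0) => E.
by rewrite (fund_inf_Jm k mu (cexp_neq0 _)) mulmxA -E (eigframe_Jm k s _ x0 x1).
Qed.

(** At a point of the upper side the eigenframe is eig_mx times fund0 for one
logarithm of tau and eig_mx times fund_inf for the other, while fund0 and
fund_inf differ by the connection matrix. *)
Lemma conn_mx_up : eig_mx s mu = eig_turn s ipi *m eig_mx s mu *m conn_mx mu.
Proof.
have [up _] := upper_xu; have [xs xs' ix] := up.
have [x0 _] := xs; rewrite /mkset in x0.
have [ly zE] := lens_match xs xs' (lt0r_neq0 ix).
rewrite ix mul1r in zE.
have [_ di] := zlens_disc k ly; have := conn_mx_lens k mu ly; rewrite zE => BE.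
rewrite zE in di.
have Ru : fund_inf mu (nroot xu) \in unitmx.
  by rewrite unitmxE unitfE (det_fund_inf mu di) oppr_eq0 oner_neq0.
have := eigframe_fund_inf xs';
  rewrite (log_jump up) eigframe_shift (eigframe_strip k sg xs) BE => E.
exact: (cancelR_conj Ru E).
Qed.

(** The same comparison on the other side of the real axis. There the sector of
the lens is reached after a rotation by zeta2n^2, and the half turn goes the
other way. *)
Lemma conn_mx_low : conn_mx mu *m mx2 1 0 0 (zeta2n ^+ 2) *m conn_mx mu =
  mx2 (zeta2n ^+ 2) 0 0 1.
Proof.
have [up _] := upper_xu; have [xs xs' ix] := up.
have [x0 _] := xs; have [x0' _] := xs'; rewrite /mkset in x0 x0'.
have xsV : strip xu^-1^-1 by rewrite invrK.
have ixV : complex.Im xu^-1 < 0.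
  rewrite Im_inv ltr_pdivrMr ?mul0r; first lra.
  by rewrite exprn_gt0// Re_gt0_cabs.
have [ly zE] := lens_match xs' xsV (ltr0_neq0 ixV).
rewrite ltNge (ltW ixV)/= in zE; set z := nroot xu^-1 in ly zE *.
have z0 : z != 0 := cexp_neq0 _.
have q0 : zeta2n != 0 := cexp_neq0 _.
have zsn : (zeta2n ^+ 2) ^+ n = 1.
  rewrite exprAC -cexpX mulrA mN mul1r cexp_ipi.
  by rewrite expr2 mulrNN mulr1.
have [_ di] := zlens_disc k ly; have := conn_mx_lens k mu ly; rewrite zE.
rewrite (fund0_rot mu z zsn) (fund_inf_rot mu z0 zsn).
set Dr := mx2 (_^-1) 0 0 1; set D1 := mx2 _ 0 0 1; set D2 := mx2 1 0 0 _.
move=> BE.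
have Du : Dr \in unitmx by rewrite mx2_unit mul0r subr0 mulr1 invr_eq0 expf_neq0.
have {}BE : D1 *m fund0 mu z = conn_mx mu *m D2 *m fund_inf mu z.
  exact: cancelR_rot Du BE.
have Ru : fund_inf mu z \in unitmx.
  have : \det (fund_inf mu (zeta2n ^+ 2 * z)) = -1 by rewrite -zE;
    exact: det_fund_inf.
  rewrite (fund_inf_rot mu z0 zsn) unitmxE unitfE.
  by move=> E; apply/eqP => E0; move: E;
    rewrite !det_mulmx E0 mulr0 mul0r => /esym/eqP;
    rewrite oppr_eq0 oner_eq0.
have lj := log_jump up.
have zV : nroot xu = z^-1 by rewrite /z nrootV// invrK.
have e1 := eigframe_strip k sg xs'; rewrite -/z in e1.
have e2 : eigframe s (plog z^-1) z = eig_mx s mu *m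
  fund_inf mu z by apply: eigframe_fund_inf.
have l2 : plog z = plog z^-1 + ipi by rewrite -zV -lj zV invrK.
rewrite l2 eigframe_shift e2 in e1.
have {}e1 := conj_solve eig_mx_unit e1.
have EB := conj_cancel eig_mx_unit conn_mx_up.
rewrite e1 mulmxA in BE; have {}BE := cancelR Ru BE.
exact: conj_compose BE EB.
Qed.

(** The connection matrix is conjugate to the half turn in the exponents, which
determines its trace. *)
Lemma conn_mx_conj : conn_mx mu = invmx (eig_mx s mu) *m eig_turn s (- ipi) *m
  eig_mx s mu.
Proof.
have LK : eig_turn s (- ipi) *m eig_turn s ipi =
  1%:M by rewrite eig_turn_mul addNr eig_turn0.
exact: (conj_solveB eig_mx_unit LK conn_mx_up).
Qed.

(** The origin of the whole monodromy: a half turn of tau is multiplication by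
the connection matrix. *)
Lemma fund1_step l z : fund1 s mu (l - ipi) z = conn_mx mu *m fund1 s mu l z.
Proof.
rewrite /fund1 eigframe_shift conn_mx_conj; exact: (conj_step _ _ eig_mx_unit).
Qed.

(** The quotient sin (pi s) / sin (pi / n). *)
Definition kap := (cexp (ipi * s) - cexp (- (ipi * s))) / (zeta2n - zeta2n^-1).

Lemma zeta2n_sqr_neq1 : zeta2n ^+ 2 != 1.
Proof.
rewrite -cexpX; apply/eqP => /cexp_eq1[p pE].
have pi0 := pi_gt0 R.
have p0 : 2 * rc pi * ii != 0.
  rewrite !mulf_neq0 ?pnatr_eq0//.
    by rewrite -(rmorph0 (real_complex R)) (inj_eq (@complexI R)) gt_eqF.
  by rewrite -(@cexp_ipi2 R) cexp_neq0.
have {pE} : 2 * rc pi * ii * m = 2 * rc pi * ii * p%:~R by rewrite -pE; ring.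
move/(mulfI p0) => E.
have : (n%:Z * p)%:~R = (1 : int)%:~R :> C.
  by rewrite intrM -E mulfV// N_neq0.
move/eqP; rewrite eqr_int => /eqP/(congr1 absz)/eqP.
by rewrite abszM muln_eq1.
Qed.

(** From the equation of conn_mx_low and the determinant one gets B_00 = -
zeta2n^2 B_11, and the trace then gives both entries. *)
Lemma conn_mx_entries : conn_mx mu 0 0 = - (zeta2n * kap) /\ conn_mx mu 1 1 =
  kap / zeta2n.
Proof.
have q0 : zeta2n != 0 := cexp_neq0 _.
have q2 : zeta2n ^+ 2 - 1 != 0 by rewrite subr_eq0 zeta2n_sqr_neq1.
have dB := conn_mx_det k mu; have lB := conn_mx_low.
have tB : \tr (conn_mx mu) = cexp (- (ipi * s)) + cexp (- (ipi * (1 - s))).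
  rewrite conn_mx_conj mxtrace_mulC mulmxA mulmxV ?mul1mx ?eig_mx_unit//
    /eig_turn.
  by rewrite /mxtrace !big_ord_recl big_ord0 addr0 !mxE/= !mulNr.
have tr : conn_mx mu 0 0 + conn_mx mu 1 1 = cexp (- (ipi * s)) - cexp (ipi * s).
  move: tB; rewrite /mxtrace !big_ord_recl big_ord0 addr0 => E.
  have -> : (1 : 'I_2) = lift ord0 ord0 by apply/val_inj.
  rewrite E; congr (_ + _).
  have -> : - (ipi * (1 - s)) = ipi * s - ipi by ring.
  by rewrite cexpB cexp_ipi invrN1 mulrN1.
clear tB; move: (conn_mx mu) dB lB tr => B;
  rewrite {1 2 3}[B]mx2E !mx2_mul mx2_det.
move: (B 0 0) (B 0 1) (B 1 0) (B 1 1) => a b c d dB lB tr; move: dB lB.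
move=> dB /mx2_inj[e1 e2 e3 e4].
have bc : b * c = a * d + 1 by rewrite -[a * d](subrK (b * c)) dB; ring.
have f1 : a * (a + zeta2n ^+ 2 * d) = 0.
  have -> : a * (a + zeta2n ^+ 2 * d) =
    (a * a + zeta2n ^+ 2 * (b * c)) - zeta2n ^+ 2.
    by rewrite bc; ring.
  by apply/eqP; rewrite subr_eq0; apply/eqP; rewrite -[RHS]e1; ring.
have f2 : d * (a + zeta2n ^+ 2 * d) = 0.
  have -> : d * (a + zeta2n ^+ 2 * d) = (b * c + zeta2n ^+ 2 * d * d) - 1.
    by rewrite bc; ring.
  by apply/eqP; rewrite subr_eq0; apply/eqP; rewrite -[RHS]e4; ring.
have f3 : a = - (zeta2n ^+ 2 * d).
  apply/eqP; rewrite -addr_eq0; apply/negPn/negP => ne.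
  move: f1 f2 => /eqP; rewrite mulf_eq0 (negbTE ne) orbF => /eqP a0 /eqP.
  rewrite mulf_eq0 (negbTE ne) orbF => /eqP d0.
  by move: ne; rewrite a0 d0 mulr0 addr0 eqxx.
have f4 : d * (1 - zeta2n ^+ 2) = cexp (- (ipi * s)) - cexp (ipi * s).
  by rewrite -tr f3; ring.
have q3 : 1 - zeta2n ^+ 2 != 0 by rewrite -oppr_eq0 opprB.
have f5 : d = kap / zeta2n.
  apply: (mulIf q3); rewrite f4 /kap.
  have -> : zeta2n - zeta2n^-1 = (zeta2n ^+ 2 - 1) / zeta2n by field.
  by field; rewrite q0 q2.
split=> //; rewrite f3 f5; by field.
Qed.

Lemma eigframe_rot l z om : om ^+ n = 1 -> eigframe s l (om * z) =
  eigframe s l z *m mx2 om^-1 0 0 1.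
Proof.
move=> o1; have oE := om_pred o1.
have X : (om * z) ^+ n = z ^+ n by rewrite exprMn o1 mul1r.
have X1 : (om * z) ^+ k.+1 = om^-1 * z ^+ k.+1 by rewrite exprMn oE.
rewrite /eigframe mx2_mul /uval /uder /uE /uF /udF /ue /tau2 /dtau2 /dlog /tau
  X X1.
by congr mx2; ring.
Qed.

End Fixed.

(** At a point common to both domains z^n lies in the strip, so z is an n-th
root of unity times the principal root, at which the frames agree for the
determination plog; the logarithm l differs from it by a multiple of 2 pi i. *)
Lemma fund0_fund1 z l : disc0 z -> Rpos z -> cexp l = tau z ->
  exists2 om, om ^+ n = 1 & exists p : int, forall s mu, nonres s mu ->
   fund0 mu z = mx2 om 0 0 1 *m fund1 s mu (l + ipi * p%:~R) z.
Proof.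
move=> d0 zp lt; pose x := z ^+ n.
have xs : strip x by split.
have [x0 _] := xs; rewrite /mkset in x0.
have [zp' z1' d0'] := strip_z k xs.
have [om o1 zE] : exists2 om, om ^+ n = 1 & z = om * nroot x.
  by apply: root_om; rewrite ?cexp_neq0 ?nroot_n//; exact: Rpos_z0 zp.
exists om => //.
have : cexp (plog (nroot x)) = cexp l.
  by rewrite (cexp_plog zp' z1') lt /tau nroot_n.
move=> /cexp_eq[p pE]; exists (2 * p) => s mu sg.
have lE : l + ipi * (2 * p)%:~R = plog (nroot x) by rewrite pE intrM; ring.
rewrite lE {1 2}zE (fund0_rot mu _ o1) /fund1 (eigframe_rot s _ _ o1).
exact: (invmx_cancel _ _ (eig_mx_unit sg) (eigframe_strip k sg xs)).
Qed.

End Entries.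

(** * Sine and cardinal sine *)

Section Sine.
Variable R : realType.
Local Notation C := (CC R).
Implicit Types (z w : C) (t : R).
Local Notation rc t := (t%:C)%C.
Local Notation ii := ('i%C : C).

Definition csin z : C := (cexp (ii * z) - cexp (- (ii * z))) / (2 * ii).

Lemma ii_neq0 : ii != 0.
Proof. by rewrite -(@cexp_ipi2 R) cexp_neq0. Qed.

Lemma two_ii_neq0 : 2 * ii != 0.
Proof. by rewrite mulf_neq0 ?ii_neq0 ?pnatr_eq0. Qed.

Lemma csinR t : csin (rc t) = rc (sin t).
Proof.
rewrite /csin; have -> : - (ii * rc t) = ii * rc (- t) by rewrite rmorphN mulrN.
rewrite !cexp_i cosN sinN.
have -> : Complex (cos t) (sin t) - Complex (cos t) (- sin t) =
  rc (sin t) * (2 * ii).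
  by apply: complexPE; rewrite !ReIm /=; ring.
by rewrite mulfK// two_ii_neq0.
Qed.

Definition exp_c k : C := (k`!%:R)^-1.

Lemma exp_conv r : conv_disc exp_c r.
Proof.
move=> X X0 _; have [N XN] : exists N : nat, 2 * X < N%:R.
  by exists (Num.bound (2 * X)); apply: archi_boundP; rewrite mulr_ge0.
apply: (@ratio_bounded _ _ 2^-1 N).
- by move=> k; rewrite mulr_ge0 ?cabs_ge0 ?exprn_ge0.
- by lra.
move=> k Nk; rewrite /exp_c !cabsV !cabs_nat factS natrM invfM exprS.
have kX : X / k.+1%:R <= 2^-1.
  rewrite ler_pdivrMr// mulrC ler_pdivlMr// mulrC (le_trans (ltW XN))//.
  by rewrite ler_nat (leq_trans Nk).
have -> : k.+1%:R^-1 / k`!%:R * (X * X ^+ k) = X / k.+1%:R * (k`!%:R^-1 * X ^+ k).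
  by move: (k.+1%:R^-1) (k`!%:R^-1) => a b; ring.
by rewrite ler_wpM2r// mulr_ge0 ?invr_ge0 ?exprn_ge0.
Qed.

(** The quotient of the series by cexp has vanishing derivative. *)
Lemma cexp_series z : cexp z = pser exp_c z.
Proof.
have d w : cder (pser exp_c) w (pser exp_c w).
  have w1 : cabs w < cabs w + 1 by rewrite ltrDl.
  have := cder_pser (@exp_conv (cabs w + 1)) w1.
  have -> : pdiff exp_c = exp_c.
    apply/funext => k; rewrite /pdiff /exp_c factS natrM invfM mulrA.
    by rewrite mulfV ?mul1r ?pnatr_eq0.
  by [].
pose f w := pser exp_c w * cexp (- w).
have f0 w : cder f w 0.
  have h : cder (fun w => cexp (- w)) w (cexp (- w) * - 1).
    exact: (cder_comp (cderN (cderid w)) (cder_cexp _)).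
  by apply: cder_eq (cderM (d w) h) _; ring.
have E : pser exp_c 0 * cexp (- 0) = pser exp_c z * cexp (- z).
  by apply: (cder0_cst (f := f)) => t _; exact: f0.
have e0 : pser exp_c 0 = 1.
  by rewrite (pser_at0 ltr01 (@exp_conv 1)) /exp_c fact0 invr1.
rewrite e0 oppr0 cexp0 mul1r in E.
by rewrite -[LHS]mul1r E -mulrA -cexpD addNr cexp0 mulr1.
Qed.

Definition sin_c k : C := (ii ^+ k - (- ii) ^+ k) / (2 * ii) * exp_c k.

Lemma cabs_i : cabs ii = 1.
Proof. by rewrite /cabs/= expr0n/= add0r expr1n sqrtr1. Qed.

Lemma cabs_sin_c k : cabs (sin_c k) <= cabs (exp_c k).
Proof.
rewrite /sin_c cabsM ler_piMl ?cabs_ge0// cabsM cabsV [cabs (2 * ii)]cabsM.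
rewrite cabs_i mulr1 cabs_nat ler_pdivrMr// mul1r (le_trans (cabsB _ _))//.
by rewrite !cabsX cabsN cabs_i expr1n.
Qed.

Lemma sin_c_conv r : conv_disc sin_c r.
Proof.
move=> X X0 Xr; have [S HS] := exp_conv X0 Xr; exists S => n.
apply: le_trans (HS n); apply: ler_sum => k _.
by rewrite ler_wpM2r ?exprn_ge0// cabs_sin_c.
Qed.

Lemma csin_series z : csin z = pser sin_c z.
Proof.
have z1 : cabs z < cabs z + 1 by rewrite ltrDl.
have se (w : C) : cabs w = 1 -> summable (fun k => exp_c k * (w * z) ^+ k).
  move=> w1; apply: (summable_pser (@exp_conv (cabs z + 1))).
  by rewrite cabsM w1 mul1r.
have E1 : cexp (ii * z) = csum (fun k => exp_c k * (ii * z) ^+ k).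
  exact: cexp_series.
have E2 : cexp (- (ii * z)) = csum (fun k => exp_c k * (- ii * z) ^+ k).
  by rewrite -mulNr; exact: cexp_series.
rewrite /csin E1 E2 -[- csum _]mulN1r.
have s1 := se _ cabs_i; have s2 : summable (fun k => exp_c k * (- ii * z) ^+ k).
  by apply: se; rewrite cabsN cabs_i.
have s3 := summableZ (-1) s2.
rewrite -(csumZ (-1) s2) -(csumD s1 s3) mulrC -(csumZ _ (summableD s1 s3)).
by apply: eq_csum => k; rewrite /sin_c !exprMn; ring.
Qed.

(** The entire function sin z / z. *)
Definition csinc := pser (fun k => sin_c k.+1).

Lemma csinc_conv r : conv_disc (fun k => sin_c k.+1) r.
Proof.
move=> X X0 Xr; have [S HS] := exp_conv X0 Xr; exists S => n.
apply: le_trans (HS n); apply: ler_sum => k _.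
rewrite ler_wpM2r ?exprn_ge0// (le_trans (cabs_sin_c _))// /exp_c !cabsV
  !cabs_nat.
by rewrite lef_pV2 ?posrE ?ltr0n ?fact_gt0// ler_nat factS leq_pmull.
Qed.

Lemma csincM z : z * csinc z = csin z.
Proof.
have z1 : cabs z < cabs z + 1 by rewrite ltrDl.
rewrite csin_series /pser csumS; last exact: (summable_pser (@sin_c_conv _) z1).
rewrite {1}/sin_c !expr0 subrr !mul0r add0r /csinc /pser -csumZ.
  by apply: eq_csum => k; rewrite exprS; ring.
exact: (summable_pser (@csinc_conv _) z1).
Qed.

Lemma hol_csinc z : hol csinc z.
Proof.
eexists; apply: (cder_pser (@csinc_conv (cabs z + 1))).
by rewrite ltrDl.
Qed.

Lemma csinc0 : csinc 0 = 1.
Proof.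
rewrite /csinc (pser_at0 ltr01 (@csinc_conv 1)) /sin_c !expr1 /exp_c (_ : 1`! =
  1%N)// invr1 mulr1.
have -> : ii - - ii = 2 * ii by ring.
by rewrite mulfV ?two_ii_neq0.
Qed.

Lemma csincR t : 0 <= t < pi -> exists2 c : R, 0 < c & csinc (rc t) = rc c.
Proof.
move=> /andP[t0 tp]; have [->|tn0] := eqVneq t 0.
  by exists 1 => //; rewrite rmorph0 csinc0 rmorph1.
have tp0 : 0 < t by rewrite lt_neqAle eq_sym tn0.
exists (sin t / t); first by rewrite divr_gt0// sin_gt0_pi// tp0.
have tc : rc t != 0.
  by rewrite -(rmorph0 (real_complex R)) (inj_eq (@complexI R)).
apply: (mulfI tc); rewrite csincM csinR rmorphM/= fmorphV/= mulrC divfK//.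
Qed.

End Sine.

(** * Holomorphic dependence on the parameter *)

Section HolNear.
Variable R : realType.
Local Notation C := (CC R).
Implicit Types (f g : C -> C) (z lam : C).

Lemma hol_near f g z : (\forall w \near z, f w = g w) -> hol f z -> hol g z.
Proof. by move=> fg [d fd]; exists d; exact: cder_near fg fd. Qed.

Lemma near_Re_gt f z (a : R) : hol f z -> a < complex.Re (f z) ->
  \forall w \near z, a < complex.Re (f w).
Proof.
move=> hf lt; have e0 : 0 < complex.Re (f z) - a by rewrite subr_gt0.
have [r r0 H] := hol_eps hf e0; apply/nbhsCP; exists r => // w /H fw.
have := Re_le_cabs (f w - f z); rewrite ReD ReN ler_norml => /andP[h _]; lra.
Qed.

Lemma near_Re_lt f z (a : R) : hol f z -> complex.Re (f z) < a ->
  \forall w \near z, complex.Re (f w) < a.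
Proof.
move=> /holN hf lt.
have /(near_Re_gt hf) : - a < complex.Re (- f z) by rewrite ReN ltrN2.
by apply: filterS => w; rewrite ReN ltrN2.
Qed.

Lemma near_neq0 f z : hol f z -> f z != 0 -> \forall w \near z, f w != 0.
Proof.
move=> hf; rewrite -cabs_gt0 => f0.
have [r r0 H] := hol_eps hf f0; apply/nbhsCP; exists r => // w /H.
by apply: contraTneq => ->; rewrite sub0r cabsN ltxx.
Qed.

Lemma hol_csqrt f z : hol f z -> 0 < complex.Re (f z) ->
  hol (fun w => csqrt (f w)) z.
Proof. by move=> hf f0; apply: hol_comp hf _; exact: cder_csqrt. Qed.

Lemma Re_csqrt z : 0 < complex.Re z -> 0 < complex.Re (csqrt z).
Proof.
move=> z0; rewrite /csqrt /cexp ReZ ReC mulr_gt0 ?expR_gt0//.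
apply: cos_gt0_pihalf.
have -> : complex.Im (clog z / 2) = complex.Im (clog z) / 2.
  have -> : clog z / 2 = ((2^-1)%:C)%C * clog z.
    by rewrite fmorphV/= rmorph_nat mulrC.
  by rewrite ImZ mulrC.
by have /andP[h1 h2] := Im_clog z0; have := pi_gt0 R; move=> p0;
  apply/andP; split; lra.
Qed.

Lemma conj_rc (t : R) : (((t%:C)%C : C)^*)%R = (t%:C)%C.
Proof. exact: conjc_real. Qed.

Lemma mul_conj z : z * z^* = ((cabs z ^+ 2)%:C)%C.
Proof. by rewrite -normCK normCE rmorphXn. Qed.

Lemma unit_inv z : cabs z = 1 -> z^-1 = z^*.
Proof. by move=> z1; rewrite invC_norm normCE z1 expr1n invr1 mul1r. Qed.

Lemma rcD (a b : R) : ((a + b)%:C)%C = ((a%:C)%C + (b%:C)%C : C).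
Proof. exact: rmorphD. Qed.
Lemma rcB (a b : R) : ((a - b)%:C)%C = ((a%:C)%C - (b%:C)%C : C).
Proof. exact: rmorphB. Qed.
Lemma rcM (a b : R) : ((a * b)%:C)%C = ((a%:C)%C * (b%:C)%C : C).
Proof. exact: rmorphM. Qed.
Lemma rcX (a : R) j : ((a ^+ j)%:C)%C = ((a%:C)%C ^+ j : C).
Proof. exact: rmorphXn. Qed.
Lemma rcV (a : R) : ((a^-1)%:C)%C = (((a%:C)%C)^-1 : C).
Proof. exact: fmorphV. Qed.
Lemma rc_nat j : ((j%:R : R)%:C)%C = (j%:R : C).
Proof. exact: rmorph_nat. Qed.

Lemma rc_eq0 (t : R) : (((t%:C)%C : C) == 0) = (t == 0).
Proof. by rewrite -(rmorph0 (real_complex R)) (inj_eq (@complexI R)). Qed.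

Lemma csin_mulDB p q : csin (p + q) * csin (p - q) =
  csin p ^+ 2 - csin q ^+ 2 :> C.
Proof.
rewrite /csin !mulrDr mulrN !opprD opprK !cexpD !cexpN.
have := cexp_neq0 ('i%C * p : C); have := cexp_neq0 ('i%C * q : C).
have := two_ii_neq0 R; move: (2 * 'i%C : C) (cexp _) (cexp _) => c a b c0 a0 b0.
by field; rewrite a0 b0 c0.
Qed.

Lemma csin_Bpi z : csin (z - ((pi : R)%:C)%C) = - csin z :> C.
Proof.
rewrite /csin mulrBr opprB cexpB cexp_ipi.
rewrite [_ - 'i%C * z]addrC cexpD cexp_ipi invrN1.
by have := two_ii_neq0 R; move: (2 * 'i%C : C) => c c0; field.
Qed.
End HolNear.

Section HypParam.
Variable (R : realType).
Local Notation C := (CC R).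
Implicit Types (mu gm y : C).

Lemma hol_hyp_mu gm mu y : cabs y < 1 ->
  hol (fun mu => hyp 1 (- mu) gm y) mu.
Proof.
move=> y1; have := @cder_hyp_mu R gm mu (fun=> 1) y y1 (fun k => or_introl erefl).
have -> // : (fun mu => csum (fun k => 1 * hyp_coef 1 (- mu) gm k * y ^+ k)) =
  (fun mu => hyp 1 (- mu) gm y).
by apply/funext => nu; apply: eq_csum => k; rewrite mul1r.
Qed.

Lemma hol_dhyp_mu gm mu y : y != 0 -> cabs y < 1 ->
  hol (fun mu => dhyp 1 (- mu) gm y) mu.
Proof.
move=> y0 y1; have H := @cder_hyp_mu R gm mu (fun k => k%:R) y y1 (fun k =>
  or_intror erefl).
have -> : (fun mu => dhyp 1 (- mu) gm y) = (fun mu => y^-1 *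
    csum (fun k => k%:R * hyp_coef 1 (- mu) gm k * y ^+ k)).
  apply/funext => nu; apply: (mulfI y0); rewrite mulrA mulfV// mul1r.
  have sb := summable_pser (conv_pdiff (@hyp_conv R 1 (- nu) gm)) y1.
  have E : (fun k => k.+1%:R * hyp_coef 1 (- nu) gm k.+1 * y ^+ k.+1) =
      (fun k => y * (pdiff (hyp_coef 1 (- nu) gm) k * y ^+ k)).
    by apply/funext => k; rewrite /pdiff exprS; ring.
  have S : summable (fun k => k%:R * hyp_coef 1 (- nu) gm k * y ^+ k).
    by apply: summable_S; rewrite E; exact: summableZ.
  by rewrite (csumS S) !mul0r add0r E csumZ.
by apply: holM; [exact: holc|exact: H].
Qed.
End HypParam.

Section B01.
Variables (R : realType) (k : nat).
Local Notation C := (CC R).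

Lemma zeta2n_zlens : zeta2n R k = zlens k 2^-1.
Proof. by rewrite zlens_half. Qed.

Lemma ycoord_zeta2n : ycoord k (zeta2n R k) = 2^-1.
Proof. by rewrite zeta2n_zlens ycoord_zlens//; exact: lens_half. Qed.

Lemma ycoord_zeta2nV : ycoord k (zeta2n R k)^-1 = 2^-1.
Proof.
have [d0 di] := zlens_disc k (lens_half R).
rewrite -zeta2n_zlens in d0;
  rewrite ycoord_inv ?cexp_neq0 ?disc0_ne1// ycoord_zeta2n.
by field.
Qed.

(** The entry is a polynomial in the values at y = 1/2 of the hypergeometric
functions and of their derivatives. *)
Lemma hol_B01 mu : hol (fun mu : C => conn_mx k mu 0 1) mu.
Proof.
have c2 : cabs (2^-1 : C) < 1 by rewrite cabsV cabs_nat; lra.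
have n2 : (2^-1 : C) != 0 by rewrite invr_eq0 pnatr_eq0.
have hF := hol_hyp_mu (1 + (k.+2%:R)^-1) mu c2.
have hG := hol_dhyp_mu (1 + (k.+2%:R)^-1) mu n2 c2.
have h2 : hol (fun mu => b2 k mu (zeta2n R k)) mu.
  by rewrite /b2 ycoord_zeta2n; exact: (holM (holc _ _) hF).
have hd2 : hol (fun mu => db2 k mu (zeta2n R k)) mu.
  by rewrite /db2 ycoord_zeta2n; exact: (holD hF (holM (holc _ _) hG)).
have h2' : hol (fun mu => b2 k mu (zeta2n R k)^-1) mu.
  by rewrite /b2 ycoord_zeta2nV; exact: (holM (holc _ _) hF).
have hd2' : hol (fun mu => db2 k mu (zeta2n R k)^-1) mu.
  by rewrite /db2 ycoord_zeta2nV; exact: (holD hF (holM (holc _ _) hG)).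
have h4 : hol (fun mu => b4 k mu (zeta2n R k)) mu.
  by rewrite /b4 /inv; apply: holM => //; exact: holc.
have hd4 : hol (fun mu => db4 k mu (zeta2n R k)) mu.
  by rewrite /db4 /dinv; apply: holB => //; apply: holM => //; exact: holc.
have -> : (fun mu : C => conn_mx k mu 0 1) =
  (fun mu => db2 k mu (zeta2n R k) * b4 k mu (zeta2n R k)
    - b2 k mu (zeta2n R k) * db4 k mu (zeta2n R k)).
  apply/funext => nu; rewrite /conn_mx /fund0 /sol_mx mx2_mul [in LHS]mxE.
  by rewrite /mx2 mxE /=; ring.
by apply: holB; apply: holM.
Qed.

End B01.

(** * The spectral parameter near the unit circle *)

Section Spectral.
Variables (R : realType) (k : nat) (w : R).
Hypothesis k_gt0 : (0 < k)%N.
Local Notation n := k.+2.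
Hypothesis hw : - (8 * n%:R) / (n%:R - 2) ^+ 2 <= w < 0.
Local Notation C := (CC R).
Implicit Types (lam : C) (t : R).
Local Notation N := (n%:R : C).
Local Notation m := (N^-1).
Local Notation rc t := (t%:C)%C.
Local Notation ii := ('i%C : C).
Local Notation zeta2n := (zeta2n R k).

Lemma cjD (a b : C) : (a + b)^* = a^* + b^*. Proof. exact: rmorphD. Qed.
Lemma cjM (a b : C) : (a * b)^* = a^* * b^*. Proof. exact: rmorphM. Qed.
Lemma cjB1 (a : C) : (1 - a)^* = 1 - a^*. Proof. by rewrite rmorphB rmorph1. Qed.

(** The parameter mu = v / lam of the scalar equation. The exponent s = 1/2 + nu
solves s (s - 1) = mu because nu^2 = 1/4 + mu. *)
Definition mu_of lam : C := v n w lam / lam.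
Definition nusq lam : C := 4^-1 + mu_of lam.
Definition nu lam : C := csqrt (nusq lam).
Definition exponent lam : C := 2^-1 + nu lam.
Definition kappa_of lam : C := kap k (exponent lam).

Definition mR : R := n%:R^-1.
(** The two values of nu nearest to 1/2 at which kappa^2 = 1. *)
Definition nu0 : R := 2^-1 - mR.
Definition nu1 : R := 2^-1 + mR.
Definition k0 : R := (n%:R - 2) ^+ 2 * (- w) / (16 * n%:R ^+ 2).

Lemma nR_ge3 : 3 <= n%:R :> R.
Proof. by rewrite ler_nat !ltnS. Qed.

Lemma mR_bounds : 0 < mR <= 3^-1.
Proof.
have n3 := nR_ge3.
by rewrite /mR invr_gt0 lef_pV2 ?posrE ?n3 ?andbT//; lra.
Qed.

Lemma rc_mR : rc mR = m.
Proof. by rewrite /mR fmorphV/= rmorph_nat. Qed.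

Lemma rc_nu0 : rc nu0 = 2^-1 - m.
Proof. by rewrite /nu0 rmorphB/= rc_mR fmorphV/= rmorph_nat. Qed.

Lemma rc_nu1 : rc nu1 = 2^-1 + m.
Proof. by rewrite /nu1 rmorphD/= rc_mR fmorphV/= rmorph_nat. Qed.

Lemma k0_bounds : 0 < k0 <= mR / 2.
Proof.
have n3 := nR_ge3; move: hw => /andP[w1 w0].
have n2 : 0 < (n%:R - 2 : R) by lra.
have n22 : 0 < (n%:R - 2 : R) ^+ 2 by rewrite exprn_gt0.
have np : 0 < (n%:R : R) by lra.
apply/andP; split.
  rewrite /k0 divr_gt0 ?mulr_gt0 ?oppr_gt0 ?exprn_gt0//.
have le : (n%:R - 2) ^+ 2 * - w <= 8 * n%:R.
  by move: w1; rewrite ler_pdivrMr// mulrC; lra.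
rewrite /k0 /mR ler_pdivrMr ?mulr_gt0 ?exprn_gt0// (le_trans le)//.
have -> : n%:R^-1 / 2 * (16 * n%:R ^+ 2) = 8 * n%:R :> R.
  have : (n%:R : R) != 0 by rewrite gt_eqF.
  by move: (n%:R : R) => x x0; field.
by [].
Qed.

(** These roots, al + de and al - de, are real because w >= - 8 n / (n - 2)^2. *)
Definition sqrtP : R := Num.sqrt (2 * mR).
Definition sqrtM : R := Num.sqrt (2 * mR - 4 * k0).
(** Chosen so that al^2 + de^2 = 2 / n - 2 k0 and al de = k0. *)
Definition al : R := (sqrtP + sqrtM) / 2.
Definition de : R := (sqrtP - sqrtM) / 2.

Lemma al_de : [/\ 0 < al, 0 <= de, de <= al, al ^+ 2 + de ^+ 2 = 2 * mR - 2 * k0 &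
  al * de = k0].
Proof.
have /andP[m0 _] := mR_bounds; have /andP[kk0 kk1] := k0_bounds.
have P0 : 0 < sqrtP by rewrite /sqrtP sqrtr_gt0; lra.
have M0 : 0 <= sqrtM by exact: sqrtr_ge0.
have MP : sqrtM <= sqrtP by rewrite /sqrtM /sqrtP ler_wsqrtr//; lra.
have P2 : sqrtP ^+ 2 = 2 * mR by rewrite sqr_sqrtr//; lra.
have M2 : sqrtM ^+ 2 = 2 * mR - 4 * k0 by rewrite sqr_sqrtr//; lra.
have e1 : al ^+ 2 + de ^+ 2 = (sqrtP ^+ 2 + sqrtM ^+ 2) / 2 by rewrite /al /de;
  field.
have e2 : al * de = (sqrtP ^+ 2 - sqrtM ^+ 2) / 4 by rewrite /al /de; field.
by split; rewrite ?e1 ?e2 ?P2 ?M2 /al /de; lra.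
Qed.

Lemma nusq_eq lam : lam != 0 ->
  nusq lam = rc (nu0 ^+ 2) + rc k0 * ((1 - lam) * (1 - lam^-1)).
Proof.
move=> l0; have N0 := N_neq0 R k.
have -> : rc (nu0 ^+ 2) = (2^-1 - m) ^+ 2.
  by rewrite rmorphXn/= rc_nu0.
have -> : rc k0 = (N - 2) ^+ 2 * (- rc w) / (16 * N ^+ 2).
  rewrite /k0 rmorphM/= rmorphM/= rmorphXn/= fmorphV/= rmorphM/= rmorphXn/=.
  by rewrite rmorphN/= rmorphB/= !rmorph_nat.
rewrite /nusq /mu_of /v; move: (rc w) N N0 => W K K0.
by field; rewrite l0 K0.
Qed.

Definition Sm : C := csin (rc pi * m).

Lemma Sm_rc : Sm = rc (sin (pi * mR)).
Proof. by rewrite /Sm -rc_mR -rmorphM csinR. Qed.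

Lemma sin_m_gt0 : 0 < sin (pi * mR).
Proof.
have /andP[m0 m1] := mR_bounds; have p0 := pi_gt0 R.
by apply: sin_gt0_pi; rewrite mulr_gt0//= gtr_pMr//; lra.
Qed.

Lemma Sm_neq0 : Sm != 0.
Proof. by rewrite Sm_rc rc_eq0 gt_eqF// sin_m_gt0. Qed.

Lemma kap_sin s : kap k s = csin (rc pi * s) / Sm.
Proof.
rewrite /kap /Sm /csin /zeta2n -cexpN.
have -> : ii * (rc pi * s) = ii * rc pi * s by ring.
have -> : ii * (rc pi * m) = m * (ii * rc pi) by ring.
have := two_ii_neq0 R; move: (2 * ii) (cexp _ - _) (cexp _ - _) => c a b c0.
by rewrite invfM invrK mulrACA mulVf// mulr1.
Qed.

(** The factor of 1 - kappa^2 that remains after its zeros at nu = nu0 and nu =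
nu1 have been split off. *)
Definition sincprod lam : C := (rc pi) ^+ 2 * csinc (rc pi * (nu lam - rc nu0)) *
  csinc (rc pi * (rc nu1 - nu lam)) /
  ((nu lam + rc nu0) * (nu lam + rc nu1) * Sm ^+ 2).

(** A neighbourhood of the unit circle on which nu, kappa and the square root of
sincprod are holomorphic. The upper bound on Re nu^2 keeps the exponent 1 - s
away from resonance. *)
Definition Omega lam := [/\ lam != 0, 0 < complex.Re (nusq lam),
  complex.Re (nusq lam) < 1 & 0 < complex.Re (sincprod lam)].

Lemma nu0_gt0 : 0 < nu0. Proof. by have /andP[m0 m1] := mR_bounds;
  rewrite /nu0; lra. Qed.
Lemma nu1_gt0 : 0 < nu1. Proof. by have /andP[m0 m1] := mR_bounds;
  rewrite /nu1; lra. Qed.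

Lemma nu_sqr lam : 0 < complex.Re (nusq lam) -> nu lam * nu lam = nusq lam.
Proof. exact: csqrtK. Qed.

Lemma nuD_neq0 lam (a : R) : 0 < complex.Re (nusq lam) -> 0 < a ->
  nu lam + rc a != 0.
Proof.
move=> x0 a0; apply: Re_neq0; rewrite ReD Re_rc.
by rewrite addr_gt0// Re_csqrt.
Qed.

Lemma nonres_exponent lam : Omega lam -> nonres (exponent lam) (mu_of lam).
Proof.
move=> [l0 x0 x1 _]; have nn := nu_sqr x0; have rn : 0 < complex.Re (nu lam) :=
  Re_csqrt x0.
split.
- have -> : exponent lam * (exponent lam - 1) =
  nu lam * nu lam - 4^-1 by rewrite /exponent; field.
  by rewrite nn /nusq addrAC subrr add0r.
- move=> j; apply: Re_neq0; rewrite /gmu /exponent.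
  have -> : 2^-1 + nu lam + 2^-1 + j%:R = nu lam + rc (1 + j%:R).
    by rewrite rmorphD rmorph1 rmorph_nat; field.
  by rewrite ReD Re_rc ltr_wpDr// addr_ge0.
- move=> j; apply/eqP => E.
  have E2 : nu lam = rc (1 + j%:R).
    move/eqP: E; rewrite /gmu /exponent.
    have -> : 1 - (2^-1 + nu lam) + 2^-1 + j%:R = (1 + j%:R) - nu lam by field.
    by rewrite subr_eq0 => /eqP <-; rewrite rmorphD rmorph1 rmorph_nat.
  move: x1; rewrite -nn E2 -rmorphM Re_rc.
  have : 0 <= j%:R :> R by [].
  by move: (j%:R : R) => x; nra.
- have -> : 2 * exponent lam - 1 = 2 * nu lam by rewrite /exponent; field.
  by rewrite mulf_neq0 ?pnatr_eq0// Re_neq0.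
Qed.

(** By sin^2 p - sin^2 q = sin (p + q) sin (p - q) the left-hand side is a
product of two sines with zeros at nu = nu1 and nu = nu0. *)
Lemma kap_prod lam : Omega lam -> 1 - kappa_of lam ^+ 2 =
  (nusq lam - rc (nu0 ^+ 2)) * (rc (nu1 ^+ 2) - nusq lam) * sincprod lam.
Proof.
move=> [l0 x0 x1 _]; rewrite /kappa_of kap_sin; have S0 := Sm_neq0.
have n0 := nuD_neq0 x0 nu0_gt0; have n1 := nuD_neq0 x0 nu1_gt0.
have e1 : csin (rc pi * exponent lam) ^+ 2 = csin (rc pi * (nu lam - 2^-1)) ^+ 2.
  have -> : rc pi * (nu lam - 2^-1) = rc pi * exponent lam - rc pi.
    by rewrite /exponent; field.
  by rewrite csin_Bpi sqrrN.
have e2 : Sm ^+ 2 - csin (rc pi * exponent lam) ^+ 2 =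
   csin (rc pi * (nu lam - rc nu0)) * csin (rc pi * (rc nu1 - nu lam)).
  rewrite e1 -csin_mulDB; congr (csin _ * csin _).
    by rewrite rc_nu0; ring.
  by rewrite rc_nu1; ring.
transitivity ((Sm ^+ 2 - csin (rc pi * exponent lam) ^+ 2) / Sm ^+ 2);
  first by field.
rewrite e2 -!csincM /sincprod -(nu_sqr x0) !rmorphXn/=.
move: (csinc _) (csinc _) => A B.
by field; rewrite n0 n1 S0.
Qed.

(** The splitting of 1 - kappa^2 into two factors that are exchanged by
conjugation on the unit circle. *)
Definition beta lam : C := rc (Num.sqrt k0) * (1 - lam) * (rc al + rc de * lam) *
  csqrt (sincprod lam).
Definition betat lam : C := rc (Num.sqrt k0) * (1 - lam^-1) *
  (rc al + rc de / lam) * csqrt (sincprod lam).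

Lemma nusq_eq1 lam : lam != 0 -> rc (nu1 ^+ 2) - nusq lam =
  (rc al + rc de * lam) * (rc al + rc de / lam).
Proof.
move=> l0; rewrite nusq_eq//; have [_ _ _ e1 e2] := al_de.
have -> : rc (nu1 ^+ 2) = rc (nu0 ^+ 2) + rc (al ^+ 2 + de ^+ 2) +
  2 * rc (al * de).
  rewrite -[2](rmorph_nat (real_complex R)) -rmorphM -!rmorphD; congr (rc _).
  by rewrite e1 e2 /nu0 /nu1; field.
rewrite -e2; move: (rc (nu0 ^+ 2)) => x.
rewrite rmorphD/= !rmorphXn/= !rmorphM/=; move: (rc al) (rc de) => a d.
by field.
Qed.

Lemma beta_prod lam : Omega lam -> beta lam * betat lam = 1 - kappa_of lam ^+ 2.
Proof.
move=> om; have [l0 x0 x1 u0] := om; have /andP[kk0 _] := k0_bounds.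
rewrite kap_prod// nusq_eq1// nusq_eq// -[in RHS](csqrtK u0).
have -> : rc k0 = rc (Num.sqrt k0) * rc (Num.sqrt k0).
  by rewrite -rmorphM -expr2 sqr_sqrtr// ltW.
rewrite /beta /betat; move: (csqrt _) (rc _) => V x; ring.
Qed.

Section UnitCircle.
Variable lam : C.
Hypothesis lam1 : cabs lam = 1.

Lemma lam_neq0 : lam != 0.
Proof. by rewrite -cabs_gt0 lam1. Qed.

Lemma conj_lam : lam^-1 = lam^*. Proof. exact: unit_inv. Qed.

(** On the unit circle 1/lam is the conjugate of lam, hence nu^2 - nu0^2 = k0 |1
- lam|^2 and nu1^2 - nu^2 = |al + de lam|^2. *)
Lemma nusq_unit : exists2 x : R, nusq lam = rc x & nu0 ^+ 2 <= x <= nu1 ^+ 2.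
Proof.
have /andP[kk0 _] := k0_bounds.
exists (nu0 ^+ 2 + k0 * cabs (1 - lam) ^+ 2).
  rewrite nusq_eq ?lam_neq0// conj_lam.
  have -> : (1 - lam) * (1 - lam^*) = rc (cabs (1 - lam) ^+ 2).
    by rewrite -mul_conj cjB1.
  by rewrite rcD (rcM k0).
have h : rc (nu1 ^+ 2 - (nu0 ^+ 2 + k0 * cabs (1 - lam) ^+ 2)) =
    rc (cabs (rc al + rc de * lam) ^+ 2).
  rewrite -mul_conj cjD (cjM (rc de)) !conj_rc -conj_lam -nusq_eq1 ?lam_neq0//.
  rewrite nusq_eq ?lam_neq0// conj_lam rcB rcD (rcM k0); congr (_ - (_ + _ * _)).
  by rewrite -mul_conj cjB1.
move/complexI: h => h.
have := sqr_ge0 (cabs (rc al + rc de * lam)); rewrite -h => h2.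
have : 0 <= k0 * cabs (1 - lam) ^+ 2 by rewrite mulr_ge0 ?sqr_ge0 ?ltW.
by move=> ?; apply/andP; split; lra.
Qed.

Lemma nu_unit : exists2 y : R, nu lam = rc y & nu0 <= y <= nu1.
Proof.
have [x xE /andP[x0 x1]] := nusq_unit; exists (Num.sqrt x).
  have n0 := nu0_gt0; rewrite /nu xE csqrtR//.
  by rewrite (lt_le_trans _ x0)// exprn_gt0.
have n0 := nu0_gt0; have n1 := nu1_gt0.
by rewrite -(ger0_norm (ltW n0)) -(ger0_norm (ltW n1)) -!sqrtr_sqr !ler_wsqrtr.
Qed.

Lemma kappa_unit : exists x : R, kappa_of lam = rc x.
Proof.
have [y yE _] := nu_unit; exists (sin (pi * (2^-1 + y)) / sin (pi * mR)).
rewrite /kappa_of kap_sin Sm_rc /exponent yE.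
have -> : rc pi * (2^-1 + rc y) = rc (pi * (2^-1 + y)).
  by rewrite (rcM pi) (rcD 2^-1) (rcV 2) (rc_nat R 2).
by rewrite csinR (rcM (sin _)) rcV.
Qed.

(** Both arguments of sinc lie between 0 and 2 pi / n, which is less than pi. *)
Lemma sincprod_unit : exists2 u : R, 0 < u & sincprod lam = rc u.
Proof.
have [y yE /andP[y0 y1]] := nu_unit; have p0 := pi_gt0 R.
have /andP[m0 m1] := mR_bounds; have n0 := nu0_gt0; have n1 := nu1_gt0.
have m23 : 2 * mR < 1 by lra.
have b (t : R) : 0 <= t <= 2 * mR -> 0 <= pi * t < pi.
  by move=> /andP[t0 t1]; rewrite mulr_ge0 ?(ltW p0)//= gtr_pMr//; lra.
have [|c1 c10 e1] := @csincR R (pi * (y - nu0)).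
  by apply: b; rewrite /nu1 /nu0 in y0 y1 *; apply/andP; split; lra.
have [|c2 c20 e2] := @csincR R (pi * (nu1 - y)).
  by apply: b; rewrite /nu1 /nu0 in y0 y1 *; apply/andP; split; lra.
have s0 := sin_m_gt0.
exists (pi ^+ 2 * c1 * c2 / ((y + nu0) * (y + nu1) * sin (pi * mR) ^+ 2)).
  by rewrite !(divr_gt0, mulr_gt0, exprn_gt0)//; lra.
rewrite /sincprod yE Sm_rc -!rcB -!rcM e1 e2 -!rcD -!rcX -!rcM.
by rewrite -rcV -rcM.
Qed.

Lemma Omega_unit : Omega lam.
Proof.
have [x xE /andP[x0 x1]] := nusq_unit; have [u u0 uE] := sincprod_unit.
have n0 := nu0_gt0; have n1 := nu1_gt0; have /andP[m0 m1] := mR_bounds.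
split; rewrite ?lam_neq0 ?xE ?uE ?Re_rc//.
  by rewrite (lt_le_trans _ x0)// exprn_gt0.
rewrite (le_lt_trans x1)// exprn_ilt1// ?ltW//.
by rewrite /nu1; lra.
Qed.

Lemma beta_unit : betat lam = (beta lam)^*.
Proof.
have [u u0 uE] := sincprod_unit.
rewrite /betat /beta uE csqrtR// conj_lam.
rewrite (cjM (_ * _ * _)) (cjM (rc _ * _)) (cjM (rc _)) cjB1 cjD (cjM (rc de)).
by rewrite !conj_rc.
Qed.

End UnitCircle.

Lemma hol_nusq lam : lam != 0 -> hol nusq lam.
Proof.
move=> l0; rewrite /nusq /mu_of /v.
have h1 : hol (fun l : C => 1 - l) lam by apply: holB; [exact: holc|exact: holid].
apply: holD; first exact: holc.
apply: holM; last exact: (holV l0 (holid lam)).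
apply: holD; last by apply: holM; [exact: holc|exact: holid].
by apply: holM; [exact: holc|exact: (holX 2 h1)].
Qed.

Lemma hol_mu lam : lam != 0 -> hol mu_of lam.
Proof.
move=> l0; have := holB (hol_nusq l0) (holc 4^-1 lam).
have -> : (fun l => nusq l - 4^-1) = mu_of; last by [].
by apply/funext => l; rewrite /nusq addrAC subrr add0r.
Qed.

Lemma hol_nu lam : lam != 0 -> 0 < complex.Re (nusq lam) -> hol nu lam.
Proof. by move=> l0 x0; apply: hol_csqrt => //; exact: hol_nusq. Qed.

Lemma hol_sincprod lam : lam != 0 -> 0 < complex.Re (nusq lam) ->
  hol sincprod lam.
Proof.
move=> l0 x0; have hn := hol_nu l0 x0.
have g1 : hol (fun l => rc pi * (nu l - rc nu0)) lam.
  by apply: holM; [exact: holc|apply: holB => //; exact: holc].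
have g2 : hol (fun l => rc pi * (rc nu1 - nu l)) lam.
  by apply: holM; [exact: holc|apply: holB => //; exact: holc].
have g3 : hol (fun l => (nu l + rc nu0) * (nu l + rc nu1) * Sm ^+ 2) lam.
  apply: holM; last exact: holc.
  by apply: holM; apply: holD => //; exact: holc.
apply: holM.
  apply: holM; last exact: (hol_comp g2 (hol_csinc _)).
  apply: holM; first exact: holc.
  exact: (hol_comp g1 (hol_csinc _)).
apply: (holV _ g3).
have n0 := nuD_neq0 x0 nu0_gt0; have n1 := nuD_neq0 x0 nu1_gt0.
exact: (mulf_neq0 (mulf_neq0 n0 n1) (expf_neq0 2 Sm_neq0)).
Qed.

Lemma hol_kappa lam : Omega lam -> hol kappa_of lam.
Proof.
move=> [l0 x0 _ _]; have hn := hol_nu l0 x0.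
have hs : hol exponent lam by apply: holD => //; exact: holc.
have g : hol (fun l => ii * rc pi * exponent l) lam by apply: holM => //;
  exact: holc.
apply: holM; last exact: holc.
apply: holB; first exact: (hol_comp g (hol_cexp _)).
exact: (hol_comp (holN g) (hol_cexp _)).
Qed.

Lemma hol_beta lam : Omega lam -> hol beta lam.
Proof.
move=> [l0 x0 _ u0]; have hu := hol_csqrt (hol_sincprod l0 x0) u0.
apply: holM => //; apply: holM.
  by apply: holM; [exact: holc|apply: holB; [exact: holc|exact: holid]].
apply: holD; first exact: holc.
by apply: holM; [exact: holc|exact: holid].
Qed.

Lemma hol_betat lam : Omega lam -> hol betat lam.
Proof.
move=> [l0 x0 _ u0]; have hu := hol_csqrt (hol_sincprod l0 x0) u0.
have hV := holV l0 (holid lam).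
apply: holM => //; apply: holM.
  by apply: holM; [exact: holc|apply: holB => //; exact: holc].
apply: holD; first exact: holc.
by apply: holM => //; exact: holc.
Qed.

Lemma Omega_open lam : Omega lam -> \forall l \near lam, Omega l.
Proof.
move=> [l0 x0 x1 u0]; have hX := hol_nusq l0; have hU := hol_sincprod l0 x0.
have n1 := near_neq0 (holid lam) l0; have n2 := near_Re_gt hX x0.
have n3 := near_Re_lt hX x1; have n4 := near_Re_gt hU u0.
by near=> l; split; near: l.
Unshelve. all: by end_near. Qed.

End Spectral.

(** * The gauge *)

Section Gauge.
Variables (R : realType) (k : nat) (w : R).
Hypothesis k_gt0 : (0 < k)%N.
Local Notation n := k.+2.
Hypothesis hw : - (8 * n%:R) / (n%:R - 2) ^+ 2 <= w < 0.
Local Notation C := (CC R).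
Implicit Types (lam z : C) (F N G : C -> 'M[C]_2).
Local Notation m := ((n%:R : C)^-1).
Local Notation rc t := (t%:C)%C.
Local Notation ii := ('i%C : C).
Local Notation ipi := (ii * rc pi).
Local Notation zeta2n := (zeta2n R k).
Local Notation conn_mx := (@conn_mx R k).
Local Notation Omega := (@Omega R k w).
Local Notation mu_of := (@mu_of R k w).
Local Notation kappa_of := (@kappa_of R k w).
Local Notation exponent := (@exponent R k w).
Local Notation beta := (@beta R k w).
Local Notation betat := (@betat R k w).
Local Notation disc0 := (@disc0 R k). Local Notation fund0 := (@fund0 R k).
Local Notation Rpos := (@Rpos R k). Local Notation tau := (@tau R k).
Local Notation fund1 := (@fund1 R k).

(** The gauge exists where beta and betat do not vanish. This excludes lam = 1. *)
Definition Lambda lam := [/\ Omega lam, beta lam != 0 & betat lam != 0].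
(** The connection matrix after the gauge transformation. *)
Definition gauged_conn lam :=
  mx2 (- (zeta2n * kappa_of lam)) (beta lam) (betat lam) (kappa_of lam / zeta2n).
Definition chi lam := beta lam / conn_mx (mu_of lam) 0 1.
(** The gauge is diagonal, hence it commutes with the rotations. *)
Definition gauge lam := mx2 (chi lam) 0 0 1.

Lemma Lambda_open lam : Lambda lam -> \forall l \near lam, Lambda l.
Proof.
move=> [om b0 b1]; have h1 := Omega_open k_gt0 om.
have h2 := near_neq0 (hol_beta k_gt0 om) b0.
have h3 := near_neq0 (hol_betat k_gt0 om) b1.
by near=> l; split; near: l.
Unshelve. all: by end_near. Qed.

Lemma zeta2n_neq0 : zeta2n != 0. Proof. exact: cexp_neq0. Qed.

Lemma conn_mx_off lam : Omega lam ->
  conn_mx (mu_of lam) 0 1 * conn_mx (mu_of lam) 1 0 = beta lam * betat lam.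
Proof.
move=> om; rewrite (beta_prod k_gt0 hw om).
have H := conn_mx_det k (mu_of lam); rewrite [conn_mx _]mx2E mx2_det in H.
have [e1 e2] := conn_mx_entries k (nonres_exponent om).
have z0 := zeta2n_neq0.
rewrite e1 e2 -/(kappa_of lam) in H.
have -> : conn_mx (mu_of lam) 0 1 * conn_mx (mu_of lam) 1 0 =
  - (zeta2n * kappa_of lam) * (kappa_of lam / zeta2n) - (-1) by rewrite -H; ring.
by field.
Qed.

Lemma B01_neq0 lam : Lambda lam -> conn_mx (mu_of lam) 0 1 != 0.
Proof.
move=> [om b0 b1]; have : conn_mx (mu_of lam) 0 1 * conn_mx (mu_of lam) 1 0 != 0.
  by rewrite (conn_mx_off om) mulf_neq0.
by apply: contraNneq => ->; rewrite mul0r.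
Qed.

Lemma chi_neq0 lam : Lambda lam -> chi lam != 0.
Proof. by move=> L; have [_ b0 _] := L; rewrite mulf_neq0// invr_eq0 B01_neq0.
  Qed.

Lemma gauge_unit lam : Lambda lam -> gauge lam \in unitmx.
Proof. by move=> L; rewrite mx2_unit mulr1 mulr0 subr0 chi_neq0. Qed.

(** Both matrices have the same diagonal, and the products of their off-diagonal
entries are equal. *)
Lemma gauge_conn lam : Lambda lam -> gauge lam *m conn_mx (mu_of lam) =
  gauged_conn lam *m gauge lam.
Proof.
move=> L; have [om b0 _] := L; have B0 := B01_neq0 L.
have [e1 e2] := conn_mx_entries k (nonres_exponent om).
have e3 := conn_mx_off om.
rewrite [conn_mx _]mx2E !mx2_mul e1 e2 -/(kappa_of lam).
congr mx2.
- by ring.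
- by rewrite mul0r addr0 mulr0 mulr1 add0r divfK.
- rewrite mul0r add0r mul1r mulr0 addr0 /chi mulrCA -[LHS](mulKf B0) e3.
  by ring.
- by ring.
Qed.

Lemma zeta2nV : zeta2n^-1 = zeta2n^*.
Proof.
apply: unit_inv; rewrite cabs_cexp; have -> : m * ipi = ii * rc (n%:R^-1 * pi).
  by rewrite rcM rcV rc_nat; ring.
by rewrite Re_Mi Im_rc oppr0 expR0.
Qed.

Lemma mx2_unitary (a b c d : C) : a * a^* + b * b^* = 1 -> c * c^* + d * d^* =
  1 ->
  a * c^* + b * d^* = 0 -> mx2 a b c d \is unitarymx.
Proof.
move=> h1 h2 h3; apply/unitarymxP.
have -> : map_mx Num.conj (mx2 a b c d)^T = mx2 a^* c^* b^* d^*.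
  by rewrite [LHS]mx2E !mxE.
have h4 : c * a^* + d * b^* = 0.
  have : (a * c^* + b * d^*)^* = 0 by rewrite h3 rmorph0.
  rewrite cjD (cjM a) (cjM b) !conjCK => <-.
  by rewrite [_ * c]mulrC [_ * d]mulrC.
by rewrite mx2_mul h1 h2 h3 h4 mx2_1.
Qed.

Lemma cjN (a : C) : (- a)^* = - a^*. Proof. exact: rmorphN. Qed.

Lemma gauged_conn_unitary lam : cabs lam = 1 -> gauged_conn lam \is unitarymx.
Proof.
move=> l1; have om := Omega_unit k_gt0 hw l1; have bE := beta_unit k_gt0 hw l1.
have bp := beta_prod k_gt0 hw om; have [x xE] := kappa_unit k_gt0 hw l1.
have cx : (kappa_of lam)^* = kappa_of lam by rewrite xE conj_rc.
have z0 := zeta2n_neq0; have zc : zeta2n^* = zeta2n^-1 by rewrite zeta2nV.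
have zVc : (zeta2n^-1)^* = zeta2n by rewrite zeta2nV conjCK.
have bb : (betat lam)^* = beta lam by rewrite bE conjCK.
have N1 : (- (zeta2n * kappa_of lam))^* =
  - (zeta2n^-1 * kappa_of lam) by rewrite cjN cjM zc cx.
have N2 : (kappa_of lam / zeta2n)^* = kappa_of lam * zeta2n by rewrite cjM cx zVc.
apply: mx2_unitary.
- by rewrite N1 -bE bp; field.
- by rewrite N2 bb mulrC bp; field.
- by rewrite N2 bb; field.
Qed.

Lemma gauged_conn_det lam : Omega lam -> \det (gauged_conn lam) = -1.
Proof.
by move=> om; rewrite mx2_det (beta_prod k_gt0 hw om); have :=
  zeta2n_neq0 => z0; field.
Qed.

(** The matrices that become unitary after the gauge transformation. The
transformed matrix G is required to be holomorphic on all of Omega, where the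
gauge itself may be singular; its determinant is required to be constant so that
inverses stay in the group. *)
Definition gauge_group N := exists G, exists2 c : C, c != 0 &
  [/\ forall lam, Omega lam -> forall i j, hol (fun l => G l i j) lam,
      forall lam, Lambda lam -> gauge lam *m N lam = G lam *m gauge lam,
      forall lam, cabs lam = 1 -> G lam \is unitarymx &
      forall lam, Omega lam -> \det (G lam) = c].

Lemma gauge_group_conn : gauge_group (fun lam => conn_mx (mu_of lam)).
Proof.
exists gauged_conn; exists (-1); first by rewrite oppr_eq0 oner_eq0.
split; [|exact: gauge_conn|exact: gauged_conn_unitary|exact: gauged_conn_det].
move=> lam om i j.
have hk := hol_kappa om.
rewrite /gauged_conn /mx2; under eq_fun do rewrite !mxE.
case: (i == 0); case: (j == 0).
- by apply: holN; apply: holM => //; exact: holc.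
- exact: hol_beta.
- exact: hol_betat.
- by apply: holM => //; exact: holc.
Qed.

Lemma gauge_groupM N1 N2 : gauge_group N1 -> gauge_group N2 ->
  gauge_group (fun lam => N1 lam *m N2 lam).
Proof.
move=> [G1 [c1 c10 [h1 g1 u1 d1]]] [G2 [c2 c20 [h2 g2 u2 d2]]].
exists (fun lam => G1 lam *m G2 lam); exists (c1 * c2); first exact: mulf_neq0.
split.
- move=> lam om i j; under eq_fun do rewrite !mxE !big_ord_recl big_ord0 addr0.
  by apply: holD; apply: holM; [exact: h1|exact: h2|exact: h1|exact: h2].
- by move=> lam L; rewrite mulmxA g1// -!mulmxA g2.
- by move=> lam l1; rewrite mul_unitarymx ?u1 ?u2.
- by move=> lam om; rewrite det_mulmx d1 ?d2.
Qed.

Lemma mx2_inv (M : 'M[C]_2) : \det M != 0 ->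
  invmx M = (\det M)^-1 *: mx2 (M 1 1) (- M 0 1) (- M 1 0) (M 0 0).
Proof.
move=> d0; have Mu : M \in unitmx by rewrite unitmxE unitfE.
apply: (can_inj (mulKmx Mu)); rewrite mulmxV// -scalemxAr [X in X *m _]mx2E.
rewrite (mx2_adj (e := \det M)); last by rewrite [in RHS](mx2E M) mx2_det.
by rewrite scalerA mulVf// scale1r.
Qed.

Lemma gauge_group_unit N : gauge_group N -> forall lam, Lambda lam ->
  N lam \in unitmx.
Proof.
move=> [G [c c0 [_ g _ d]]] lam L; have [om _ _] := L.
have /(congr1 (fun M => \det M)) := g _ L; rewrite !det_mulmx d// mulrC.
have : \det (gauge lam) != 0 by have := gauge_unit L; rewrite unitmxE unitfE.
move=> h0 /(mulIf h0) E; by rewrite unitmxE unitfE E.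
Qed.

Lemma gauge_groupV N : gauge_group N -> gauge_group (fun lam => invmx (N lam)).
Proof.
move=> gN; have Nu := gauge_group_unit gN; move: gN => [G [c c0 [h g u d]]].
exists (fun lam => invmx (G lam)); exists c^-1; first by rewrite invr_eq0.
have Gu lam : Omega lam -> G lam \in unitmx by move=> om;
  rewrite unitmxE unitfE d.
split.
- move=> lam om i j.
  have := Omega_open k_gt0 om => /filterS near_.
  pose f l := c^-1 * mx2 (G l 1 1) (- G l 0 1) (- G l 1 0) (G l 0 0) i j.
  apply: (@hol_near _ f).
    by apply: near_ => l ol; rewrite mx2_inv d// /f !mxE.
  rewrite /f /mx2; under eq_fun do rewrite !mxE.
  apply: holM; first exact: holc.
  by case: (i == 0); case: (j == 0); try exact: h; apply: holN; exact: h.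
- move=> lam L; have [om _ _] := L.
  apply: (can_inj (mulKmx (Gu _ om))).
  by rewrite mulKVmx ?Gu// mulmxA -g// mulmxK// Nu.
- by move=> lam l1; rewrite invmx_unitary ?u// trmxC_unitary u.
- by move=> lam om; rewrite det_inv d.
Qed.

Lemma gauge_group_diag a d : cabs a = 1 -> cabs d = 1 ->
  gauge_group (fun=> mx2 a 0 0 d).
Proof.
move=> a1 d1; exists (fun=> mx2 a 0 0 d); exists (a * d).
  by rewrite -cabs_gt0 cabsM a1 d1 mulr1.
split.
- by move=> *; exact: holc.
- by move=> lam _; rewrite !mx2_mul; congr mx2; ring.
- by move=> lam _; apply: mx2_unitary;
    rewrite ?rmorph0 ?mul0r ?mulr0 ?addr0 ?add0r ?mul_conj ?a1 ?d1 ?expr1n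
      ?rmorph1.
- by move=> lam _; rewrite mx2_det mul0r subr0.
Qed.

Lemma root_unit (om : C) : om ^+ n = 1 -> cabs om = 1.
Proof.
move=> /(congr1 (@cabs R)); rewrite cabsX cabs1 => /eqP.
by rewrite pexpr_eq1// ?cabs_ge0// => /eqP.
Qed.

(** Equality of frames up to a left factor in the gauge group. *)
Definition frame_equiv F1 F2 := exists2 N, gauge_group N &
  forall lam, Lambda lam -> F1 lam = N lam *m F2 lam.

Lemma frame_equiv_sym F1 F2 : frame_equiv F1 F2 -> frame_equiv F2 F1.
Proof.
move=> [N gN E]; exists (fun lam => invmx (N lam)); first exact: gauge_groupV.
by move=> lam L; rewrite E// mulKmx// (gauge_group_unit gN).
Qed.

Lemma frame_equiv_trans F1 F2 F3 : frame_equiv F1 F2 -> frame_equiv F2 F3 ->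
  frame_equiv F1 F3.
Proof.
move=> [N1 g1 E1] [N2 g2 E2]; exists (fun lam => N1 lam *m N2 lam).
  exact: gauge_groupM.
by move=> lam L; rewrite E1// E2// mulmxA.
Qed.

Lemma frame_equiv_ext F1 F2 : (forall lam, Lambda lam -> F1 lam = F2 lam) ->
  frame_equiv F1 F2.
Proof.
move=> E; exists (fun=> mx2 1 0 0 1); first by apply: gauge_group_diag;
  rewrite cabs1.
by move=> lam L; rewrite E// -mx2_1 mul1mx.
Qed.

Lemma frame_equiv_step l z :
  frame_equiv (fun lam => fund1 (exponent lam) (mu_of lam) (l - ipi) z)
  (fun lam => fund1 (exponent lam) (mu_of lam) l z).
Proof.
exists (fun lam => conn_mx (mu_of lam)); first exact: gauge_group_conn.
by move=> lam [om _ _]; exact: (fund1_step k (nonres_exponent om)).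
Qed.

Lemma frame_equiv_shift l z (p : int) :
  frame_equiv (fun lam => fund1 (exponent lam) (mu_of lam) (l + ipi * p%:~R) z)
    (fun lam => fund1 (exponent lam) (mu_of lam) l z).
Proof.
have up l' : frame_equiv (fun lam => fund1 (exponent lam) (mu_of lam) (l' +
  ipi) z)
    (fun lam => fund1 (exponent lam) (mu_of lam) l' z).
  by apply: frame_equiv_sym; have := frame_equiv_step (l' + ipi) z; rewrite addrK.
have nat_ (j : nat) l' : frame_equiv (fun lam => fund1 (exponent lam) (mu_of
  lam) (l' + ipi * j%:R) z)
    (fun lam => fund1 (exponent lam) (mu_of lam) l' z).
  elim: j => [|j IH]; first by rewrite mulr0 addr0; exact: frame_equiv_ext.
  apply: frame_equiv_trans IH; have := up (l' + ipi * j%:R).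
  by have -> : l' + ipi * j%:R + ipi = l' + ipi * j.+1%:R by rewrite -natr1; ring.
case: p => j; first exact: nat_.
apply: frame_equiv_sym; have := nat_ j.+1 (l - ipi * j.+1%:R); rewrite subrK.
by rewrite NegzE mulrNz mulrN.
Qed.

(** The frames at hand over z: the one at 0, or the one at the roots of unity
for any logarithm of tau. Their domains cover the plane minus the roots of
unity. *)
Definition frame z F :=
  (disc0 z /\ forall lam, Lambda lam -> F lam = fund0 (mu_of lam) z) \/
  (Rpos z /\ exists2 l, cexp l = tau z &
    forall lam, Lambda lam -> F lam = fund1 (exponent lam) (mu_of lam) l z).

Lemma frame_equiv_01 z l : disc0 z -> Rpos z -> cexp l = tau z ->
  frame_equiv (fun lam => fund0 (mu_of lam) z) (fun lam => fund1 (exponent lam)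
    (mu_of lam) l z).
Proof.
move=> d0 zp lE; have [om o1 [p E]] := fund0_fund1 d0 zp lE; have o2 :=
  root_unit o1.
apply: frame_equiv_trans (frame_equiv_shift l z p).
exists (fun=> mx2 om 0 0 1); first by apply: gauge_group_diag; rewrite ?cabs1.
by move=> lam [omm _ _]; apply: E; exact: nonres_exponent.
Qed.

(** The frames differ by rotations and by half turns, that is, by diagonal
matrices and powers of the connection matrix. *)
Lemma frame_unique z F1 F2 : frame z F1 -> frame z F2 -> frame_equiv F1 F2.
Proof.
have T F1' F2' : (forall lam, Lambda lam -> F1 lam = F1' lam) ->
    (forall lam, Lambda lam -> F2 lam = F2' lam) -> frame_equiv F1' F2' ->
      frame_equiv F1 F2.
  move=> E1 E2 e; apply: (frame_equiv_trans (frame_equiv_ext E1));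
    apply: (frame_equiv_trans e).
  by apply: frame_equiv_sym; exact: frame_equiv_ext.
move=> [[d1 E1]|[d1 [l1 e1 E1]]] [[d2 E2]|[d2 [l2 e2 E2]]]; apply: (T _ _ E1 E2).
- exact: frame_equiv_ext.
- exact: frame_equiv_01.
- by apply: frame_equiv_sym; exact: frame_equiv_01.
- have [p ->] : exists p : int, l1 = l2 + ipi * (2 * p)%:~R.
    have /cexp_eq[p pE] : cexp l1 = cexp l2 by rewrite e1 e2.
    by exists p; rewrite pE intrM; ring.
  exact: frame_equiv_shift.
Qed.

End Gauge.

(** * Choice of the radius *)

Section MatrixDerivative.
Variable R : realType.
Local Notation C := (CC R).
Implicit Types (z : C) (F : C -> 'M[C]_2).

Lemma hol_mx F z : (forall i j, hol (fun l => F l i j) z) -> derivable F z 1.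
Proof.
move=> H; pose h (i : 'I_2) := \sum_(j < 2) (fun l :
  C => F l i j *: delta_mx i j : 'M[C]_2).
have -> : F = \sum_(i < 2) h i.
  apply/funext => l; rewrite fct_sumE [LHS]matrix_sum_delta.
  by apply: eq_bigr => i _; rewrite /h fct_sumE.
apply: derivable_sum => i; apply: derivable_sum => j.
apply/derivable1_diffP/differentiableZl/derivable1_diffP.
by have [d []] := H i j.
Qed.

Lemma mx_cder F z D i j : is_derive (z : C) 1 F D ->
  cder (fun l => F l i j) z (D i j).
Proof.
move=> [df <-].
have cv : (fun h : C => (h^-1 *: ((F \o shift z) (h *: (1 : C)) - F z)) i j) @ 0^'
    --> ('D_1 F z) i j.
  exact: (cvg_comp _ _ (df : _ @ _ --> _) (@coord_continuous C 2 2 i j ('D_1 F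
    z))).
have E : (fun h : C => (h^-1 *: ((F \o shift z) (h *: (1 : C)) - F z)) i j) =
   (fun h : C => h^-1 *: (((fun l => F l i j) \o shift z) (h *: (1 :
     C)) - F z i j)).
  by apply/funext => h; rewrite !mxE.
rewrite E in cv.
apply: DeriveDef; last exact: cvg_lim.
by apply/cvg_ex; eexists; exact: cv.
Qed.

End MatrixDerivative.

Section Annulus.
Variables (R : realType) (k : nat) (w : R).
Hypothesis k_gt0 : (0 < k)%N.
Local Notation n := k.+2.
Hypothesis hw : - (8 * n%:R) / (n%:R - 2) ^+ 2 <= w < 0.
Local Notation C := (CC R).
Implicit Types (lam z : C).
Local Notation rc t := (t%:C)%C.
Local Notation ii := ('i%C : C).
Local Notation Omega := (@Omega R k w).
Local Notation Lambda := (@Lambda R k w).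

Lemma polar lam : lam != 0 ->
  exists2 t : R, 0 <= t <= 2 * pi & lam = rc (cabs lam) * cexp (ii * rc t).
Proof.
move=> /clog_exists[u <-]; have p0 : 0 < 2 * (pi : R) by rewrite mulr_gt0 ?pi_gt0.
pose j := Num.floor (complex.Im u / (2 * pi)).
exists (complex.Im u - 2 * pi * j%:~R).
  have /andP[h1 h2] := floor_itv (complex.Im u / (2 * pi)).
  move: h1 h2; rewrite -/j ler_pdivlMr// ltr_pdivrMr// intrD1 => h1 h2.
  by apply/andP; split; lra.
rewrite cabs_cexp -cexpR -cexpD.
have uE : u = rc (complex.Re u) + ii * rc (complex.Im u)
    by exact: cE.
have -> : rc (complex.Re u) + ii * rc (complex.Im u - 2 * pi * j%:~R) =
    u + 2 * rc pi * ii * (- j)%:~R.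
  by rewrite {3}uE rcB !rcM rc_nat mulrNz [rc j%:~R]rmorph_int; ring.
rewrite cexpD.
have -> : cexp (2 * rc pi * ii * (- j)%:~R) = 1; last by rewrite mulr1.
have nat_ (q : nat) : cexp (2 * rc pi * ii * q%:R) = 1.
  have -> : 2 * rc pi * ii * q%:R = (2 * q)%:R * (ii * rc pi) by rewrite natrM;
    ring.
  by rewrite cexpX cexp_ipi exprM sqrrN !expr1n.
case: (- j) => q; first exact: nat_.
by rewrite NegzE mulrNz mulrN cexpN nat_ invr1.
Qed.

(** The unit circle is compact and Omega is open; the circle is parametrised by
the angle. *)
Lemma Omega_annulus : exists2 d : R, 0 < d &
  forall lam, `|cabs lam - 1| < d -> lam != 0 -> Omega lam.
Proof.
pose P (rho t : R) := Omega (rc rho * cexp (ii * rc t)).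
have /compact_near_coveringP/(_ _ (nbhs (1 : R)) P) :=
  @segment_compact R 0 (2 * pi).
move=> [].
  move=> t _.
  have u1 : cabs (cexp (ii * rc t)) = 1.
    by rewrite cabs_cexp Re_Mi Im_rc oppr0 expR0.
  have /nbhsCP[e e0 He] := Omega_open k_gt0 (Omega_unit k_gt0 hw u1).
  have e2 : 0 < e / 2 by rewrite divr_gt0.
  have [r r0 Hr] := hol_eps (hol_cexp (ii * rc t)) e2.
  have r1 : nbhs t [set s : R | `|s - t| < r].
    by apply/nbhs_ballP; exists r => //= s; rewrite /ball/= distrC.
  have r2 : nbhs (1 : R) [set s : R | `|s - 1| < e / 2].
    by apply/nbhs_ballP; exists (e / 2) => //= s; rewrite /ball/= distrC.
  exists ([set s : R | `|s - t| < r], [set s : R | `|s - 1| < e / 2]) => //.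
  move=> [s rho] /= [s1 s2]; apply: He.
  have -> : rc rho * cexp (ii * rc s) - cexp (ii * rc t) =
    rc (rho - 1) * cexp (ii * rc s) + (cexp (ii * rc s) - cexp (ii * rc t)).
    by rewrite rcB rmorph1; ring.
  apply: (le_lt_trans (cabsD _ _)); rewrite [e]splitr ltrD//.
    by rewrite cabsM cabsR cabs_cexp Re_Mi Im_rc oppr0 expR0 mulr1.
  apply: Hr; rewrite -mulrBr -rcB cabsM cabsR.
  by have -> : cabs ii = 1; [exact: cabs_i|rewrite mul1r].
move=> d /= d0 Hd; exists d => // lam l1 l0.
have [t t0 ->] := polar l0.
apply: (Hd (cabs lam)); first by rewrite /ball_/= distrC.
by rewrite /= in_itv/=.
Qed.

(** beta and betat vanish only at lam = 1 and where |lam| is al / de or de / al;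
as de <= al, only the last value can be less than 1. *)
Lemma Lambda_circle lam (r : R) : cabs lam = r -> 0 < r < 1 ->
  r != de k w / al k w ->
  Omega lam -> Lambda lam.
Proof.
move=> lr /andP[r0 r1] rd om; have [l0 _ _ u0] := om.
have [a0 d0 da _ _] := al_de k_gt0 hw; have /andP[kk0 _] := k0_bounds k_gt0 hw.
have V0 : csqrt (sincprod k w lam) != 0 by apply: Re_neq0; exact: Re_csqrt.
have K0 : rc (Num.sqrt (k0 k w)) != 0 by rewrite rc_eq0 gt_eqF// sqrtr_gt0.
have l1 : 1 - lam != 0.
  by rewrite subr_eq0; apply: contraTneq r1 => E; rewrite -lr -E cabs1 ltxx.
have lV1 : 1 - lam^-1 != 0.
  rewrite subr_eq0; apply: contraTneq r1 => E.
  by rewrite -lr -[lam]invrK -E invr1 cabs1 ltxx.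
have ca : cabs (rc (al k w)) = al k w by rewrite cabsR ger0_norm// ltW.
have cd : cabs (rc (de k w)) = de k w by rewrite cabsR ger0_norm.
have h1 : rc (al k w) + rc (de k w) * lam != 0.
  rewrite addr_eq0; apply/eqP => /(congr1 (@cabs R)).
  by rewrite cabsN cabsM ca cd lr => E; nra.
have h2 : rc (al k w) + rc (de k w) / lam != 0.
  rewrite addr_eq0; apply: contra rd => /eqP/(congr1 (@cabs R)).
  rewrite cabsN cabsM cabsV ca cd lr => E.
  have d1 : de k w = al k w * r by rewrite E divfK// gt_eqF.
  by rewrite d1 mulrC mulKf// gt_eqF.
split=> //.
  exact: (mulf_neq0 (mulf_neq0 (mulf_neq0 K0 l1) h1) V0).
exact: (mulf_neq0 (mulf_neq0 (mulf_neq0 K0 lV1) h2) V0).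
Qed.

Lemma radius_exists : exists r : R, [/\ 0 < r < 1,
  forall lam, r <= cabs lam <= r^-1 -> Omega lam &
  forall lam, cabs lam = r -> Lambda lam].
Proof.
have [d d0 Hd] := Omega_annulus.
pose e := Num.min d 1 / 2.
have e0 : 0 < e by rewrite divr_gt0// lt_min d0 ltr01.
have e1 : e <= 1 / 2 by rewrite ler_pM2r// ge_min lexx orbT.
have ed : e <= d / 2 by rewrite ler_pM2r// ge_min lexx.
(* At least one of the radii 1 - e / 2 and 1 - e / 3 differs from de / al. *)
have [r [r0 r1 rd]] : exists r : R, [/\ 1 - e / 2 <= r, r <= 1 - e / 3 &
    r != de k w / al k w].
  have [E|NE] := eqVneq (1 - e / 2) (de k w / al k w).
    by exists (1 - e / 3); rewrite -E; split; [lra|lra|apply/eqP; lra].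
  by exists (1 - e / 2); split=> //; lra.
have r01 : 0 < r < 1 by apply/andP; split; lra.
have rV : r^-1 < 1 + d.
  have rp : 0 < r by lra.
  by rewrite -[r^-1]mul1r ltr_pdivrMr//; nra.
have HO lam : r <= cabs lam <= r^-1 -> Omega lam.
  move=> /andP[h1 h2]; apply: Hd; last by rewrite -cabs_gt0; lra.
  by rewrite ltr_norml; apply/andP; split; lra.
exists r; split=> // lam lr; apply: (Lambda_circle lr) => //; apply: HO.
have rp : 0 < r by lra.
by rewrite lr lexx/= -[r^-1]mul1r ler_pdivlMr//; nra.
Qed.

End Annulus.

(** * Sheets of a covering of the sphere *)

Section LocallyConstant.
Variable R : realType.
Local Notation C := (CC R).

(** The indicator function of P has derivative zero. *)
Lemma loc_cst_real (P : R -> Prop) :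
  (forall t, \forall s \near t, P s <-> P t) -> forall t s, P t -> P s.
Proof.
move=> H t s; pose f t : R := if `[< P t >] then 1 else 0.
have fE : f t = f s.
  apply: is_derive_0_is_cst => x; apply: (near_eq_is_derive (f := cst (f x))).
    by apply: filterS (H x) => y Py; rewrite /f (propext Py).
move: fE; rewrite /f; case: asboolP => // Pt; case: asboolP => // _ /eqP.
by rewrite oner_eq0.
Qed.

Lemma loc_cst_convex (D : set C) (P : C -> Prop) : cconvex D ->
  (forall u, D u -> \forall v \near u, P v <-> P u) ->
  forall u v, D u -> D v -> P u -> P v.
Proof.
move=> cD H u v Du Dv; pose f t : C := if `[< P t >] then 1 else 0.
have fE : f u = f v.
  apply: (cder0_convex cD) => // x Dx; apply: (cder_near (f := cst (f x))).
    by apply: filterS (H x Dx) => y Py; rewrite /f (propext Py).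
move: fE; rewrite /f; case: asboolP => // Pt; case: asboolP => // _ /eqP.
by rewrite oner_eq0.
Qed.

(** A retraction of the line onto [0, 1], which turns a path on [0, 1] into a
map on the line. *)
Definition clamp (t : R) : R := Num.max 0 (Num.min t 1).

Lemma clamp_in t : `[0, 1]%classic (clamp t).
Proof. by rewrite /= in_itv/= /clamp le_max lexx/= ge_max ler01 ge_min lexx
  orbT. Qed.

Lemma clamp0 : clamp 0 = 0.
Proof. by rewrite /clamp (min_idPl ler01) maxxx. Qed.
Lemma clamp1 : clamp 1 = 1.
Proof. by rewrite /clamp minxx (max_idPr ler01). Qed.

Lemma clamp_cts : continuous clamp.
Proof.
move=> t A /nbhs_ballP[e e0 He]; apply/nbhs_ballP; exists e => // s /=.
rewrite /ball/= => st; apply: He; rewrite /ball/=; apply: le_lt_trans st.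
have h1 := ler_norm (t - s); have h2 := ler_norm (s - t); rewrite distrC in h2.
have h0 := normr_ge0 (t - s); rewrite ler_norml; move: h0 h1 h2;
  move: `|t - s| => N.
rewrite /clamp; case: (lerP t 1) => ?; case: (lerP s 1) => ?;
  case: (lerP 0 t) => ?;
  case: (lerP 0 s) => ?; rewrite ?(max_idPr (@ler01 R)); by move=> *;
    apply/andP; split; lra.
Qed.

Lemma path_local (E : topologicalType) (Q : E -> Prop) : path_connected R E ->
  (forall e, \forall e' \near e, Q e' <-> Q e) -> forall e1 e2, Q e1 -> Q e2.
Proof.
move=> pc H e1 e2; have [c [cc <- <-]] := pc e1 e2.
rewrite -{1}clamp0 -{1}clamp1; move: (0 : R) (1 : R).
apply: (@loc_cst_real (fun t => Q (c (clamp t)))) => t.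
have /subspace_continuousP/(_ _ (clamp_in t)) := cc => /(_ _ (H (c (clamp t)))).
move=> W; have W' : nbhs (clamp t) (fun s => `[0, 1]%classic s ->
    (Q (c s) <-> Q (c (clamp t)))) by exact: W.
have W2 : nbhs t (fun s => `[0, 1]%classic (clamp s) ->
    (Q (c (clamp s)) <-> Q (c (clamp t)))) := @clamp_cts t _ W'.
by apply: filterS W2 => s; apply; exact: clamp_in.
Qed.

Lemma compact_bound (K : set C) : compact K ->
  exists M : R, forall z, K z -> cabs z < M.
Proof.
move=> /compact_near_coveringP/(_ _ (pinfty_nbhs R) (fun M z => cabs z < M)).
move=> [].
  move=> z _; exists ([set v | cabs (v - z) < 1], [set M : R | cabs z + 1 < M]).
    split => /=; first by apply/nbhsCP; exists 1.
    by exists (cabs z + 1); split=> //; exact: num_real.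
  move=> [v M] /= [h1 h2]; apply: le_lt_trans h2.
  have -> : v = z + (v - z) by rewrite addrC subrK.
  by rewrite (le_trans (cabsD _ _))// lerD2l ltW.
move=> M [_ HM]; exists (M + 1); apply: HM; lra.
Qed.

(** Serves to show that the points of large modulus form a punctured
neighbourhood of infinity in the sphere. *)
Lemma compact_square (M : R) : exists2 K : set C, compact K /\ closed K &
  forall z, cabs z <= M -> K z.
Proof.
pose f (q : R * R) : C := (q.1%:C)%C + 'i%C * (q.2%:C)%C.
have fc : continuous f.
  move=> [a b] A /nbhsCP[e e0 He].
  have e2 : 0 < e / 2 by rewrite divr_gt0.
  exists ([set x | `|x - a| < e / 2], [set y | `|y - b| < e / 2]).
    by split; apply/nbhs_ballP; exists (e / 2) => //= s; rewrite /ball/= distrC.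
  move=> [x y] /= [h1 h2]; apply: He.
  have -> : f (x, y) - f (a, b) = ((x - a)%:C)%C + 'i%C * ((y - b)%:C)%C.
    by rewrite /f /= !rcB; ring.
  rewrite [e]splitr (le_lt_trans (cabsD _ _))// ltrD ?cabsR// cabsM cabsR.
  by have -> : cabs ('i%C : C) = 1; [exact: cabs_i|rewrite mul1r].
pose K := f @` (`[- M, M] `*` `[- M, M]).
have cK : compact K.
  apply: continuous_compact; first by apply: continuous_subspaceT.
  by apply: compact_setX; exact: segment_compact.
exists K; first by split=> //; apply: compact_closed => //; exact: norm_hausdorff.
move=> z zM; exists (complex.Re z, complex.Im z); last by rewrite /f [RHS]cE.
by split; rewrite /= in_itv/= -ler_norml (le_trans _ zM)// (Re_le_cabs,
  Im_le_cabs).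
Qed.

Lemma nbhs_None (U : set (sphere R)) : nbhs (None : sphere R) U ->
  exists M : R, forall z : C, M <= cabs z -> U (Some z).
Proof.
move=> [W [cW _] WU]; have [M HM] := compact_bound cW.
exists M => z Mz; apply: WU; left; exists z => //= /HM.
by rewrite ltNge Mz.
Qed.

End LocallyConstant.

Section Sheets.
Variables (R : realType) (E : topologicalType) (p : E -> sphere R).
Variable S : set (sphere R).
Hypothesis cov : covering_map p S.
Local Notation C := (CC R).

Lemma sheet e0 : exists (V : set E) (U : set (sphere R)) (g : sphere R -> E),
  [/\ nbhs e0 V, open U & U (p e0)] /\ [/\ U `<=` S,
    forall e, V e -> U (p e) /\ g (p e) = e,
    forall u, U u -> V (g u) /\ p (g u) = u &
    forall u, U u -> g @ u --> g u].
Proof.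
have [cp rp ev] := cov.
have Sp : S (p e0) by rewrite -rp; exists e0.
have [U [oU Up US [I [V [oV tV UV hV]]]]] := ev _ Sp.
have [i _ Vi] : (\bigcup_i V i) e0 by rewrite -UV.
have [g [g1 g2 _ cg]] := hV i.
exists (V i), U, g; split; first by split=> //; apply: open_nbhs_nbhs.
split=> // u sincprod; have /subspace_continuousP/(_ _ sincprod) := cg.
by rewrite within_interior//; apply: open_nbhs_nbhs.
Qed.

Definition section (g : C -> E) (D : set C) :=
  forall z, D z -> p (g z) = Some z /\ g @ z --> g z.

Definition cball (z0 : C) (d : R) : set C := [set z | cabs (z - z0) < d].

Lemma cball_nbhs z0 d z : cball z0 d z -> nbhs z (cball z0 d).
Proof.
rewrite /cball/= => zd; apply/nbhsCP; exists (d - cabs (z - z0));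
  first by rewrite subr_gt0.
move=> v vz; rewrite /cball/=; have -> : v - z0 =
  (v - z) + (z - z0) by rewrite addrA subrK.
by rewrite (le_lt_trans (cabsD _ _))// -ltrBrDr.
Qed.

Lemma sheet_fin e0 (z0 : C) (d0 : R) : p e0 = Some z0 -> 0 < d0 ->
  exists (d : R) (g : C -> E), [/\ 0 < d, d <= d0, section g (cball z0 d) &
    \forall e \near e0, exists2 z, cball z0 d z & e = g z].
Proof.
move=> pe d00; have [V [U [g [[nV oU Up] [US gV gU cg]]]]] := sheet e0.
rewrite pe in Up.
have /nbhsCP[d1 d10 H1] : nbhs (z0 : C) (fun z => U (Some z)).
  by have := open_nbhs_nbhs (conj oU Up).
pose d := Num.min d1 d0.
have dd : 0 < d by rewrite lt_min d10 d00.
have dU z : cball z0 d z -> U (Some z).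
  by rewrite /cball/= lt_min => /andP[h _]; exact: H1.
exists d, (g \o Some); split => //; first by rewrite ge_min lexx orbT.
  move=> z zd; have [Vg pg] := gU _ (dU _ zd); split=> //.
  by move=> A /(cg _ (dU _ zd)).
have [cp _ _] := cov.
have nB : nbhs (p e0) (Some @` cball z0 d).
  rewrite pe; apply: one_point_compactification_some_nbhs.
  by apply: cball_nbhs; rewrite /cball/= subrr cabs0.
apply: filterS2 nV (cp _ _ nB) => e Ve [z zd zE].
by exists z => //=; rewrite zE (gV _ Ve).2.
Qed.

(** Around a point over infinity, a sheet consists of this point and of the
image of a punctured neighbourhood {M < |z|} of infinity. *)
Lemma sheet_inf e0 : p e0 = None -> exists (M : R) (g : C -> E),
  [/\ 0 < M, section g [set z | M < cabs z],
    \forall e \near e0, (p e = None -> e = e0) /\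
      forall z, p e = Some z -> M < cabs z /\ e = g z &
    forall W, nbhs e0 W -> exists2 z, M < cabs z & W (g z)].
Proof.
move=> pe; have [V [U [g [[nV oU Up] [US gV gU cg]]]]] := sheet e0.
have pe' := pe; rewrite pe in Up; have [cp _ _] := cov.
have [M0 HM0] := nbhs_None (open_nbhs_nbhs (conj oU Up)).
pose M := Num.max M0 1.
have M_gt0 : 0 < M by rewrite lt_max ltr01 orbT.
have HM z : M <= cabs z -> U (Some z) by rewrite ge_max => /andP[/HM0].
have g0 : g None = e0 by rewrite -pe; apply: (gV _ _).2; exact: nbhs_singleton.
exists M, (g \o Some); split=> //.
- move=> z /= /ltW/HM Uz; have [Vg pg] := gU _ Uz; split=> //.
  by move=> A /(cg _ Uz).
- have [K [cK clK] KM] := @compact_square R M.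
  have nN : nbhs (p e0) ((Some @` ~` K) `|` [set None : sphere R]).
    by rewrite pe; exists K.
  apply: filterS2 nV (cp _ _ nN) => e Ve nK; split=> [pN|z pz].
    by rewrite -g0 -pN (gV _ Ve).2.
  have zM : M < cabs z.
    rewrite ltNge; apply/negP => /KM Kz; move: nK; rewrite /= pz.
    by move=> [[v vK [vz]]|//]; apply: vK; rewrite vz.
  by split=> //=; rewrite -pz (gV _ Ve).2.
- move=> W nW; have := cg _ Up; rewrite g0 => /(_ _ nW)/nbhs_None[M' HM'].
  pose r := Num.max (M + 1) (Num.max M' 0).
  have [r1 r2 r3] : [/\ M < r, M' <= r & 0 <= r].
    by rewrite /r !(lt_max, le_max) !lexx !orbT ltrDl ltr01.
  by exists (r%:C)%C; rewrite /= ?cabsR ?ger0_norm//; apply: HM';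
    rewrite cabsR ger0_norm.
Qed.

End Sheets.

(** * Connectedness away from infinity *)

Section Connect.
Variables (R : realType) (n : nat) (E : topologicalType) (p : E -> sphere R).
Hypothesis cov : covering_map p (Sigma R n).
Hypothesis pc : path_connected R E.
Local Notation C := (CC R).

Lemma p_neq1 e z : p e = Some z -> z ^+ n != 1.
Proof.
move=> pe; have [_ rp _] := cov; have : Sigma R n (p e) by rewrite -rp; exists e.
by rewrite pe => /eqP.
Qed.

Variable Pr : E -> Prop.
Hypothesis H : forall z0 : C, z0 ^+ n != 1 -> exists2 d0 : R, 0 < d0 &
  forall (d : R) (g : C -> E), 0 < d <= d0 -> section p g (cball z0 d) ->
  forall z1 z2, cball z0 d z1 -> cball z0 d z2 -> Pr (g z1) -> Pr (g z2).

(** A punctured neighbourhood of infinity is the image under exp of a half-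
plane, and the half-plane is convex. *)
Lemma end_cst (M : R) (g : C -> E) : 0 < M -> section p g [set z | M < cabs z] ->
  forall z1 z2, M < cabs z1 -> M < cabs z2 -> Pr (g z1) -> Pr (g z2).
Proof.
move=> M0 sg z1 z2 h1 h2; pose D : set C := [set u | ln M < complex.Re u].
have DE u : D u <-> M < cabs (cexp u).
  by rewrite /D/= cabs_cexp -[X in _ <-> X < _]lnK// ltr_expR.
have z10 : z1 != 0 by rewrite -cabs_gt0 (lt_trans M0).
have z20 : z2 != 0 by rewrite -cabs_gt0 (lt_trans M0).
have [u1 e1] := clog_exists z10; have [u2 e2] := clog_exists z20.
rewrite -e1 -e2 in h1 h2 *.
apply: (@loc_cst_convex R D (fun u => Pr (g (cexp u)))).
- exact: cconvex_Re_gt.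
- move=> u /DE Du; have [pu _] := sg _ Du.
  have [d0 d00 Hd] := H (p_neq1 pu).
  pose d := Num.min d0 (cabs (cexp u) - M).
  have dd : 0 < d <= d0 by rewrite lt_min d00 subr_gt0 Du/= ge_min lexx.
  have dp : 0 < d by case/andP: dd.
  have sd : section p g (cball (cexp u) d).
    move=> z zd; apply: sg => /=; move: zd;
      rewrite /cball/= lt_min => /andP[_ zd].
    have : cabs (cexp u) <= cabs z + cabs (z - cexp u).
      rewrite -[X in _ <= _ + X]cabsN; apply: le_trans (cabsD _ _).
      by rewrite opprB addrC subrK.
    lra.
  have [r r0 Hr] := hol_eps (hol_cexp u) dp.
  apply/nbhsCP; exists r => // v /Hr vd.
  have ud : cball (cexp u) d (cexp u) by rewrite /cball/= subrr cabs0.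
  by split; apply: (Hd _ _ dd sd).
- exact/DE.
- exact/DE.
Qed.

(** The predicate is extended to the points over infinity by Q, as a limit of
points at which it holds. Then Q is locally constant on the whole covering,
which is path-connected. *)
Lemma lift_connected e1 e2 z1 z2 : p e1 = Some z1 -> p e2 = Some z2 ->
  Pr e1 -> Pr e2.
Proof.
pose Q e := if p e is Some _ then Pr e else
  forall W, nbhs e W -> exists e', [/\ W e', p e' <> None & Pr e'].
move=> p1 p2; suff : Q e1 -> Q e2 by rewrite /Q p1 p2.
apply: (path_local pc) => {e1 e2 z1 z2 p1 p2} e.
case pe: (p e) => [z0|].
  have [d0 d00 Hd] := H (p_neq1 pe).
  have [d [g [d1 d2 sg ng]]] := sheet_fin cov pe d00.
  have dd : 0 < d <= d0 by rewrite d1.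
  have [z zd ez] := nbhs_singleton ng.
  apply: filterS ng => e' [z' zd' ->]; rewrite ez /Q.
  have [-> _] := sg _ zd; have [-> _] := sg _ zd'.
  by split; apply: (Hd _ _ dd sg).
have [M [g [M0 sg ng W]]] := sheet_inf cov pe.
have cst := end_cst M0 sg.
apply: filterS (ng) => e' [eN eS]; case pe': (p e') => [z'|]; last by rewrite eN.
have [Mz' ->] := eS _ pe'.
rewrite /Q pe; have [-> _] := sg _ Mz'.
split=> [Pz' W' nW'|Qe].
  have [z Mz Wz] := W _ nW'; exists (g z); split=> //;
    first by rewrite (sg _ Mz).1.
  exact: cst Pz'.
have [e'' [[_ eS'] pe'' Pe'']] := Qe _ ng.
case pE: (p e'') pe'' => [z''|//] _; have [Mz'' e''E] := eS' _ pE.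
by apply: (cst z'') => //; rewrite -e''E.
Qed.

End Connect.

(** * Local frames and sections *)

Section LocalFrames.
Variables (R : realType) (k : nat) (w : R).
Local Notation n := k.+2.
Local Notation C := (CC R).
Implicit Types (lam z : C).
Local Notation scalar_sol := (@scalar_sol R k).
Local Notation mu_of := (@mu_of R k w).
Local Notation exponent := (@exponent R k w).
Local Notation disc0 := (@disc0 R k). Local Notation fund0 := (@fund0 R k).
Local Notation Rpos := (@Rpos R k). Local Notation tau := (@tau R k).
Local Notation fund1 := (@fund1 R k).
Local Notation Lambda := (@Lambda R k w).
Local Notation frame := (@frame R k w).

Lemma disc0_or_Rpos z : disc0 z \/ Rpos z.
Proof.
by rewrite /disc0 /Rpos; case: (ltP (complex.Re (z ^+ n)) 2^-1) => h;
  [left|right; lra].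
Qed.

Lemma near_cball (P : C -> Prop) z0 : (\forall z \near z0, P z) ->
  exists2 d : R, 0 < d & forall z, cball z0 d z -> P z.
Proof. by move=> /nbhsCP. Qed.

Lemma scalar_sol_lin mu (a b : C) (f df g dg : C -> C) z :
  scalar_sol mu f df z -> scalar_sol mu g dg z ->
  scalar_sol mu (fun z => a * f z + b * g z) (fun z => a * df z + b * dg z) z.
Proof.
move=> [f1 f2] [g1 g2]; split; first exact: (cderD (cderZ a f1) (cderZ b g1)).
by apply: cder_eq (cderD (cderZ a f2) (cderZ b g2)) _; ring.
Qed.

Lemma sol_mx_lin (A : 'M[C]_2) (f df g dg : C -> C) z : A *m sol_mx f df g dg z =
  sol_mx (fun z => A 0 0 * f z + A 0 1 * g z) (fun z => A 0 0 * df z + A 0 1 *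
    dg z)
      (fun z => A 1 0 * f z + A 1 1 * g z) (fun z => A 1 0 * df z + A 1 1 * dg
        z) z.
Proof. by rewrite {1}[A]mx2E /sol_mx mx2_mul. Qed.

Lemma cder_tau z : Rpos z -> z ^+ n != 1 -> cder tau z (tau z * dlog k z).
Proof.
move=> zp z1; have x1 := Rpos_neq zp.
have x2 : 1 - z ^+ n != 0 by rewrite subr_eq0 eq_sym.
have h1 := cderD (cderc 1 z) (cder_zn k z).
have h2 := cderB (cderc 1 z) (cder_zn k z).
have h3 := cderV (f := fun w => 1 + w ^+ n) x1 h1.
apply: cder_eq (cderM h2 h3) _.
rewrite /dlog /tau /= (@expz1 R k z); move: x1 x2.
move: (z ^+ n) (z ^+ k) (n%:R : C) => x P N x1 x2.
have -> : 1 - x ^+ 2 = (1 - x) * (1 + x) by ring.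
by field; rewrite x1 x2.
Qed.

Lemma tau_neq0 z : Rpos z -> z ^+ n != 1 -> tau z != 0.
Proof.
move=> zp z1; have x1 := Rpos_neq zp.
by rewrite mulf_neq0 ?invr_eq0// subr_eq0 eq_sym.
Qed.

Lemma log_tau z0 : Rpos z0 -> z0 ^+ n != 1 -> exists (l : C -> C),
  \forall z \near z0, cexp (l z) = tau z /\ cder l z (dlog k z).
Proof.
move=> zp z1; have t0 := tau_neq0 zp z1; have [l0 lE] := clog_exists t0.
exists (fun z => l0 + clog (tau z / tau z0)).
have hn : hol (fun z : C => z ^+ n) z0 by apply: holX; exact: holid.
have ht : hol (fun z => tau z / tau z0) z0.
  by apply: holM; [exists (tau z0 * dlog k z0); exact: cder_tau|exact: holc].
have q0 : 0 < complex.Re (tau z0 / tau z0) by rewrite mulfV// Re1 ltr01.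
have n1 := near_Re_gt hn zp; have n3 := near_Re_gt ht q0.
have n2 : \forall z \near z0, z ^+ n - 1 != 0.
  by apply: near_neq0; [apply: holB => //; exact: holc|rewrite subr_eq0].
near=> z.
have zp' : Rpos z by near: z.
have z1' : z ^+ n != 1 by rewrite -subr_eq0; near: z.
have tz : 0 < complex.Re (tau z / tau z0) by near: z.
split; first by rewrite cexpD lE cexp_clog// mulrC divfK.
have h := cder_comp (cderM (cder_tau zp' z1') (cderc (tau z0)^-1 z)) (cder_clog
  tz).
apply: cder_eq (cderD (cderc l0 z) h) _.
have tz0 := tau_neq0 zp' z1'; move: (tau z) (tau z0) tz0 t0 => a b a0 b0.
by field; rewrite a0 b0.
Unshelve. all: by end_near. Qed.

Definition frame_sol lam (D : set C) (F : C -> 'M[C]_2) := exists f df g dg,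
  forall z, D z -> [/\ F z = sol_mx f df g dg z, scalar_sol (mu_of lam) f df z &
    scalar_sol (mu_of lam) g dg z].

(** Near z0 a frame can be chosen that consists of solutions; at the roots of
unity this takes a holomorphic logarithm of tau. *)
Lemma frame_local z0 : z0 ^+ n != 1 -> exists2 d0 : R, 0 < d0 &
  exists F : C -> C -> 'M[C]_2, (forall z, cball z0 d0 z -> frame z (F z)) /\
  forall lam, Lambda lam -> frame_sol lam (cball z0 d0) (fun z => F z lam).
Proof.
move=> z1; have hn : hol (fun z : C => z ^+ n) z0 by apply: holX; exact: holid.
have [d0|zp] := disc0_or_Rpos z0.
  have [d dd Hd] := near_cball (near_Re_lt hn d0).
  exists d => //; exists (fun z lam => fund0 (mu_of lam) z); split.
    by move=> z /Hd Dz; left.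
  move=> lam _; exists (b2 k (mu_of lam)), (db2 k (mu_of lam)),
    (b1 k (mu_of lam)),
    (db1 k (mu_of lam)).
  by move=> z /Hd Dz; split; [exact: erefl|exact: scalar_sol2|exact: scalar_sol1].
have [l nl] := log_tau zp z1.
have n1 := near_Re_gt hn zp.
have n2 : \forall z \near z0, z ^+ n - 1 != 0.
  by apply: near_neq0; [apply: holB => //; exact: holc|rewrite subr_eq0].
have [d dd Hd] := near_cball (filterI (filterI n1 n2) nl).
exists d => //; exists (fun z lam => fund1 (exponent lam) (mu_of lam) (l z) z);
  split.
  by move=> z /Hd[[zp' _] [lz _]]; right; split=> //; exists (l z).
move=> lam [om _ _]; have [smu g1 g2 _] := nonres_exponent om.
pose A := invmx (eig_mx k (exponent lam) (mu_of lam)).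
pose f s z := uval k s (l z) z; pose df s z := uder k s (l z) z.
have S z : cball z0 d z -> scalar_sol (mu_of lam) (f (exponent lam)) (df
  (exponent lam)) z /\
    scalar_sol (mu_of lam) (f (1 - exponent lam)) (df (1 - exponent lam)) z.
  move=> /Hd[[zp' z1'] [_ lz]]; rewrite subr_eq0 in z1'.
  by split; apply: scalar_sol_u => //; exact: exponent_sym.
exists (fun z => A 0 0 * f (exponent lam) z + A 0 1 * f (1 - exponent lam) z),
  (fun z => A 0 0 * df (exponent lam) z + A 0 1 * df (1 - exponent lam) z),
  (fun z => A 1 0 * f (exponent lam) z + A 1 1 * f (1 - exponent lam) z),
  (fun z => A 1 0 * df (exponent lam) z + A 1 1 * df (1 - exponent lam) z).
move=> z zd; have [S1 S2] := S _ zd.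
split; [|exact: scalar_sol_lin|exact: scalar_sol_lin].
by rewrite /fund1 -/A /eigframe -[mx2 _ _ _ _]/(sol_mx (f (exponent lam)) (df
  (exponent lam))
  (f (1 - exponent lam)) (df (1 - exponent lam)) z) sol_mx_lin.
Qed.

(** A linear relation with constant coefficients between two frames of solutions
propagates. *)
Lemma frame_sol_cst lam z0 d (F S : C -> 'M[C]_2) (A B : 'M[C]_2) kap z1 z2 :
  frame_sol lam (cball z0 d) F -> frame_sol lam (cball z0 d) S -> kap != 0 ->
  (forall z, cball z0 d z -> \det (S z) = kap) ->
  cball z0 d z1 -> cball z0 d z2 ->
  A *m F z1 = B *m S z1 -> A *m F z2 = B *m S z2.
Proof.
move=> [f [df [g [dg HF]]]] [c [dc [e [de HS]]]] kap0 dS d1 d2.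
have [FE1 _ _] := HF _ d1; have [FE2 _ _] := HF _ d2.
have [SE1 _ _] := HS _ d1; have [SE2 _ _] := HS _ d2.
have H x : cball z0 d x -> cder (fun x : C => x) x 1 /\
    [/\ scalar_sol (mu_of lam) f df x, scalar_sol (mu_of lam) g dg x,
      scalar_sol (mu_of lam) c dc x,
     scalar_sol (mu_of lam) e de x & \det (sol_mx c dc e de x) = kap].
  move=> xd; split; first exact: cderid.
  have [_ ? ?] := HF _ xd; have [SE ? ?] := HS _ xd.
  by split=> //; rewrite -SE; exact: dS.
have cc : cconvex (cball z0 d) by exact: cconvex_ball.
have T := connection_cst cc kap0 d1 H; rewrite FE1 SE1 FE2 SE2 (T _ d1) (T _ d2).
move: (kap^-1 *: _) => {}T; rewrite !mulmxA.
have Su : sol_mx c dc e de z1 \in unitmx by rewrite unitmxE unitfE -SE1 dS.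
by move=> /(can_inj (mulmxK Su)) ->.
Qed.

End LocalFrames.

Section Lifts.
Variables (R : realType) (k : nat) (w : R).
Local Notation n := k.+2.
Variables (E : topologicalType) (p : E -> sphere R).
Local Notation C := (CC R).
Variable Phi : E -> C -> 'M[C]_2.
Hypothesis sol : solution p (xi n w) Phi.
Implicit Types (lam z : C).
Local Notation scalar_sol := (@scalar_sol R k).
Local Notation mu_of := (@mu_of R k w).
Local Notation frame_sol := (@frame_sol R k w).

Lemma xiE lam z : lam != 0 ->
  xi n w lam z = mx2 0 lam^-1 (lam * mu_of lam * qcoef k z) 0.
Proof.
move=> l0; rewrite [LHS]mx2E !mxE/= /mu_of /qcoef [lam * _]mulrC divfK//.
by rewrite !subSS subn0.
Qed.

(** Phi along a section, with the rows (lam b', b) normalised to (b', b). *)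
Definition Phi_section (g : C -> E) lam z := Phi (g z) lam *m mx2 lam^-1 0 0 1.

Lemma section_row g z0 d lam z (i : 'I_2) : section p g (cball z0 d) ->
  cball z0 d z -> lam != 0 ->
  scalar_sol (mu_of lam) (fun z => Phi (g z) lam i 1) (fun z => lam^-1 * Phi (g
    z) lam i 0) z.
Proof.
move=> sg zd l0; have [pz gz] := sg _ zd.
have [F [dF PF]] := sol l0 pz.
have nF : \forall x \near z, F x = Phi (g x) lam.
  apply: filterS2 (cball_nbhs zd) (gz _ PF) => x xd H.
  by have [px _] := sg _ xd; rewrite (H x px).
have dz := nbhs_singleton dF.
have e j : cder (fun x => Phi (g x) lam i j) z ((Phi (g z) lam *m
  xi n w lam z) i j).
  rewrite -(nbhs_singleton nF).
  apply: (cder_near (f := fun x => F x i j)); last exact: mx_cder.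
  by apply: filterS nF => x ->.
have E0 := e 0; have E1 := e 1.
rewrite xiE// !mxE !big_ord_recl !big_ord0 !mxE/= in E0 E1.
split; first by apply: cder_eq E1 _; rewrite mulr0 !addr0 mulrC.
apply: cder_eq (cderZ lam^-1 E0) _; rewrite mulr0 add0r addr0.
have -> : lift ord0 ord0 = 1 :> 'I_2 by apply/val_inj.
by field.
Qed.

Lemma section_frame_sol g z0 d lam : section p g (cball z0 d) -> lam != 0 ->
  frame_sol lam (cball z0 d) (Phi_section g lam).
Proof.
move=> sg l0.
exists (fun z => Phi (g z) lam 0 1), (fun z => lam^-1 * Phi (g z) lam 0 0).
exists (fun z => Phi (g z) lam 1 1), (fun z => lam^-1 * Phi (g z) lam 1 0).
move=> z zd; split; try exact: (section_row _ sg zd l0).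
by rewrite /Phi_section [Phi _ _]mx2E mx2_mul /sol_mx; congr mx2; ring.
Qed.

Lemma Phi_section_det g lam z : lam != 0 -> \det (Phi_section g lam z) =
  lam^-1 * \det (Phi (g z) lam).
Proof. by move=> l0; rewrite det_mulmx mx2_det mulr1 mulr0 subr0 mulrC. Qed.

Lemma section_det g z0 d lam z1 z2 : section p g (cball z0 d) -> lam != 0 ->
  cball z0 d z1 -> cball z0 d z2 ->
  \det (Phi (g z1) lam) = \det (Phi (g z2) lam).
Proof.
move=> sg l0 d1 d2.
pose f i z := Phi (g z) lam i 1; pose df i z := lam^-1 * Phi (g z) lam i 0.
have W : wronsk (f 0) (df 0) (f 1) (df 1) z1 =
  wronsk (f 0) (df 0) (f 1) (df 1) z2.
  apply: (@wronsk_cst R k (mu_of lam) _ _ _ _ (cball z0 d) (fun z => z) (fun=>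
    1)) => //.
    exact: cconvex_ball.
  by move=> x xd; split; [exact: cderid|exact: (section_row 0 sg xd l0)|
    exact: (section_row 1 sg xd l0)].
have DE z : \det (Phi (g z) lam) = - lam * wronsk (f 0) (df 0) (f 1) (df 1) z.
  by rewrite [X in \det X]mx2E mx2_det /wronsk /f /df; field.
by rewrite !DE W.
Qed.

End Lifts.

(** * Unitarisation of the monodromy *)

Section Unitarise.
Variables (R : realType) (k : nat) (w : R).
Hypothesis k_gt0 : (0 < k)%N.
Local Notation n := k.+2.
Hypothesis hw : - (8 * n%:R) / (n%:R - 2) ^+ 2 <= w < 0.
Variables (E : topologicalType) (p : E -> sphere R) (w0 : E).
Local Notation C := (CC R).
Variable Phi : E -> C -> 'M[C]_2.
Hypothesis cov : covering_map p (Sigma R n).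
Hypothesis pc : path_connected R E.
Hypothesis pw0 : p w0 = Some 0.
Hypothesis sol : solution p (xi n w) Phi.
Hypothesis init : forall lam : C, lam != 0 -> Phi w0 lam = 1%:M.
Implicit Types (lam z : C).
Local Notation mu_of := (@mu_of R k w).
Local Notation fund0 := (@fund0 R k).
Local Notation Lambda := (@Lambda R k w).
Local Notation Omega := (@Omega R k w).
Local Notation frame := (@frame R k w).
Local Notation gauge_group := (@gauge_group R k w).
Local Notation Phi_section := (Phi_section Phi).
Local Notation Dlam lam := (mx2 lam^-1 0 0 (1 : C)).
Local Notation gauge := (@gauge R k w).

Lemma Dlam_unit lam : lam != 0 -> Dlam lam \in unitmx.
Proof. by move=> l0; rewrite mx2_unit mulr1 mulr0 subr0 invr_eq0. Qed.

Lemma det_Phi e z lam : p e = Some z -> lam != 0 -> \det (Phi e lam) = 1.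
Proof.
move=> pe l0.
apply: (lift_connected cov pc (Pr := fun e => \det (Phi e lam) = 1) _ pw0 pe).
  move=> z0 _; exists 1; first exact: ltr01.
  by move=> d g _ sg z1 z2 d1 d2 <-; apply/esym; exact: (section_det sol sg l0).
by rewrite init// det1.
Qed.

Lemma section_Phi_det g z0 d lam z : section p g (cball z0 d) -> lam != 0 ->
  cball z0 d z -> \det (Phi_section g lam z) = lam^-1.
Proof. by move=> sg l0 /sg[pz _];
  rewrite Phi_section_det// (det_Phi pz l0) mulr1. Qed.

(** Along a section both sides solve the same equation, and they agree at w0,
where Phi is the identity. *)
Lemma monodromy g : deck_transformation p g ->
  is_monodromy p Phi g (fun lam => Phi (g w0) lam).
Proof.
move=> [pg [g' [cg _ _ _]]] lam l0; split; first by apply: (det_Phi (z := 0));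
  rewrite ?pg.
move=> e z pe.
apply: (lift_connected cov pc
  (Pr := fun e => Phi (g e) lam = Phi (g w0) lam *m Phi e lam) _ pw0 pe);
    last first.
  by rewrite init// mulmx1.
move=> z0 _; exists 1; first exact: ltr01.
move=> d t _ st z1 z2 d1 d2 E1.
have sgs : section p (g \o t) (cball z0 d).
  move=> x /st[px sx]; split; first by rewrite /= pg.
  by apply: cvg_comp sx _; exact: cg.
have lV : lam^-1 != 0 by rewrite invr_eq0.
have := frame_sol_cst (A := 1%:M) (B :=
  Phi (g w0) lam) (section_frame_sol sol sgs l0)
  (section_frame_sol sol st l0) lV (fun x xd => section_Phi_det st l0 xd) d1 d2.
rewrite !mul1mx /Phi_section !mulmxA => H.
by apply: (can_inj (mulmxK (Dlam_unit l0))); apply: H; rewrite /= E1.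
Qed.

(** Phi at e is a frame, up to a left factor in the gauge group and to the
normalisation of rows. *)
Definition framed e := exists2 z, p e = Some z & exists2 N, gauge_group N &
  exists2 F, frame z F & forall lam, Lambda lam ->
    Phi e lam *m Dlam lam = Dlam lam *m (N lam *m F lam).

Lemma Lambda_neq0 lam : Lambda lam -> lam != 0. Proof. by move=> [[]]. Qed.

Lemma frame0 : frame 0 (fun lam => fund0 (mu_of lam) 0).
Proof. by left; split=> //; rewrite /disc0 expr0n/=; lra. Qed.

Lemma gauge_group1 : gauge_group (fun=> 1%:M).
Proof. by rewrite mx2_1; apply: gauge_group_diag; exact: cabs1. Qed.

(** At w0 the frame fund0 and Phi are both the identity. Along a section Phi and
a frame of solutions keep differing by the same constant matrix. *)
Lemma all_framed e z : p e = Some z -> framed e.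
Proof.
move=> pe; apply: (lift_connected cov pc (Pr := framed) _ pw0 pe); last first.
  exists 0 => //; exists (fun=> 1%:M); first exact: gauge_group1.
  exists (fun lam => fund0 (mu_of lam) 0); first exact: frame0.
  by move=> lam /Lambda_neq0 l0; rewrite init// fund0_0 !mulmx1 mul1mx.
move: z {pe} => _ z0 z01; have [d0 d00 [F [frF solF]]] := frame_local w z01.
exists d0 => // d g /andP[_ dd] sg z1 z2 d1 d2 [z pz [N gN [F1 frF1 E1]]].
have [pz1 _] := sg _ d1; have [pz2 _] := sg _ d2.
have zz : z = z1 by move: pz; rewrite pz1 => -[].
rewrite zz in frF1; have dd0 x : cball z0 d x -> cball z0 d0 x.
  by rewrite /cball/= => xd; exact: lt_le_trans dd.
have [N' gN' E'] := frame_unique k_gt0 hw frF1 (frF _ (dd0 _ d1)).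
exists z2 => //; exists (fun lam => N lam *m N' lam).
  exact: gauge_groupM.
exists (F z2); first exact: frF (dd0 _ d2).
move=> lam L; have l0 := Lambda_neq0 L.
have fs : frame_sol k w lam (cball z0 d) (fun z => F z lam).
  have [f [df [c [dc Hf]]]] := solF _ L.
  by exists f, df, c, dc => x /dd0/Hf.
have lV : lam^-1 != 0 by rewrite invr_eq0.
have := frame_sol_cst (A := Dlam lam *m (N lam *m N' lam)) (B := 1%:M) fs
  (section_frame_sol sol sg l0) lV (fun x xd => section_Phi_det sg l0 xd) d1 d2.
rewrite !mul1mx /Phi_section => H.
by rewrite -H ?mulmxA// E1// E'// !mulmxA.
Qed.

Lemma deck_framed g : deck_transformation p g -> exists2 N, gauge_group N &
  forall lam, Lambda lam -> Phi (g w0) lam *m Dlam lam = Dlam lam *m N lam.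
Proof.
move=> [pg _]; have pg0 : p (g w0) = Some 0 by rewrite pg.
have [z pz [N gN [F frF E1]]] := all_framed pg0.
have zz : z = 0 by move: pz; rewrite pg0 => -[].
rewrite zz in frF; have [N' gN' E'] := frame_unique k_gt0 hw frF frame0.
exists (fun lam => N lam *m N' lam); first exact: gauge_groupM.
by move=> lam L; rewrite (E1 _ L) (E' _ L) fund0_0 mulmx1.
Qed.

(** The gauge multiplied by diag(lam, 1), which undoes the normalisation of
rows. *)
Definition full_gauge lam := mx2 (lam * chi k w lam) 0 0 1.

Lemma full_gaugeE lam : lam != 0 -> full_gauge lam *m Dlam lam = gauge lam.
Proof. by move=> l0; rewrite mx2_mul; congr mx2; field. Qed.

Lemma full_gauge_unit lam : Lambda lam -> full_gauge lam \in unitmx.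
Proof.
move=> L; rewrite mx2_unit mulr1 mulr0 subr0 mulf_neq0 ?(Lambda_neq0 L)//.
exact: chi_neq0.
Qed.

Lemma hol_chi lam : Lambda lam -> hol (chi k w) lam.
Proof.
move=> L; have [om _ _] := L; apply: holM; first exact: hol_beta.
apply: holV; first exact: (B01_neq0 k_gt0 hw L).
exact: (hol_comp (hol_mu k w (Lambda_neq0 L)) (hol_B01 k _)).
Qed.

Lemma circleE (r : R) lam : circle r lam -> cabs lam = r.
Proof. by rewrite /circle/= normCE => /complexI. Qed.

Theorem unitarise : unitarisable p Phi.
Proof.
have [r [r01 HO HL]] := radius_exists k_gt0 hw.
exists r, full_gauge; split=> //.
- move=> x /circleE/HL/(Lambda_open k_gt0)/filterS; apply=> y Ly.
  apply: hol_mx => i j; rewrite /full_gauge /mx2; under eq_fun do rewrite !mxE.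
  case: (i == 0); case: (j == 0); try exact: holc.
  by apply: holM; [exact: holid|exact: hol_chi].
- by move=> x /circleE/HL/(Lambda_open k_gt0)/filterS; apply=> y;
  exact: full_gauge_unit.
move=> g dg; exists (fun lam => Phi (g w0) lam); split; first exact: monodromy.
have [N gN EN] := deck_framed dg.
have Nu := gauge_group_unit k_gt0 hw gN.
have [G [c c0 [hG gG uG dG]]] := gN.
have pg0 : p (g w0) = Some 0 by have [-> _] := dg.
(* As Phi has determinant 1, evaluation at lam = r gives the constant. *)
have c1 : c = 1.
  have Lr : Lambda (r%:C)%C.
    by apply: HL; rewrite cabsR ger0_norm//; case/andP: r01 => /ltW.
  have [om _ _] := Lr; have l0 := Lambda_neq0 Lr.
  have h0 : \det (gauge (r%:C)%C) != 0.
    by have := gauge_unit k_gt0 hw Lr; rewrite unitmxE unitfE.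
  have D0' : \det (Dlam (r%:C)%C) != 0 by have := Dlam_unit l0;
    rewrite unitmxE unitfE.
  have N1 : \det (N (r%:C)%C) = 1.
    have /(congr1 (fun M => \det M)) := EN _ Lr.
    rewrite !det_mulmx (det_Phi pg0 l0) mul1r => E1.
    by apply: (mulfI D0'); rewrite -E1 mulr1.
  have /(congr1 (fun M => \det M)) := gG _ Lr.
  by rewrite !det_mulmx N1 dG// mulr1 -[LHS]mul1r => /(mulIf h0) <-.
exists G; split.
- move=> x /= /andP[h1 h2]; rewrite !normCE !lecR in h1 h2.
  have om : Omega x by apply: HO; rewrite h1 h2.
  apply: filterS (Omega_open k_gt0 om) => y oy; apply: hol_mx => i j; exact: hG.
- move=> x /circleE/HL/(Lambda_open k_gt0)/filterS; apply=> y Ly.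
  have l0 := Lambda_neq0 Ly; have hu := full_gauge_unit Ly.
  apply: (can_inj (mulmxK hu)); rewrite mulmxKV//.
  apply: (can_inj (mulmxK (Dlam_unit l0))).
  by rewrite -!mulmxA EN// full_gaugeE// -gG// mulmxA full_gaugeE.
- move=> lam; rewrite normCE => /(@complexI R) l1.
  by split; [exact: uG|rewrite dG ?c1//; exact: Omega_unit].
Qed.

End Unitarise.

Theorem theorem5p1 (R : realType) (n : nat) (w : R)
    (E : topologicalType) (p : E -> sphere R) (w0 : E)
    (Phi : E -> CC R -> 'M[CC R]_2) :
  (3 <= n)%N ->
  - (8 * n%:R) / (n%:R - 2) ^+ 2 <= w < 0 ->
  universal_covering R p (Sigma R n) ->
  p w0 = Some 0 ->
  solution p (xi n w) Phi ->
  (forall lam : CC R, lam != 0 -> Phi w0 lam = 1%:M) ->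
  unitarisable p Phi.
Proof.
case: n => [|[|k]] // k_gt0 hw [cov [pc _]] pw0 sol init.
exact: (unitarise k_gt0 hw cov pc pw0 sol init).
Qed.
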